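(* Let $p > 3$ be a prime and let $K_{\mathfrak p}$ be a finite extension of $\mathbb{Q}_p$ with residue field $\mathbb{F}_q$. Then for monic cubic polynomials with coefficients in $\mathfrak{O}_{\mathfrak p}$, $$\nu_{3,\mathfrak p}\left(P_{3,\mathfrak p}(\mathrm{id})\right) = \nu_{3,\mathfrak p}\left(P_{3,\mathfrak p}(1,1,1)\right) = \frac16 - \frac{3q^4+q^3+2q^2+2q+1}{6(q+1)(q^4+q^3+q^2+q+1)},$$ $$\nu_{3,\mathfrak p}\left(P_{3,\mathfrak p}(\mathbb{Z}/2\mathbb{Z})\right) = \nu_{3,\mathfrak p}\left(P_{3,\mathfrak p}(2,1)\right) = \frac12 + \frac{q^4-q^3-1}{2(q+1)(q^4+q^3+q^2+q+1)},$$ $$\nu_{3,\mathfrak p}\left(P_{3,\mathfrak p}(3)\right) = \frac13 + \frac{2q^2-q+2}{3(q^4+q^3+q^2+q+1)},$$ and $$\nu_{3,\mathfrak p}\left(P_{3,\mathfrak p}(\mathbb{Z}/3\mathbb{Z})\right) = \frac13 - \frac{q^2+q+1}{3(q^4+q^3+q^2+q+1)} + \frac12\left(1+\left(\frac{q}{3}\right)\right)\frac{q^2+1}{q^4+q^3+q^2+q+1},$$ $$\nu_{3,\mathfrak p}\left(P_{3,\mathfrak p}(S_3)\right) = \frac12\left(1-\left(\frac{q}{3}\right)\right)\frac{q^2+1}{q^4+q^3+q^2+q+1}.$$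
   Context: $\mathfrak{O}_{\mathfrak p}$ is the ring of integers of $K_{\mathfrak p}$. $\nu_{3,\mathfrak p}$ is the product measure on $(\mathfrak{O}_{\mathfrak p})^3$ of the additive Haar measure on $\mathfrak{O}_{\mathfrak p}$ normalized to total mass $1$. A tuple $(a_0,a_1,a_2) \in (\mathfrak{O}_{\mathfrak p})^3$ is identified with the monic polynomial $f(x) = x^3 + a_2x^2 + a_1 x + a_0$. For a partition $\mu \in \{(1,1,1),(2,1),(3)\}$ of $3$, $P_{3,\mathfrak p}(\mu)$ is the set of tuples whose polynomial is square-free and whose monic irreducible factors over $\mathfrak{O}_{\mathfrak p}$ (equivalently over $K_{\mathfrak p}$) have degrees the parts of $\mu$. For a group $G$ among $\mathrm{id}$ (trivial), $\mathbb{Z}/2\mathbb{Z}$, $\mathbb{Z}/3\mathbb{Z}$, $S_3$, $P_{3,\mathfrak p}(G)$ is the set of tuples for which the Galois group over $K_{\mathfrak p}$ of the splitting field of $f$ is isomorphic to $G$. (Polynomials with repeated roots form a null set.) $\left(\frac{q}{3}\right)$ is the Legendre symbol, equal to $1$ if $q \equiv 1 \pmod 3$ and $-1$ if $q \equiv 2 \pmod 3$. *)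

(* Defs.v *)
From HB Require Import structures.
From mathcomp Require Import all_boot all_order all_algebra all_fingroup.
From mathcomp Require Import all_solvable all_field.
From mathcomp Require Import all_classical all_reals all_analysis.

Set Implicit Arguments.
Unset Strict Implicit.
Unset Printing Implicit Defensive.

Import Order.TTheory GRing.Theory Num.Theory.
Local Open Scope classical_set_scope.
Local Open Scope ring_scope.

Record nonarch_absval (R : realType) (F : fieldType) := NonarchAbsval {
  absval :> F -> R;
  absval_ge0 : forall x, 0 <= absval x;
  absval_eq0 : forall x, absval x = 0 -> x = 0;
  absval0 : absval 0 = 0;
  absvalM : forall x y, absval (x * y) = absval x * absval y;
  absval_ultra : forall x y, absval (x + y) <= Num.max (absval x) (absval y)
}.

Definition rat_padic_val (p : nat) (x : rat) : int :=
  (logn p `|numq x|%N)%:Z - (logn p `|denq x|%N)%:Z.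

Definition rat_padic_abs (R : realType) (p : nat) (x : rat) : R :=
  if x == 0 then 0 else p%:R ^ (- rat_padic_val p x).

(* [F], with absolute value [v], is the completion of the rationals for the
   p-adic absolute value; such a valued field is unique up to a unique
   isometric isomorphism.  [padic_rat] forces [F] to have characteristic 0,
   so that [ratr] is indeed a field embedding. *)
Record is_padic_field (R : realType) (p : nat) (F : fieldType)
    (v : nonarch_absval R F) : Prop := IsPadicField {
  padic_rat : forall x : rat, v (ratr x) = rat_padic_abs R p x;
  padic_dense : forall (x : F) (e : R), 0 < e ->
    exists r : rat, v (x - ratr r) < e;
  padic_complete : forall u : nat -> F,
    (forall e : R, 0 < e ->
       exists N, forall m n, (N <= m)%N -> (N <= n)%N -> v (u m - u n) < e) ->
    exists l : F, forall e : R, 0 < e ->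
       exists N, forall n, (N <= n)%N -> v (u n - l) < e
}.

Section AbsvalTheory.
Variables (R : realType) (F : fieldType) (v : nonarch_absval R F).

Lemma absval1 : v 1 = 1.
Proof.
have v1 : v 1 != 0 by apply/eqP => /absval_eq0/eqP; rewrite oner_eq0.
by apply: (mulfI v1); rewrite -absvalM !mulr1.
Qed.

Lemma absvalN x : v (- x) = v x.
Proof.
have h : v (-1) = 1.
  have /eqP : v (-1) ^+ 2 = 1 by rewrite expr2 -absvalM mulrNN mulr1 absval1.
  rewrite sqrf_eq1 => /orP[/eqP//|/eqP h].
  by have := absval_ge0 v (-1); rewrite h oppr_ge0 ler10.
by rewrite -mulN1r absvalM h mul1r.
Qed.

Definition in_integers : {pred F} := [pred x | v x <= 1].

Fact in_integers_subring : subring_closed in_integers.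
Proof.
split=> [|x y|x y]; rewrite !inE ?absval1 // => hx hy.
  apply: (le_trans (absval_ultra _ _ _)).
  by rewrite absvalN ge_max hx hy.
by rewrite absvalM mulr_ile1 ?absval_ge0.
Qed.

HB.instance Definition _ :=
  GRing.isSubringClosed.Build F in_integers in_integers_subring.

End AbsvalTheory.

(* The valuation ring; for a finite extension of a p-adic field it is the
   integral closure of the p-adic integers. *)
Record integers (R : realType) (F : fieldType) (v : nonarch_absval R F) :=
  Integers { integer_val :> F; integer_valP : integer_val \in in_integers v }.

Section Integers.
Variables (R : realType) (F : fieldType) (v : nonarch_absval R F).
Local Notation O := (integers v).

HB.instance Definition _ := [isSub for @integer_val R F v].
HB.instance Definition _ := [Choice of O by <:].
HB.instance Definition _ := [SubChoice_isSubComNzRing of O by <:].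
HB.instance Definition _ := isPointed.Build O 0.

Definition max_ideal : {pred O} := [pred x : O | v (val x) < 1].

Fact max_ideal_closed : idealr_closed max_ideal.
Proof.
split=> [||a x y]; rewrite !inE /=.
- by rewrite absval0 ltr01.
- by rewrite absval1 ltxx.
move=> hx hy; apply: (le_lt_trans (absval_ultra _ _ _)).
rewrite gt_max hy andbT absvalM (le_lt_trans _ hx) //.
by rewrite ler_piMl ?absval_ge0 //; exact: (valP a).
Qed.

HB.instance Definition _ := isIdealr.Build O max_ideal max_ideal_closed.

Definition residue_field := {ideal_quot max_ideal}.

Definition integers_open : set (set O) :=
  [set U | forall x, U x -> exists2 e : R, 0 < e &
             forall y : O, v (val y - val x) < e -> U y].

HB.instance Definition _ := @isMeasurable.Build (sigma_display integers_open) O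
  <<s integers_open >> (@sigma_algebra0 _ setT integers_open)
  (@sigma_algebraC _ integers_open) (@sigma_algebra_bigcup _ setT integers_open).

(* Translation invariance and total mass 1 (part of [probability]) determine
   the normalized Haar measure. *)
Definition is_haar (mu : probability O R) : Prop :=
  forall (a : O) (A : set O), measurable A ->
    mu [set a + x | x in A] = mu A.

Definition cubic (a : O * O * O) : {poly F} :=
  'X^3 + (val a.2) *: 'X^2 + (val a.1.2) *: 'X + (val a.1.1)%:P.

End Integers.

Definition square_free (F : fieldType) (f : {poly F}) : Prop :=
  forall g : {poly F}, g ^+ 2 %| f -> size g = 1%N.

Definition has_factor_degrees (F : fieldType) (f : {poly F}) (mu : seq nat) :=
  exists s : seq {poly F},
    [/\ forall g, g \in s -> g \is monic /\ irreducible_poly g,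
        f = \prod_(g <- s) g
      & perm_eq [seq (size (g : {poly F})).-1 | g <- s] mu].

Definition has_galois_group (F : fieldType) (f : {poly F})
    (gT : finGroupType) (G : {group gT}) : Prop :=
  exists L : splittingFieldType F,
    splittingFieldFor 1 (map_poly (in_alg L) f) {:L} /\
    'Gal({:L} / 1) \isog G.

(* Factorization is taken over the field: by Gauss's lemma the monic irreducible
   factors of a monic polynomial over the valuation ring are the same. *)
Section CubicSets.
Variables (R : realType) (F : fieldType) (v : nonarch_absval R F).

Definition P3_part (mu : seq nat) : set (integers v * integers v * integers v) :=
  [set a | square_free (cubic a) /\ has_factor_degrees (cubic a) mu].

Definition P3_gal (gT : finGroupType) (G : {group gT}) :
    set (integers v * integers v * integers v) :=
  [set a | has_galois_group (cubic a) G].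

End CubicSets.

Arguments P3_part {R F} v mu _.
Arguments P3_gal {R F} v {gT} G _.

(* The prime [l] is meant to be odd. *)
Definition legendre (a l : nat) : int :=
  if (l %| a)%N then 0
  else if [exists x : 'I_l, (x ^ 2 == a %[mod l])%N] then 1 else -1.

(* Main.v *)
Require Import Defs.
From HB Require Import structures.
From mathcomp Require Import all_boot all_order all_algebra all_fingroup.
From mathcomp Require Import all_solvable all_field.
From mathcomp Require Import all_classical all_reals all_analysis.
From mathcomp Require Import ring zify.

(** As 3 is a unit, the translation x -> x - a2/3 brings a monic cubic to the
    form x^3 + bx + c; on coefficients it is a composition of shears, so it
    preserves Haar measure ([measure_depress]).  All the properties at stake
    then depend on two questions about the pair (c, b): does the cubic have a
    root in K, and is its discriminant -4b^3 - 27c^2 a square in K?  The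
    answers determine the degrees of the irreducible factors ([factors111],
    [factors21], [factors3]), and also the degree of the splitting field,
    which is 1, 2, 3 or 6 ([card_galois]); a cubic with vanishing discriminant
    splits, and these cubics form a null set ([pair_disc0]).

    Let w be a uniformizer.  The dilation (c, b) -> (w^3 c, w^2 b) corresponds
    to x -> wx, hence keeps both answers, and it divides measures by q^5.  So
    the measure of a type is its measure outside the image of the dilation,
    divided by 1 - q^-5 ([measure_invariant]).  Outside this image there are
    three possibilities ([residue_cases], [deep_cases]).

    If the discriminant is a unit, Hensel's lemma reduces both questions to
    the residue field, where the answers are counted by pairing cubics with
    their roots ([card_cubics_split], [card_cubics_quad], [card_cubics_irr]);
    irreducible cubics over a finite field have square discriminant since the
    Frobenius permutes the roots cyclically ([finite_noroot_square]).

    If the discriminant is not a unit but b is, the simple root of the reduced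
    cubic lifts.  For fixed b the discriminant maps the residue class of c
    isometrically onto the maximal ideal, so it is uniformly distributed there
    ([mu_disc_fiber]), and the measure of the nonzero squares follows from
    their own self-similarity under multiplication by w^2 ([square_massE]).

    If b and c both lie in the maximal ideal, the Newton polygon decides: for
    v(c) = 1, or v(c) = 2 and v(b) >= 2, there is no root and the discriminant
    is -3 times a square up to a factor congruent to 1; for v(b) = 1 and
    v(c) >= 2 there is a root and the discriminant has odd valuation.  Finally
    -3 is a square in the residue field exactly when q = 1 modulo 3
    ([neg3_square]), which is where the Legendre symbol enters.

    These arguments use that K is complete and discretely valued with finite
    residue field; the first two facts are derived from the finiteness of the
    degree over the p-adic field ([extension_complete],
    [exists_uniformizer]). *)

Set Implicit Arguments.
Unset Strict Implicit.
Unset Printing Implicit Defensive.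

Import Order.TTheory GRing.Theory Num.Theory.
Local Open Scope ring_scope.

(** * Depressed cubics: roots and discriminant *)

Definition disc3 (A : comPzRingType) (b c : A) : A :=
  - (4%:R * b ^+ 3 + 27%:R * c ^+ 2).

Definition is_root3 (A : comPzRingType) (b c x : A) : Prop :=
  x ^+ 3 + b * x + c = 0.

Definition has_root3 (A : comPzRingType) (b c : A) : Prop :=
  exists x, is_root3 b c x.

Definition is_square (A : comPzRingType) (x : A) : Prop :=
  exists y, x = y ^+ 2.

(** The roots y1, y2, y3 of a depressed cubic sum to 0, so y3 is determined by
    the other two; stating it this way keeps all identities in two variables. *)
Definition splits3 (A : comPzRingType) (b c y1 y2 y3 : A) : Prop :=
  [/\ y3 = - y1 - y2, b = - (y1 ^+ 2 + y1 * y2 + y2 ^+ 2)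
    & c = y1 * y2 * (y1 + y2)].

Section CubicAlgebra.
Variable (A : comNzRingType).
Implicit Types b c x y : A.

(** Dividing by x - r leaves a quadratic factor of discriminant -3r^2 - 4b whose
    value at r is 3r^2 + b; the discriminant of a product is the product of the
    discriminants with the square of the resultant. *)
Lemma disc3_root b c x : is_root3 b c x ->
  disc3 b c = (- 3%:R * x ^+ 2 - 4%:R * b) * (3%:R * x ^+ 2 + b) ^+ 2.
Proof.
rewrite /is_root3 /disc3 => h.
have -> : c = - (x ^+ 3 + b * x) by rewrite -[LHS]subr0 -h; ring.
by ring.
Qed.

Lemma disc3_splits b c y1 y2 y3 : splits3 b c y1 y2 y3 ->
  disc3 b c = ((y1 - y2) * (y2 - y3) * (y3 - y1)) ^+ 2.
Proof. by case=> -> -> ->; rewrite /disc3; ring. Qed.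

Lemma splits3_factor b c y1 y2 y3 x : splits3 b c y1 y2 y3 ->
  x ^+ 3 + b * x + c = (x - y1) * (x - y2) * (x - y3).
Proof. by case=> -> -> ->; ring. Qed.

Lemma splits3_rot b c y1 y2 y3 : splits3 b c y1 y2 y3 -> splits3 b c y2 y3 y1.
Proof. by case=> -> -> ->; split; ring. Qed.

Lemma splits3_root b c y1 y2 y3 : splits3 b c y1 y2 y3 -> is_root3 b c y1.
Proof. by move=> /splits3_factor h; rewrite /is_root3 h subrr !mul0r. Qed.

End CubicAlgebra.

Section CubicField.
Variable F : fieldType.
Hypotheses (h2 : 2%:R != 0 :> F) (h3 : 3%:R != 0 :> F).
Implicit Types b c x y : F.

(** By [disc3_root] the quadratic cofactor of x has square discriminant, unless
    3x^2 + b = 0, in which case x is a double root. *)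
Lemma root_square_splits b c x : is_root3 b c x -> is_square (disc3 b c) ->
  exists y2 y3, splits3 b c x y2 y3.
Proof.
move=> hx [d hd]; have := disc3_root hx; rewrite hd => E.
have hc : c = - (x ^+ 3 + b * x).
  by rewrite -[LHS]subr0 -[X in _ - X]hx; ring.
have [e0|e0] := eqVneq (3%:R * x ^+ 2 + b) 0.
  have hb : b = - (3%:R * x ^+ 2) by rewrite -[LHS]subr0 -[X in _ - X]e0; ring.
  by exists x, (- 2%:R * x); split; rewrite ?hc ?hb; ring.
pose e := d / (3%:R * x ^+ 2 + b).
have he : e ^+ 2 = - 3%:R * x ^+ 2 - 4%:R * b by rewrite /e expr_div_n E mulfK ?expf_neq0.
have hb : b = - (e ^+ 2 + 3%:R * x ^+ 2) / 4%:R.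
  have four_neq0 : 4%:R != 0 :> F by rewrite (natrM _ 2 2) mulf_neq0.
  by rewrite he; field; rewrite four_neq0.
exists ((- x + e) / 2%:R), ((- x - e) / 2%:R).
split; rewrite ?hc ?hb; field; rewrite ?h2 //.
all: by rewrite (natrM _ 2 2) mulf_neq0.
Qed.

Lemma splits3_eq0 b c y1 y2 y3 x : splits3 b c y1 y2 y3 -> is_root3 b c x ->
  [|| x == y1, x == y2 | x == y3].
Proof.
move=> /splits3_factor h; rewrite /is_root3 h => /eqP.
by rewrite !mulf_eq0 !subr_eq0 -orbA.
Qed.

(** The double root is rational in the coefficients: it equals -3c/(2b) when b is
    nonzero. *)
Lemma disc3_eq0_splits b c : disc3 b c = 0 ->
  exists y, splits3 b c y y (- 2%:R * y).
Proof.
rewrite /disc3 => h; have [b0|b0] := eqVneq b 0.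
  have : (3%:R * c) ^+ 2 * 3%:R = 0.
    by rewrite -[RHS]oppr0 -h b0; ring.
  move/eqP; rewrite mulf_eq0 (negPf h3) orbF expf_eq0 /= mulf_eq0 (negPf h3) /=.
  by move=> /eqP ->; exists 0; split; rewrite ?b0; ring.
pose y := - (3%:R * c) / (2%:R * b).
have hc : c = - (2%:R * b * y) / 3%:R.
  by rewrite /y; field; rewrite b0 h2 h3.
have four_neq0 : 4%:R != 0 :> F by rewrite (natrM _ 2 2) mulf_neq0.
have : (4%:R * b ^+ 2) * (b + 3%:R * y ^+ 2) = 0.
  by rewrite -[RHS]oppr0 -h [in RHS]hc; field.
move/eqP; rewrite !mulf_eq0 (negPf four_neq0) /= (negPf b0) /= addr_eq0 => /eqP hb.
by exists y; split; rewrite ?hc ?hb; field.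
Qed.

End CubicField.

(** * Factorization types of a cubic over a field *)

Definition monic_cubic (A : comNzRingType) (a0 a1 a2 : A) : {poly A} :=
  'X^3 + a2 *: 'X^2 + a1 *: 'X + a0%:P.

(** This is (x+s)^3 + b(x+s) + c, expanded; every monic cubic has this form when
    3 is invertible. *)
Definition shifted_cubic (A : comNzRingType) (s b c : A) : {poly A} :=
  monic_cubic (c + b * s + s ^+ 3) (b + 3%:R * s ^+ 2) (3%:R * s).

Section MonicCubic.
Variable A : comNzRingType.
Implicit Types s b c x y : A.

Lemma size_monic_cubic (a0 a1 a2 : A) : size (monic_cubic a0 a1 a2) = 4%N.
Proof.
rewrite /monic_cubic -!addrA size_polyDl size_polyXn // -mul_polyC.
rewrite (leq_ltn_trans (size_polyD _ _)) // gtn_max.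
rewrite (leq_ltn_trans (size_polyMleq _ _)) ?size_polyXn ?addnS ?addn0 /=; last first.
  by rewrite size_polyC; case: eqP.
rewrite (leq_ltn_trans (size_polyD _ _)) // gtn_max -mul_polyC.
rewrite (leq_ltn_trans (size_polyMleq _ _)) ?size_polyX ?addnS ?addn0 /=; last first.
  by rewrite size_polyC; case: eqP.
by rewrite size_polyC; case: eqP.
Qed.

Lemma coef_monic_cubic (a0 a1 a2 : A) :
  [/\ (monic_cubic a0 a1 a2)`_0 = a0, (monic_cubic a0 a1 a2)`_1 = a1,
      (monic_cubic a0 a1 a2)`_2 = a2 & (monic_cubic a0 a1 a2)`_3 = 1].
Proof.
by rewrite /monic_cubic; split; rewrite !(coefE, coefXn) /= ?mulr0 ?mulr1 ?add0r ?addr0.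
Qed.

Lemma monic_monic_cubic (a0 a1 a2 : A) : monic_cubic a0 a1 a2 \is monic.
Proof.
by rewrite monicE lead_coefE size_monic_cubic; have [_ _ _ ->] := coef_monic_cubic a0 a1 a2.
Qed.

Lemma monic_cubic_inj (a0 a1 a2 b0 b1 b2 : A) :
  monic_cubic a0 a1 a2 = monic_cubic b0 b1 b2 -> [/\ a0 = b0, a1 = b1 & a2 = b2].
Proof.
move=> e; have [p0 p1 p2 _] := coef_monic_cubic a0 a1 a2.
have [q0 q1 q2 _] := coef_monic_cubic b0 b1 b2.
by split; [rewrite -p0 -q0 e | rewrite -p1 -q1 e | rewrite -p2 -q2 e].
Qed.

Lemma horner_shifted s b c y :
  (shifted_cubic s b c).[y - s] = y ^+ 3 + b * y + c.
Proof. by rewrite /shifted_cubic /monic_cubic !(hornerD, hornerZ, hornerXn, hornerX, hornerC); ring. Qed.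

Lemma deriv_shifted s b c y :
  (shifted_cubic s b c)^`().[y - s] = 3%:R * y ^+ 2 + b.
Proof. by rewrite /shifted_cubic /monic_cubic !(derivD, derivZ, derivXn, derivX, derivC) !(hornerD, hornerMn, hornerZ, hornerXn, hornerX, hornerC) /=; ring. Qed.

Lemma size_monic_quadratic (u w : A) : size ('X^2 + u *: 'X + w%:P) = 3%N.
Proof.
rewrite -addrA size_polyDl size_polyXn // (leq_ltn_trans (size_polyD _ _)) //.
rewrite gtn_max -mul_polyC (leq_ltn_trans (size_polyMleq _ _)) /=.
  by rewrite size_polyC; case: eqP.
by rewrite size_polyX addn2 /= size_polyC; case: eqP.
Qed.

Lemma monic_size2 (g : {poly A}) : g \is monic -> size g = 2%N ->
  g = 'X - (- g`_0)%:P.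
Proof.
move=> gm sg; rewrite polyCN opprK; apply/polyP => i; rewrite !coefE.
case: i => [|[|i]] /=; rewrite ?add0r ?addr0 //.
  by move: gm; rewrite monicE lead_coefE sg => /eqP.
by rewrite nth_default // sg.
Qed.

Lemma prod3_cubic x1 x2 x3 :
  ('X - x1%:P) * ('X - x2%:P) * ('X - x3%:P) =
  monic_cubic (- (x1 * x2 * x3)) (x1 * x2 + x1 * x3 + x2 * x3) (- (x1 + x2 + x3)).
Proof. by rewrite /monic_cubic -!mul_polyC; ring. Qed.

Lemma splits3_prod s b c y1 y2 y3 : splits3 b c y1 y2 y3 ->
  shifted_cubic s b c =
  ('X - (y1 - s)%:P) * ('X - (y2 - s)%:P) * ('X - (y3 - s)%:P).
Proof.
by case=> -> -> ->; rewrite prod3_cubic /shifted_cubic; congr monic_cubic; ring.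
Qed.

(** Vieta's formulas, read on the depressed form. *)
Lemma prod_splits3 s b c x1 x2 x3 :
  shifted_cubic s b c = ('X - x1%:P) * ('X - x2%:P) * ('X - x3%:P) ->
  splits3 b c (x1 + s) (x2 + s) (x3 + s).
Proof.
rewrite prod3_cubic => /monic_cubic_inj[e0 e1 e2].
have x3E : x3 = - 3%:R * s - x1 - x2 by rewrite mulNr e2; ring.
have bE : b = x1 * x2 + x1 * x3 + x2 * x3 - 3%:R * s ^+ 2 by rewrite -e1; ring.
have cE : c = - (x1 * x2 * x3) - b * s - s ^+ 3 by rewrite -e0; ring.
by split; rewrite ?cE ?bE ?x3E; ring.
Qed.

End MonicCubic.

Section FactorTypes.
Variable F : fieldType.
Hypotheses (h2 : 2%:R != 0 :> F) (h3 : 3%:R != 0 :> F).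
Variables s b c : F.
Let f := shifted_cubic s b c.

Lemma root_shifted y : root f (y - s) <-> is_root3 b c y.
Proof. by rewrite /root horner_shifted; split=> /eqP. Qed.

Lemma shifted_neq0 : f != 0.
Proof. by rewrite -size_poly_gt0 size_monic_cubic. Qed.

(** A square factor of positive degree of a cubic is the square of a linear one, so
    it yields a common root of the cubic and of its derivative. *)
Lemma square_free_disc : square_free f <-> disc3 b c != 0.
Proof.
split=> [sf|d0].
  apply/eqP => /(disc3_eq0_splits h2 h3)[y /(splits3_prod s) e].
  have /sf : ('X - (y - s)%:P) ^+ 2 %| f by rewrite /f e -expr2 dvdp_mulr.
  by rewrite size_XsubC.
move=> g gf; have g0 : g != 0.
  by apply: contraTneq gf => ->; rewrite expr0n /= dvd0p shifted_neq0.
have := dvdp_leq shifted_neq0 gf; rewrite size_monic_cubic expr2 size_mul // => hs.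
have : (0 < size g)%N by rewrite size_poly_gt0.
case e: (size g) hs => [|[|[|n]]] // hs _; last by move: hs; rewrite /=; lia.
have [x gx] : exists x, root g x by have [x gx] := poly2_root e; exists x.
have [h eh] := factor_theorem _ _ gx.
have /dvdpP[k ek] := gf.
have fx : is_root3 b c (x + s).
  by apply/root_shifted; rewrite addrK ek expr2 !rootM gx !orbT.
have f'x : 3%:R * (x + s) ^+ 2 + b = 0.
  by rewrite -(deriv_shifted s b c) -/f ek eh addrK !(derivM, derivB, derivX, derivC, derivXn, deriv_exp) !(hornerM, hornerD, hornerN, hornerX, hornerC, hornerMn) subrr; ring.
by move: d0; rewrite (disc3_root fx) f'x expr0n mulr0 eqxx.
Qed.

Lemma irreducible_size3_noroot (g : {poly F}) x :
  irreducible_poly g -> (2 < size g)%N -> ~~ root g x.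
Proof.
move=> [_ irr] sg; apply/negP => gx.
have := irr ('X - x%:P); rewrite size_XsubC dvdp_XsubCl gx => /(_ isT isT).
by move/eqp_size; rewrite size_XsubC => e; rewrite -e in sg.
Qed.

(** Once one root is known, the remaining two are rational exactly when the
    discriminant is a square. *)
Lemma factors111 : has_factor_degrees f [:: 1; 1; 1]%N <->
  has_root3 b c /\ is_square (disc3 b c).
Proof.
split=> [[gs [gsP fE pe]]|[[y hy] sq]].
  have := perm_size pe; rewrite size_map; case: gs gsP fE pe => [|g1[|g2[|g3[|]]]]// gsP fE pe _.
  have lin g : g \in [:: g1; g2; g3] -> exists x, g = 'X - x%:P.
    move=> gin; have [gm _] := gsP _ gin.
    have : (size g).-1 \in [:: 1; 1; 1]%N by rewrite -(perm_mem pe); apply: (map_f (fun g : {poly F} => (size g).-1)).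
    rewrite !inE orbb orbb => /eqP sg1.
    have sg : size g = 2%N by move: sg1; case: (size g) => [|[|[]]].
    by exists (- g`_0); exact: monic_size2.
  have [x1 e1] := lin g1 (mem_head _ _).
  have [x2 e2] : exists x, g2 = 'X - x%:P by apply: lin; rewrite !inE eqxx orbT.
  have [x3 e3] : exists x, g3 = 'X - x%:P by apply: lin; rewrite !inE eqxx !orbT.
  move: fE; rewrite !big_cons big_nil mulr1 e1 e2 e3 mulrA => /prod_splits3 sp.
  split; first by exists (x1 + s); exact: splits3_root sp.
  by eexists; exact: disc3_splits sp.
have [y2 [y3 sp]] := root_square_splits h2 hy sq.
exists [:: 'X - (y - s)%:P; 'X - (y2 - s)%:P; 'X - (y3 - s)%:P]; split.
- move=> g; rewrite !inE => /or3P[] /eqP ->; split; rewrite ?monicXsubC //;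
  by apply: irredp_XsubC.
- by rewrite !big_cons big_nil mulr1 mulrA; exact: splits3_prod.
- by rewrite /= !size_XsubC.
Qed.

Lemma factors3 : has_factor_degrees f [:: 3]%N <-> ~ has_root3 b c.
Proof.
split=> [[gs [gsP fE pe]] [y hy]|nr].
  have := perm_size pe; rewrite size_map; case: gs gsP fE pe => [|g[|]]// gsP fE pe _.
  have [_ irr] := gsP g (mem_head _ _).
  have fy : root f (y - s) by apply/root_shifted.
  rewrite fE big_seq1 in fy.
  move: fy; apply/negP; apply: irreducible_size3_noroot => //.
  by have := size_monic_cubic (c + b * s + s ^+ 3) (b + 3%:R * s ^+ 2) (3%:R * s);
     rewrite -/(shifted_cubic s b c) -/f fE big_seq1 => ->.
exists [:: f]; split.
- move=> g; rewrite inE => /eqP ->; split; first exact: monic_monic_cubic.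
  apply: cubic_irreducible; first by rewrite size_monic_cubic.
  move=> x; apply/negP => fx; apply: nr; exists (x + s); apply/root_shifted.
  by rewrite addrK.
- by rewrite big_seq1.
- by rewrite /= size_monic_cubic.
Qed.

(** A square discriminant together with a root would split the cubic, so the
    quadratic factor would have a root. *)
Lemma factors21 : has_factor_degrees f [:: 2; 1]%N <->
  has_root3 b c /\ ~ is_square (disc3 b c).
Proof.
split=> [[gs [gsP fE pe]]|[[y hy] nsq]].
  have := perm_size pe; rewrite size_map; case: gs gsP fE pe => [|g1[|g2[|]]]// gsP fE pe _.
  have [g [h [gin sg sh fgh]]] : exists g h : {poly F}, [/\ g \in [:: g1; g2],
      size g = 3%N, size h = 2%N & f = g * h].
    have := perm_mem pe 2%N; have := perm_mem pe 1%N.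
    rewrite /= !inE /= => o1 o2; move: fE; rewrite !big_cons big_nil mulr1 => fE.
    move: o1 o2; case e1: (size g1) => [|[|[|[|n1]]]]; case e2: (size g2) => [|[|[|[|n2]]]] //= _ _.
      by exists g2, g1; split; rewrite ?inE ?eqxx ?orbT // mulrC.
    by exists g1, g2; split; rewrite ?inE ?eqxx ?orbT.
  have [_ irr] := gsP g gin.
  have [x hx] : exists x, root h x by have [x hx] := poly2_root sh; exists x.
  have rx : is_root3 b c (x + s) by apply/root_shifted; rewrite addrK fgh rootM hx orbT.
  split; first by exists (x + s).
  move=> sq; have [y2 [y3 sp]] := root_square_splits h2 rx sq.
  have : g %| f by rewrite fgh dvdp_mulr.
  have cop z : coprimep g ('X - z%:P).
    by rewrite coprimep_XsubC irreducible_size3_noroot // sg.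
  rewrite /f (splits3_prod s sp) !Gauss_dvdpr ?coprimepMr ?cop //.
  by move=> /dvdp_leq; rewrite polyXsubC_eq0 sg size_XsubC => /(_ isT).
have fy : root f (y - s) by apply/root_shifted.
have [g eg] := factor_theorem _ _ fy.
have g0 : g != 0 by apply: contraNneq shifted_neq0; rewrite eg => ->; rewrite mul0r.
have gm : g \is monic.
  by have := monic_monic_cubic (c + b * s + s ^+ 3) (b + 3%:R * s ^+ 2) (3%:R * s);
    rewrite -/(shifted_cubic s b c) -/f eg monicMr // monicXsubC.
have sg : size g = 3%N.
  have := size_monic_cubic (c + b * s + s ^+ 3) (b + 3%:R * s ^+ 2) (3%:R * s).
  by rewrite -/(shifted_cubic s b c) -/f eg size_mul ?polyXsubC_eq0 // size_XsubC addn2 => -[].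
exists [:: g; 'X - (y - s)%:P]; split.
- move=> g1; rewrite !inE => /orP[] /eqP ->; split=> //; rewrite ?monicXsubC //;
    last exact: irredp_XsubC.
  apply: cubic_irreducible; first by rewrite sg.
  move=> x; apply/negP => gx; apply: nsq.
  have [h eh] := factor_theorem _ _ gx.
  have h0 : h != 0 by apply: contraNneq g0; rewrite eh => ->; rewrite mul0r.
  have sh : size h = 2%N.
    by move: sg; rewrite eh size_mul ?polyXsubC_eq0 // size_XsubC addn2 => -[].
  have hm : h \is monic by move: gm; rewrite eh monicMr // monicXsubC.
  move: eg; rewrite eh (monic_size2 hm sh) => /prod_splits3 sp.
  by eexists; exact: disc3_splits sp.
- by rewrite !big_cons big_nil mulr1.
- by rewrite /= sg size_XsubC.
Qed.

End FactorTypes.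

(** * Degree of the splitting field of a cubic *)

Lemma map_monic_cubic (A B : comNzRingType) (h : {rmorphism A -> B}) a0 a1 a2 :
  map_poly h (monic_cubic a0 a1 a2) = monic_cubic (h a0) (h a1) (h a2).
Proof.
by rewrite /monic_cubic !rmorphD /= !map_polyZ /= !map_polyXn map_polyX map_polyC.
Qed.

Lemma map_shifted_cubic (A B : comNzRingType) (h : {rmorphism A -> B}) s b c :
  map_poly h (shifted_cubic s b c) = shifted_cubic (h s) (h b) (h c).
Proof.
rewrite /shifted_cubic map_monic_cubic.
by rewrite !(rmorph_nat, rmorphD, rmorphM, rmorphXn).
Qed.

Lemma rmorph_disc3 (A B : comNzRingType) (h : {rmorphism A -> B}) b c :
  h (disc3 b c) = disc3 (h b) (h c).
Proof. by rewrite /disc3 !(rmorph_nat, rmorphN, rmorphD, rmorphM, rmorphXn). Qed.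

Lemma rmorph_root3 (A B : comNzRingType) (h : {rmorphism A -> B}) b c x :
  is_root3 b c x -> is_root3 (h b) (h c) (h x).
Proof.
by move=> /(congr1 h); rewrite !(rmorphD, rmorphM, rmorphXn, rmorph0).
Qed.

Lemma rmorph_splits3 (A B : comNzRingType) (h : {rmorphism A -> B}) b c x y z :
  splits3 b c x y z -> splits3 (h b) (h c) (h x) (h y) (h z).
Proof.
by case=> -> -> ->; split; rewrite !(rmorphN, rmorphD, rmorphM, rmorphXn).
Qed.

Section SplittingDimension.
Variable K : fieldType.
Hypotheses (h2 : 2%:R != 0 :> K) (h3 : 3%:R != 0 :> K).
Variables (s b c : K) (L : fieldExtType K).
Let f := shifted_cubic s b c.

(** Adding s to the roots moves them to the roots of the depressed cubic without
    changing the field they generate; the third root is minus the sum of the other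
    two, so two of them generate. *)
Lemma splitting_roots : splittingFieldFor 1 (map_poly (in_alg L) f) {:L} ->
  exists y1 y2 y3, splits3 b%:A c%:A y1 y2 y3 /\
    forall U : {subfield L}, y1 \in U -> y2 \in U -> U = fullv :> {vspace L}.
Proof.
case=> rs; rewrite map_shifted_cubic => e genL.
have srs : size rs = 3%N.
  by have := eqp_size e; rewrite size_monic_cubic size_prod_XsubC => -[].
move: e genL; rewrite eqp_monic ?monic_monic_cubic ?monic_prod_XsubC // => /eqP.
case: rs srs => [|x1 [|x2 [|x3 [|]]]] //= _ + genL.
rewrite !big_cons big_nil mulr1 mulrA => /prod_splits3 sp.
do 3!eexists; split; first exact: sp.
have al (U : {subfield L}) (a : K) : a%:A \in U by rewrite memvZ ?mem1v.
move=> U y1U y2U; apply/eqP; rewrite eqEsubv; apply/andP; split; first exact: subvf.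
rewrite -genL.
apply/(@Fadjoin_seqP _ _ 1%AS); split; first exact: sub1v.
have x1U : x1 \in U by rewrite -[x1](addrK s%:A) rpredB ?al.
have x2U : x2 \in U by rewrite -[x2](addrK s%:A) rpredB ?al.
have x3U : x3 \in U.
  by case: sp => e _ _; rewrite -[x3](addrK s%:A) e !rpredB ?rpredN ?rpredD ?al.
by move=> x; rewrite !inE => /or3P[] /eqP ->.
Qed.

Hypothesis splitL : splittingFieldFor 1 (map_poly (in_alg L) f) {:L}.

Lemma alg_mem (U : {subfield L}) (a : K) : a%:A \in U.
Proof. by rewrite memvZ ?mem1v. Qed.

Lemma in_alg_inj : injective (in_alg L).
Proof. exact: fmorph_inj. Qed.

Lemma mem1_alg (x : L) : x \in 1%VS -> exists a : K, x = a%:A.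
Proof. by case/vlineP => a ->; exists a. Qed.

Lemma natr_alg_neq0 n : n%:R != 0 :> K -> n%:R != 0 :> L.
Proof. by move=> n0; rewrite -(rmorph_nat (in_alg L)) fmorph_eq0. Qed.

Lemma root3_in1 (x : L) : is_root3 b%:A c%:A x -> x \in 1%VS -> has_root3 b c.
Proof.
move=> hx /mem1_alg[a xE]; exists a; apply: in_alg_inj.
by rewrite rmorph0 -hx xE !(rmorphD, rmorphM, rmorphXn).
Qed.

Lemma square_in1 (d : L) (D : K) : D%:A = d ^+ 2 -> d \in 1%VS -> is_square D.
Proof.
move=> hd /mem1_alg[a dE]; exists a; apply: in_alg_inj.
by rewrite [LHS]hd dE rmorphXn.
Qed.

Lemma square_notin1 (d : L) (D : K) : D%:A = d ^+ 2 -> is_square D -> d \in 1%VS.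
Proof.
move=> hd [e eD]; have : (d - e%:A) * (d + e%:A) = 0.
  rewrite -subr_sqr -hd eD -[X in _ - X ^+ _]/(in_alg L e) -rmorphXn /=.
  by rewrite subrr.
move/eqP; rewrite mulf_eq0 subr_eq0 addr_eq0 => /orP[] /eqP ->.
  exact: (alg_mem 1%AS).
by rewrite memvN; exact: (alg_mem 1%AS).
Qed.

Lemma adjoin_degree_quadratic (U : {subfield L}) (y u v : L) :
  u \in U -> v \in U -> y ^+ 2 + u * y + v = 0 -> (adjoin_degree U y <= 2)%N.
Proof.
move=> uU vU hy; pose p : {poly L} := 'X^2 + u *: 'X + v%:P.
have sp : size p = 3%N by exact: size_monic_quadratic.
have pU : p \is a polyOver U.
  by rewrite !rpredD ?polyOverZ ?polyOverX ?polyOverC ?rpredX ?polyOverX.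
have py : root p y.
  by rewrite /root /p !(hornerD, hornerZ, hornerXn, hornerX, hornerC) hy.
have /dvdp_leq : minPoly U y %| p by exact: minPoly_dvdp.
by rewrite size_minPoly sp -size_poly_gt0 sp ltnS => /(_ isT).
Qed.

(** A cubic without roots is irreducible, hence is the minimal polynomial of each
    of its roots. *)
Lemma adjoin_degree_noroot (y : L) :
  is_root3 b%:A c%:A y -> ~ has_root3 b c -> adjoin_degree 1%AS y = 3%N.
Proof.
move=> hy nr; have irr : irreducible_poly (shifted_cubic 0 b c).
  apply: cubic_irreducible; first by rewrite size_monic_cubic.
  move=> x; apply/negP => fx; apply: nr; exists x.
  by move: fx; rewrite -[x in root _ x]subr0 root_shifted.
have /polyOver1P[p ep] := minPolyOver 1%AS y.
have fy : root (map_poly (in_alg L) (shifted_cubic 0 b c)) y.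
  by rewrite map_shifted_cubic rmorph0 -[y]subr0 root_shifted.
have : minPoly 1 y %| map_poly (in_alg L) (shifted_cubic 0 b c).
  by apply: minPoly_dvdp => //; exact: alg_polyOver.
rewrite ep dvdp_map => pf.
have sp : size p = (adjoin_degree 1%AS y).+1.
  by rewrite -size_minPoly ep size_map_poly.
have [_ /(_ p) irr2] := irr.
have /irr2 : size p != 1%N by rewrite sp eqSS -lt0n.
by move=> /(_ pf) /eqp_size; rewrite /shifted_cubic size_monic_cubic sp => /succn_inj.
Qed.

Lemma dim_root_square : has_root3 b c -> is_square (disc3 b c) -> \dim {:L} = 1%N.
Proof.
move=> [z hz] sq; have [z2 [z3 sz]] := root_square_splits h2 hz sq.
have [y1 [y2 [y3 [sy full]]]] := splitting_roots splitL.
have in1 (y : L) : is_root3 b%:A c%:A y -> y \in 1%AS.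
  have sz2 := rmorph_splits3 (in_alg L) sz.
  by move=> /(splits3_eq0 sz2) /or3P[] /eqP ->; exact: alg_mem.
by rewrite -(full 1%AS) ?dimv1 //; apply: in1; [exact: splits3_root sy |
  exact: splits3_root (splits3_rot sy)].
Qed.

(** The rational root leaves a quadratic, so the degree is at most 2; it is not 1
    because the product of the differences of the roots is a square root of the
    discriminant. *)
Lemma dim_root_nonsquare :
  has_root3 b c -> ~ is_square (disc3 b c) -> \dim {:L} = 2%N.
Proof.
move=> [z hz] nsq.
have [z1 [z2 [z3 [sz full]]]] := splitting_roots splitL.
have [y2 [y3 [sy full2]]] : exists y2 y3, splits3 b%:A c%:A z%:A y2 y3 /\
    forall U : {subfield L}, y2 \in U -> U = fullv :> {vspace L}.
  have hz' : is_root3 b%:A c%:A (in_alg L z) by exact: rmorph_root3.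
  have sz2 := splits3_rot sz; have sz3 := splits3_rot sz2.
  case/or3P: (splits3_eq0 sz hz') => /eqP e.
  - exists z2, z3; split; first by rewrite [z%:A]e.
    by move=> U zU; apply: full => //; rewrite -e; exact: alg_mem.
  - exists z3, z1; split; first by rewrite [z%:A]e.
    move=> U zU; have z2U : z2 \in U by rewrite -e; exact: alg_mem.
    by apply: full => //; case: sz2 => -> _ _; rewrite rpredB ?rpredN.
  - exists z1, z2; split; first by rewrite [z%:A]e.
    move=> U zU; have z3U : z3 \in U by rewrite -e; exact: alg_mem.
    by apply: full => //; case: sz3 => -> _ _; rewrite rpredB ?rpredN.
have gen : <<1; y2>>%VS = fullv by apply: full2; exact: memv_adjoin.
have dimL : \dim {:L} = adjoin_degree 1%AS y2.
  by rewrite -gen dim_Fadjoin dimv1 muln1.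
have le2 : (adjoin_degree 1%AS y2 <= 2)%N.
  apply: (@adjoin_degree_quadratic _ _ z%:A (b + z ^+ 2)%:A); try exact: alg_mem.
  have -> : (b + z ^+ 2)%:A = b%:A + z%:A ^+ 2 :> L.
    by rewrite -[LHS]/(in_alg L _) rmorphD rmorphXn.
  by case: sy => _ -> _; ring.
have ne1 : adjoin_degree 1%AS y2 != 1%N.
  apply/negP; rewrite adjoin_deg_eq1 => y1; apply: nsq.
  have := disc3_splits sy; rewrite -(rmorph_disc3 (in_alg L)) => /square_in1; apply.
  have y31 : y3 \in 1%AS by case: sy => -> _ _; rewrite rpredB ?rpredN ?alg_mem.
  by rewrite !rpredM ?rpredB ?alg_mem.
rewrite dimL; apply/eqP; rewrite eqn_leq le2 ltn_neqAle eq_sym ne1.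
by rewrite lt0n.
Qed.

Section NoRoot.
Hypothesis noroot : ~ has_root3 b c.
Variables y1 y2 y3 : L.
Hypothesis sy : splits3 b%:A c%:A y1 y2 y3.
Hypothesis full : forall U : {subfield L}, y1 \in U -> y2 \in U -> U = fullv :> {vspace L}.

Let d := (y1 - y2) * (y2 - y3) * (y3 - y1).

Let dE : (disc3 b c)%:A = d ^+ 2.
Proof. by rewrite -(disc3_splits sy) -(rmorph_disc3 (in_alg L)). Qed.

Let dim_y1 : \dim <<1; y1>> = 3%N.
Proof.
by rewrite dim_Fadjoin dimv1 muln1 adjoin_degree_noroot //; exact: splits3_root sy.
Qed.

Let dim_L : \dim {:L} = (adjoin_degree <<1; y1>> y2 * 3)%N.
Proof.
rewrite -dim_y1 -dim_Fadjoin; congr (\dim _); apply/esym.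
by apply: full; [apply: (subvP (subv_adjoin _ _)) |]; exact: memv_adjoin.
Qed.

Let deg_y2 : (adjoin_degree <<1; y1>> y2 <= 2)%N.
Proof.
have y1U : y1 \in <<1; y1>>%VS by exact: memv_adjoin.
apply: (@adjoin_degree_quadratic _ _ y1 (b%:A + y1 ^+ 2)) => //.
  by rewrite rpredD ?rpredX ?alg_mem.
by case: sy => _ -> _; ring.
Qed.

(** The field generated by y1 has degree 3.  It contains the other roots: their sum
    is -y1 and their difference is d divided by -(3 y1^2 + b), where d is a square
    root of the discriminant and is rational here. *)
Lemma dim_noroot_square_aux : is_square (disc3 b c) -> \dim {:L} = 3%N.
Proof.
move=> sq; have d1 : d \in 1%VS by exact: square_notin1 dE sq.
have disc0 : disc3 b c != 0.
  apply: contra_notN noroot => /eqP /(disc3_eq0_splits h2 h3)[y /splits3_root hy].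
  by exists y.
have d0 : d != 0 by rewrite -sqrf_eq0 -dE -[_%:A]/(in_alg L _) fmorph_eq0.
have y1U : y1 \in <<1; y1>>%AS by exact: memv_adjoin.
have w0 : 3%:R * y1 ^+ 2 + b%:A != 0.
  apply: contraNneq d0 => w0; rewrite -sqrf_eq0 -(disc3_splits sy).
  by rewrite (disc3_root (splits3_root sy)) w0 expr0n mulr0.
have y2E : y2 = (- y1 - d / (3%:R * y1 ^+ 2 + b%:A)) / 2%:R.
  rewrite /d; case: sy w0 => -> -> _ w0.
  by field; rewrite w0 natr_alg_neq0.
have y2U : y2 \in <<1; y1>>%AS.
  rewrite y2E rpred_div ?rpred_nat // rpredB ?rpredN // rpred_div //.
    by apply: (subvP (sub1v _)).
  by rewrite rpredD ?alg_mem // rpredM ?rpredX ?rpred_nat.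
by rewrite -(full y1U y2U) dim_y1.
Qed.

(** The degree is at most 6 and a multiple of 3, and it is even because the
    splitting field contains a square root of the discriminant. *)
Lemma dim_noroot_nonsquare_aux : ~ is_square (disc3 b c) -> \dim {:L} = 6%N.
Proof.
move=> nsq; have dim_d : \dim <<1; d>> = 2%N.
  rewrite dim_Fadjoin dimv1 muln1; apply/eqP; rewrite eqn_leq; apply/andP; split.
    apply: (@adjoin_degree_quadratic _ _ 0 (- (disc3 b c)%:A)).
    - exact: rpred0.
    - by rewrite rpredN alg_mem.
    - by rewrite dE; ring.
  rewrite ltn_neqAle lt0n andbT eq_sym; apply/negP; rewrite adjoin_deg_eq1.
  by move=> /(square_in1 dE).
have : (\dim <<1; d>> %| \dim {:L})%N by apply: field_dimS; exact: subvf.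
rewrite dim_d dim_L; move: deg_y2.
have : (0 < adjoin_degree <<1; y1>> y2)%N by [].
by case: (adjoin_degree _ _) => [|[|[|]]].
Qed.

End NoRoot.

Lemma dim_noroot_square :
  ~ has_root3 b c -> is_square (disc3 b c) -> \dim {:L} = 3%N.
Proof.
move=> nr sq; have [y1 [y2 [y3 [sy full]]]] := splitting_roots splitL.
exact: (dim_noroot_square_aux nr sy full).
Qed.

Lemma dim_noroot_nonsquare :
  ~ has_root3 b c -> ~ is_square (disc3 b c) -> \dim {:L} = 6%N.
Proof.
move=> nr sq; have [y1 [y2 [y3 [sy full]]]] := splitting_roots splitL.
exact: (dim_noroot_nonsquare_aux nr sy full).
Qed.

End SplittingDimension.

(** * Galois groups of cubics in characteristic zero *)

(** Induction on the degree down to an irreducible factor, whose root exists in the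
    quotient of the polynomial ring. *)
Lemma exists_ext_root (F : fieldType) (p : {poly F}) : (1 < size p)%N ->
  exists (L : fieldExtType F) (z : L), root (map_poly (in_alg L) p) z.
Proof.
have [n] := ubnP (size p); elim: n p => // n IH p; rewrite ltnS => sp p1.
have [irr|nirr] := pselect (irreducible_poly p).
  by have [L _ [z hz _]] := irredp_FAdjoin irr; exists L, z.
have [q [q1 qp nqp]] : exists q : {poly F}, [/\ size q != 1%N, q %| p & ~ q %= p].
  apply: contrapT => h; apply: nirr; split=> // q q1 qp.
  by apply: contrapT => nqp; apply: h; exists q.
have p0 : p != 0 by rewrite -size_poly_gt0 ltnW.
have q0 : q != 0 by apply: dvdpN0 qp p0.
have sqp : (size q < size p)%N.
  by rewrite ltn_neqAle dvdp_leq // andbT; apply/negP => /eqP e; apply: nqp; rewrite -dvdp_size_eqp // e.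
have [|//|L [z hz]] := IH q.
- exact: leq_trans sqp sp.
- by rewrite ltn_neqAle eq_sym q1 size_poly_gt0.
exists L, z; case/dvdpP: qp => k ->.
by rewrite rmorphM rootM hz orbT.
Qed.

Section SplittingField.
Variable K : fieldType.
Variables (s b c : K).
Let f := shifted_cubic s b c.

(** A root y1 is adjoined first, then a root of the quadratic cofactor; the third
    root is minus their sum. *)
Lemma exists_ext_splits3 : exists (L : fieldExtType K) (y1 y2 y3 : L),
  splits3 b%:A c%:A y1 y2 y3.
Proof.
have sf : (1 < size (shifted_cubic 0 b c))%N by rewrite size_monic_cubic.
have [L1 [y1]] := exists_ext_root sf.
rewrite map_shifted_cubic rmorph0 -[y1]subr0 root_shifted => hy1.
have [w wE] : exists w : L1, w = b%:A + y1 ^+ 2 by eexists.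
pose g : {poly L1} := 'X^2 + y1 *: 'X + w%:P.
have sg : (1 < size g)%N by rewrite size_monic_quadratic.
have [L2 [y2]] := exists_ext_root sg.
rewrite /root /g !rmorphD /= map_polyZ /= map_polyXn map_polyX map_polyC /=.
rewrite !(hornerD, hornerZ, hornerXn, hornerX, hornerC) => /eqP hy2.
exists (baseFieldType L2), (y1%:A : L2), y2, (- y1%:A - y2 : L2).
have al (a : K) : (a%:A : baseFieldType L2) = (a%:A : L1)%:A :> L2.
  exact: baseField_scaleE.
rewrite !al.
have hy2' : (b%:A)%:A + (y1%:A) ^+ 2 + y1%:A * y2 + y2 ^+ 2 = 0 :> L2.
  have wA : w%:A = (b%:A)%:A + y1%:A ^+ 2 :> L2.
    by rewrite -[LHS]/(in_alg L2 w) wE rmorphD rmorphXn.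
  by rewrite -hy2 wA; ring.
have hy1' : (y1%:A) ^+ 3 + (b%:A)%:A * y1%:A + (c%:A)%:A = 0 :> L2.
  by move: hy1 => /(congr1 (in_alg L2)); rewrite !(rmorphD, rmorphM, rmorphXn, rmorph0).
set B : L2 := (b%:A)%:A in hy1' hy2' *; set C : L2 := (c%:A)%:A in hy1' *.
set Y : L2 := y1%:A in hy1' hy2' *.
have BE : B = - (Y ^+ 2 + Y * y2 + y2 ^+ 2).
  by rewrite -[LHS]subr0 -[X in _ - X]hy2'; ring.
split=> //.
by rewrite -[LHS]subr0 -[X in _ - X]hy1' BE; ring.
Qed.

(** Among the extensions containing all the roots, one of smallest degree is
    generated by them: otherwise the subfield that they generate is a smaller one. *)
Lemma exists_splitting_field : exists L : splittingFieldType K,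
  splittingFieldFor 1 (map_poly (in_alg L) f) {:L}.
Proof.
have [E [y1 [y2 [y3]]]] := exists_ext_splits3.
have [n] := ubnP (\dim {:E}); elim: n E y1 y2 y3 => // n IH E y1 y2 y3.
rewrite ltnS => dimE sp.
pose U := <<1 & [:: y1 - s%:A; y2 - s%:A; y3 - s%:A]>>%AS.
have [Ufull|Unfull] := eqVneq (U : {vspace E}) fullv.
  have sF : splittingFieldFor 1 (map_poly (in_alg E) f) {:E}.
    exists [:: y1 - s%:A; y2 - s%:A; y3 - s%:A] => //.
    rewrite !big_cons big_nil mulr1 mulrA map_shifted_cubic.
    by rewrite (splits3_prod s%:A sp) eqpxx.
  have ax : SplittingField.axiom E.
    by exists (map_poly (in_alg E) f) => //; exact: alg_polyOver.
  pose L : splittingFieldType K :=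
    HB.pack (FieldExt.sort E) (FieldExt_isSplittingField.Build K E ax).
  by exists L.
have yU y : y - s%:A \in U -> y \in U.
  by move=> yU; rewrite -[y](subrK s%:A) rpredD ?alg_mem.
have sub := @seqv_sub_adjoin _ _ 1%VS [:: y1 - s%:A; y2 - s%:A; y3 - s%:A].
have y1U : y1 \in U by apply: yU; apply: sub; rewrite inE eqxx.
have y2U : y2 \in U by apply: yU; apply: sub; rewrite !inE eqxx orbT.
have y3U : y3 \in U by apply: yU; apply: sub; rewrite !inE eqxx !orbT.
apply: (IH (subvs_of U) (Subvs y1U) (Subvs y2U) (Subvs y3U)).
  apply: leq_trans dimE; rewrite [X in (X < _)%N]dimvf /=.
  by move: Unfull; rewrite eqEdim subvf /= -ltnNge.
by case: sp => e1 e2 e3; split; apply: val_inj; rewrite /= ?algid1 ?e2 ?e3 ?e1.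
Qed.

End SplittingField.

Section CubicGalois.
Variable K : fieldType.
Hypothesis char0 : forall n, (0 < n)%N -> n%:R != 0 :> K.
Variables (s b c : K).
Let f := shifted_cubic s b c.

Section InSplittingField.
Variable L : splittingFieldType K.
Hypothesis splitL : splittingFieldFor 1 (map_poly (in_alg L) f) {:L}.

Lemma card_galois_dim : #|'Gal({:L} / 1)%g| = \dim {:L}.
Proof.
rewrite -galois_dim ?dimv1 ?divn1 //; apply/and3P; split.
- exact: sub1v.
- apply/separableP => y _; apply: pcharf0_separable => p.
  rewrite inE; apply/negbTE; rewrite negb_and; apply/orP.
  have [/prime_gt0 p0|] := boolP (prime p); last by left.
  by right; rewrite natr_alg_neq0 // char0.
- exact: normalFieldf.
Qed.

Section Embedding.
Variables y1 y2 y3 : L.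
Hypothesis sy : splits3 b%:A c%:A y1 y2 y3.
Hypothesis full : forall U : {subfield L}, y1 \in U -> y2 \in U -> U = fullv :> {vspace L}.
Hypothesis disc_neq0 : disc3 b c != 0.

Let rs := [:: y1; y2; y3].

Let uniq_rs : uniq rs.
Proof.
have := disc_neq0; rewrite -(fmorph_eq0 (in_alg L)) rmorph_disc3.
rewrite (disc3_splits sy) expf_eq0 /= !mulf_eq0 !subr_eq0 !negb_or.
by case/andP => /andP[e1 e2] e3; rewrite /rs /= e1 e2 eq_sym e3.
Qed.

Lemma gal_root (g : gal_of {:L}) (y : L) : y \in rs -> g y \in rs.
Proof.
move=> yrs; have hy : is_root3 b%:A c%:A y.
  have s2 := splits3_rot sy; have s3 := splits3_rot s2.
  by move: yrs; rewrite /rs !inE => /or3P[] /eqP ->;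
    [exact: splits3_root sy | exact: splits3_root s2 | exact: splits3_root s3].
have : is_root3 b%:A c%:A (g y).
  have := rmorph_root3 g hy.
  by rewrite -![_%:A]/(in_alg L _) /= !linearZ /= !rmorph1.
by move=> /(splits3_eq0 sy); rewrite /rs !inE.
Qed.

(** The position of the image of the i-th root; [inord] only casts, because an
    automorphism maps roots to roots. *)
Definition gal_index (g : gal_of {:L}) (i : 'I_3) : 'I_3 :=
  inord (index (g (nth 0 rs i)) rs).

Lemma nth_gal_index g i : nth 0 rs (gal_index g i) = g (nth 0 rs i).
Proof.
have gin : g (nth 0 rs i) \in rs by apply: gal_root; rewrite mem_nth.
by rewrite /gal_index inordK ?nth_index // index_mem.
Qed.

Lemma gal_index_inj g : injective (gal_index g).
Proof.
move=> i j /(congr1 (fun k : 'I_3 => nth 0 rs k)); rewrite !nth_gal_index => /fmorph_inj e.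
by apply/val_inj/eqP; rewrite -(nth_uniq 0 _ _ uniq_rs) ?ltn_ord //= e.
Qed.

Definition gal_perm g : 'S_3 := perm (@gal_index_inj g).

Lemma gal_permM : {in 'Gal({:L} / 1)%g &, {morph gal_perm : g h / (g * h)%g}}.
Proof.
move=> g h _ _; apply/permP => i; rewrite permM !permE; apply/val_inj/eqP.
rewrite -(nth_uniq 0 _ _ uniq_rs) ?ltn_ord //.
by rewrite !nth_gal_index galM ?memvf.
Qed.

Canonical gal_perm_morphism := Morphism gal_permM.

Lemma gal_perm_inj : ('injm gal_perm_morphism)%g.
Proof.
apply/fintype.subsetP => g /morphpreP[gG]; rewrite inE => /eqP /permP g1.
rewrite inE; apply/eqP/eqP/gal_eqP => x _; rewrite gal_id.
have fixr i : (i < 3)%N -> g (nth 0 rs i) = nth 0 rs i.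
  move=> i3; have := g1 (Ordinal i3); rewrite permE perm1 => e.
  by have := nth_gal_index g (Ordinal i3); rewrite e.
have fixF (y : L) : y \in rs -> y \in fixedField [set g].
  move=> /(nthP 0)[i i3 <-]; apply/fixedFieldP; first exact: memvf.
  by move=> h /set1P ->; exact: fixr.
have e : fixedField [set g] = fullv.
  by apply: full; apply: fixF; rewrite !inE eqxx ?orbT.
have xF : x \in fixedField [set g] by rewrite e memvf.
by have /fixedFieldP/(_ xF g) := memvf x; apply; exact: set11.
Qed.

(** The action on the three roots is faithful since they generate the field, and
    the group has as many elements as the symmetric group. *)
Lemma gal_isog_S3 : #|'Gal({:L} / 1)%g| = 6%N -> 'Gal({:L} / 1) \isog [set: 'S_3].
Proof.
move=> card6; have := sub_isog (subxx _) gal_perm_inj.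
suff -> : (gal_perm_morphism @* 'Gal({:L} / 1))%g = [set: 'S_3] by [].
apply/eqP; rewrite eqEcard finset.subsetT /= card_injm ?gal_perm_inj //.
by rewrite cardsT card_Sn card6.
Qed.

End Embedding.

End InSplittingField.

Let h2 : 2%:R != 0 :> K := char0 (isT : (0 < 2)%N).
Let h3 : 3%:R != 0 :> K := char0 (isT : (0 < 3)%N).

Definition galois_order : nat :=
  if `[< has_root3 b c >] then (if `[< is_square (disc3 b c) >] then 1%N else 2%N)
  else if `[< is_square (disc3 b c) >] then 3%N else 6%N.

Lemma card_galois (L : splittingFieldType K) :
  splittingFieldFor 1 (map_poly (in_alg L) f) {:L} ->
  #|'Gal({:L} / 1)%g| = galois_order.
Proof.
move=> splitL; rewrite card_galois_dim /galois_order.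
case: asboolP => hr; case: asboolP => sq.
- exact: (dim_root_square h2 splitL).
- exact: (dim_root_nonsquare splitL).
- exact: (dim_noroot_square h2 h3 splitL).
- exact: (dim_noroot_nonsquare splitL).
Qed.

Lemma has_galois_group_card (gT : finGroupType) (G : {group gT}) :
  has_galois_group f G -> #|G| = galois_order.
Proof. by case=> L [/card_galois <- /card_isog]. Qed.

(** Groups of order 1, 2 and 3 are cyclic, hence determined by their order. *)
Lemma has_galois_group_cyclic (gT : finGroupType) (G : {group gT}) :
  cyclic G -> #|G| = galois_order -> galois_order != 6%N -> has_galois_group f G.
Proof.
move=> cG card_G n6; have [L splitL] := exists_splitting_field s b c.
exists L; split=> //; rewrite isog_sym isog_cyclic_card // card_G card_galois // eqxx andbT.
have := card_galois splitL; move: n6; rewrite /galois_order.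
do 2!case: ifP => _ //; move=> _ e; try by apply: prime_cyclic; rewrite e.
by have/eqP := e; rewrite -trivg_card1 => /eqP ->; exact: cyclic1.
Qed.

Lemma galois_trivial :
  has_galois_group f (1%G : {group 'Z_2}) <-> has_root3 b c /\ is_square (disc3 b c).
Proof.
split=> [/has_galois_group_card|[hr sq]].
  by rewrite cards1 /galois_order; case: asboolP => ?; case: asboolP.
have o1 : galois_order = 1%N.
  by rewrite /galois_order; case: asboolP => // _; case: asboolP.
by apply: has_galois_group_cyclic; rewrite ?o1 ?cards1 ?cyclic1.
Qed.

Lemma galois_Z2 :
  has_galois_group f [set: 'Z_2]%G <-> has_root3 b c /\ ~ is_square (disc3 b c).
Proof.
have card2 : #|[set: 'Z_2]%G| = 2%N by rewrite cardsT card_ord.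
split=> [/has_galois_group_card|[hr sq]].
  by rewrite card2 /galois_order; case: asboolP => ?; case: asboolP.
have o1 : galois_order = 2%N.
  by rewrite /galois_order; case: asboolP => // _; case: asboolP.
by apply: has_galois_group_cyclic; rewrite ?o1 ?card2 // prime_cyclic // card2.
Qed.

Lemma galois_Z3 :
  has_galois_group f [set: 'Z_3]%G <-> ~ has_root3 b c /\ is_square (disc3 b c).
Proof.
have card3 : #|[set: 'Z_3]%G| = 3%N by rewrite cardsT card_ord.
split=> [/has_galois_group_card|[hr sq]].
  by rewrite card3 /galois_order; case: asboolP => ?; case: asboolP.
have o1 : galois_order = 3%N.
  by rewrite /galois_order; case: asboolP => // _; case: asboolP.
by apply: has_galois_group_cyclic; rewrite ?o1 ?card3 // prime_cyclic // card3.
Qed.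

Lemma galois_S3 :
  has_galois_group f [set: 'S_3]%G <-> ~ has_root3 b c /\ ~ is_square (disc3 b c).
Proof.
split=> [/has_galois_group_card|[hr sq]].
  by rewrite cardsT card_Sn /galois_order; case: asboolP => ?; case: asboolP.
have o1 : galois_order = 6%N.
  by rewrite /galois_order; case: asboolP => // _; case: asboolP.
have [L splitL] := exists_splitting_field s b c; exists L; split=> //.
have [y1 [y2 [y3 [sy full]]]] := splitting_roots splitL.
apply: (gal_isog_S3 sy full); last by rewrite card_galois.
apply: contra_notN hr => /eqP /(disc3_eq0_splits h2 h3)[y /splits3_root hy].
by exists y.
Qed.

End CubicGalois.

(** * Counting cubics over a finite field *)

(** Double counting along a map with fibers of constant size. *)
Lemma card_fibers (T U : finType) (f : T -> U) (A : {set T}) (B : {set U}) k :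
  (forall x, x \in A -> f x \in B) ->
  (forall y, y \in B -> #|[set x in A | f x == y]| = k) ->
  #|A| = (#|B| * k)%N.
Proof.
move=> fAB fib; rewrite -sum1_card (partition_big f (mem B)) //=.
under eq_bigr => y yB.
  rewrite sum1dep_card (_ : #|_| = k); last first.
    by rewrite -(fib y yB); apply: eq_card => x; rewrite !inE.
  over.
by rewrite sum_nat_const.
Qed.

Section FiniteField.
Variable F : finFieldType.
Hypotheses (h2 : 2%:R != 0 :> F) (h3 : 3%:R != 0 :> F).
Let q := #|F|.

Definition sqb (d : F) := [exists e, d == e ^+ 2].
Definition rootb (y : F * F) := [exists x, x ^+ 3 + y.2 * x + y.1 == 0].
Definition disc2 (y : F * F) := disc3 y.2 y.1.

Lemma sqbP d : reflect (is_square d) (sqb d).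
Proof. by apply: (iffP existsP) => -[e /eqP h]; exists e. Qed.

Lemma rootbP y : reflect (has_root3 y.2 y.1) (rootb y).
Proof. by apply: (iffP existsP) => -[e /eqP h]; exists e. Qed.

Definition nz_squares : {set F} := [set d | (d != 0) && sqb d].
Definition nonsquares : {set F} := [set d | ~~ sqb d].

Lemma card_nz_squares : (#|nz_squares| * 2 = q.-1)%N.
Proof.
have <- : #|[set~ (0 : F)]| = q.-1 by rewrite cardsC1.
rewrite -(@card_fibers _ _ (fun x : F => x ^+ 2) [set~ 0]) //.
  move=> x; rewrite !inE => x0; rewrite expf_neq0 //=.
  by apply/sqbP; exists x.
move=> d; rewrite inE => /andP[d0 /sqbP[e de]].
have e0 : e != 0 by apply: contraNneq d0 => e0; rewrite de e0 expr0n.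
have ee : e != - e by rewrite -subr_eq0 opprK -mulr2n -mulr_natl mulf_neq0.
have -> : [set x in [set~ 0] | x ^+ 2 == d] = [set e; - e].
  apply/setP => x; rewrite !inE de eqf_sqr andb_idl //.
  by move=> /orP[] /eqP ->; rewrite ?oppr_eq0.
by rewrite cards2 ee.
Qed.

Lemma card_nonsquares : (#|nonsquares| * 2 = q.-1)%N.
Proof.
have := card_nz_squares.
have : (#|nz_squares| + #|nonsquares| = q.-1)%N.
  rewrite -(cardsC1 (0 : F)) -(cardsID nz_squares [set~ 0]).
  congr (_ + _)%N; apply: eq_card => d; rewrite !inE; first by case: eqP.
  have [->|d0] /= := eqVneq d 0; last by rewrite andbT.
  by apply/negbTE; rewrite negbK; apply/sqbP; exists 0; rewrite expr0n.
by lia.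
Qed.

(** A pair (x, b) determines the unique c for which x is a root; the cubics are
    counted through the pairs formed with their roots. *)
Definition root_pair (z : F * F) : F * F := (- (z.1 ^+ 3 + z.2 * z.1), z.2).
(** The discriminant of the quadratic cofactor of the root x, as in [disc3_root]. *)
Definition quad_disc (z : F * F) := - 3%:R * z.1 ^+ 2 - 4%:R * z.2.

Lemma root_pair_root z : is_root3 (root_pair z).2 (root_pair z).1 z.1.
Proof. by rewrite /is_root3 /root_pair /=; ring. Qed.

Lemma root_pairP y z :
  (root_pair z == y) = (z.2 == y.2) && (z.1 ^+ 3 + y.2 * z.1 + y.1 == 0).
Proof.
case: y z => c b [x b'] /=; rewrite /root_pair xpair_eqE /= andbC.
case: eqP => //= ->; rewrite -subr_eq0 -oppr_eq0 opprB opprK.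
by congr (_ == 0); ring.
Qed.

Lemma four_neq0 : 4%:R != 0 :> F.
Proof. by rewrite (natrM _ 2 2) mulf_neq0. Qed.

(** For each x the discriminant of the cofactor is an affine bijection of b. *)
Lemma card_quad_disc (A : {set F}) :
  #|[set z | quad_disc z \in A]| = (q * #|A|)%N.
Proof.
rewrite mulnC.
apply: (@card_fibers _ _ quad_disc _ A); first by move=> z; rewrite inE.
move=> d dA; pose g (x : F) := (x, - (d + 3%:R * x ^+ 2) / 4%:R).
have gi : injective g by move=> x1 x2 [].
rewrite /q -cardsT -(card_imset _ gi); apply: eq_card => z; rewrite !inE.
apply/andP/imsetP => [[_ /eqP zd]|[x _ ->]].
  exists z.1 => //; rewrite /g; case: z zd => x b /= <-.
  by rewrite /quad_disc /=; congr pair; field; exact: four_neq0.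
suff -> : quad_disc (g x) = d by [].
by rewrite /quad_disc /g /=; field; exact: four_neq0.
Qed.

Lemma disc_root_pair z :
  disc2 (root_pair z) = quad_disc z * (3%:R * z.1 ^+ 2 + z.2) ^+ 2.
Proof. exact: (disc3_root (root_pair_root z)). Qed.

Lemma sqb_mul_sq d e : e != 0 -> sqb (d * e ^+ 2) = sqb d.
Proof.
move=> e0; apply/sqbP/sqbP => -[w hw].
  by exists (w / e); rewrite expr_div_n -hw mulfK // expf_neq0.
by exists (w * e); rewrite exprMn hw.
Qed.

Definition cubics_split := [set y | [&& disc2 y != 0, rootb y & sqb (disc2 y)]].
Definition cubics_quad := [set y | rootb y && ~~ sqb (disc2 y)].
Definition cubics_irr := [set y | ~~ rootb y].
Definition cubics_deg := [set y | (disc2 y == 0) && (y.2 != 0)].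

Lemma sqb_quad_double z : 3%:R * z.1 ^+ 2 + z.2 = 0 -> sqb (quad_disc z).
Proof.
move=> e; apply/sqbP; exists (3%:R * z.1).
have -> : quad_disc z = 9%:R * z.1 ^+ 2 - 4%:R * (3%:R * z.1 ^+ 2 + z.2) by rewrite /quad_disc; ring.
by rewrite e; ring.
Qed.

(** These cubics have exactly one root, so they correspond bijectively to the pairs
    (x, b) whose cofactor has nonsquare discriminant. *)
Lemma card_cubics_quad : (#|cubics_quad| * 2 = q * q.-1)%N.
Proof.
rewrite -card_nonsquares mulnA -card_quad_disc; congr (_ * _)%N.
rewrite -[LHS]muln1; apply/esym; apply: (@card_fibers _ _ root_pair).
  move=> z; rewrite !inE => zd; apply/andP; split.
    by apply/rootbP; exists z.1; exact: root_pair_root.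
  rewrite disc_root_pair sqb_mul_sq //.
  by apply: contraNneq zd; exact: sqb_quad_double.
move=> y; rewrite inE => /andP[/rootbP[x hx] nsq].
suff -> : [set z in [set z | quad_disc z \in nonsquares] | root_pair z == y]
   = [set (x, y.2)] by rewrite cards1.
have ry z : root_pair z = y -> ~~ sqb (quad_disc z).
  move=> zy; apply: contraNN nsq => sz; rewrite -zy disc_root_pair.
  by have /sqbP[e ->] := sz; rewrite -exprMn; apply/sqbP; eexists.
have rx : root_pair (x, y.2) == y.
  by rewrite root_pairP /= eqxx; apply/eqP.
apply/setP => z; rewrite !inE; apply/andP/eqP => [[_ zy]|->]; last first.
  by split=> //; apply: ry; apply/eqP.
move: zy; rewrite root_pairP => /andP[/eqP z2 /eqP z1].
have nsq' : ~ is_square (quad_disc (x, y.2)) by move=> /sqbP; apply/negP; apply: ry; apply/eqP.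
have z1x : z.1 = x; last by rewrite -z1x -z2 -surjective_pairing.
apply: contrapT => /eqP nx; apply: nsq'.
(* A second root z.1 would be a root of the cofactor of x, whose derivative
   there is then a square root of its discriminant. *)
exists (2%:R * z.1 + x); rewrite /quad_disc /=.
have : (z.1 - x) * (z.1 ^+ 2 + z.1 * x + x ^+ 2 + y.2) = 0.
  rewrite -[RHS]subr0 -[X in _ = X - _]z1 -[X in _ = _ - X]hx; ring.
move/eqP; rewrite mulf_eq0 subr_eq0 (negPf nx) /= => /eqP e.
rewrite -[RHS]subr0 -[0](mulr0 4%:R) -e; ring.
Qed.

(** Each split separable cubic arises from three pairs (x, b), namely those whose
    cofactor has nonzero square discriminant, except for the q - 1 pairs in which
    x is itself a root of the cofactor. *)
Lemma card_cubics_split : (#|cubics_split| * 6 = q.-1 * (q - 2))%N.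
Proof.
pose A := [set z | quad_disc z \in nz_squares].
pose B := [set z in A | 3%:R * z.1 ^+ 2 + z.2 != 0].
have cA : (#|A| * 2 = q * q.-1)%N by rewrite card_quad_disc -mulnA card_nz_squares.
(* The excluded pairs have b = -3x^2; x = 0 is not among them, as its cofactor
   would have discriminant 0. *)
have cAB : (#|A :\: B| = q.-1)%N.
  rewrite -(cardsC1 (0 : F)).
  pose g (x : F) := (x, - (3%:R * x ^+ 2)).
  have gi : injective g by move=> x1 x2 [].
  rewrite -(card_imset _ gi); apply: eq_card => z; rewrite !inE.
  apply/idP/imsetP => [|[x x0 ->]].
    rewrite negb_and negbK => /andP[/orP[|/eqP e]]; first by move=> /negP.
    move=> /andP[d0 _]; exists z.1.
      rewrite !inE; apply: contraNneq d0 => z0; move: e.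
      by rewrite /quad_disc z0 expr0n !mulr0 add0r => ->; rewrite !mulr0 subrr.
    by case: z e {d0} => x b /=; rewrite /g => /eqP; rewrite addrC addr_eq0 => /eqP ->.
  have e : 3%:R * (g x).1 ^+ 2 + (g x).2 = 0 by rewrite /g /= subrr.
  rewrite e eqxx andbF /= (sqb_quad_double e) andbT.
  rewrite (_ : quad_disc _ = (3%:R * x) ^+ 2); last by rewrite /quad_disc /g /=; ring.
  by rewrite expf_neq0 // mulf_neq0 //; move: x0; rewrite !inE.
have cB : (#|B| + q.-1 = #|A|)%N.
  rewrite -cAB -[RHS](cardsID B A); congr (_ + _)%N.
  by apply: eq_card => z; rewrite !inE; case: (_ && sqb _).
have : #|B| = (#|cubics_split| * 3)%N.
  apply: (@card_fibers _ _ root_pair).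
    move=> z; rewrite !inE => /andP[/andP[d0 sd] e0].
    rewrite disc_root_pair sqb_mul_sq // sd mulf_neq0 ?expf_neq0 //=.
    by rewrite andbT; apply/rootbP; exists z.1; exact: root_pair_root.
  move=> y; rewrite inE => /and3P[d0 /rootbP[x hx] /sqbP sq].
  have [x2 [x3 sp]] := root_square_splits h2 hx sq.
  have : [&& x != x2, x2 != x3 & x3 != x].
    move: d0; rewrite /disc2 (disc3_splits sp) expf_eq0 /= !mulf_eq0 !subr_eq0.
    by rewrite !negb_or -andbA.
  case/and3P => n1 n2 n3.
  have -> : [set z in B | root_pair z == y] = [set (x, y.2); (x2, y.2); (x3, y.2)].
    apply/setP => z; rewrite !inE root_pairP (splits3_factor z.1 sp).
    have -> : (z == (x, y.2)) || (z == (x2, y.2)) || (z == (x3, y.2)) =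
       (z.2 == y.2) && ((z.1 - x) * (z.1 - x2) * (z.1 - x3) == 0).
      rewrite !mulf_eq0 !subr_eq0; case: z => u v /=.
      by rewrite !xpair_eqE; case: (v == y.2); rewrite ?andbF ?andbT.
    rewrite -(splits3_factor z.1 sp) -root_pairP andb_idl // => /eqP zy.
    move: d0; rewrite -zy disc_root_pair mulf_eq0 negb_or expf_eq0 /= => /andP[-> e0].
    rewrite e0 andbT -(sqb_mul_sq _ e0) -disc_root_pair zy; exact/sqbP.
  by rewrite -finset.setUA !cardsU1 cards1 !inE !xpair_eqE eqxx !andbT negb_or n1 n2 eq_sym n3.
have q2 : (2 <= q)%N by exact: finRing_gt1.
nia.
Qed.

(** The double root is a bijective parameter of the discriminant curve. *)
Lemma card_disc0 : #|[set y | disc2 y == 0]| = q.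
Proof.
pose g (x : F) := (2%:R * x ^+ 3, - 3%:R * x ^+ 2) : F * F.
have gi : injective g.
  move=> x y [] /(mulfI h2) e3 /mulfI e2.
  have {}e2 : x ^+ 2 = y ^+ 2 by apply: e2; rewrite oppr_eq0.
  have [x0|x0] := eqVneq x 0.
    by move: e2; rewrite x0 expr0n => /esym/eqP; rewrite expf_eq0 => /eqP ->.
  by apply: (mulfI (expf_neq0 2 x0)); rewrite -exprSr e3 e2 -exprSr.
rewrite /q -cardsT -(card_imset _ gi); apply: eq_card => y; rewrite !inE.
apply/eqP/imsetP => [/(disc3_eq0_splits h2 h3)[x sp]|[x _ ->]].
  exists x => //; case: y sp => c b [_ /= -> ->]; congr pair; ring.
by rewrite /disc2 /disc3 /g /=; ring.
Qed.

Lemma card_cubics_deg : #|cubics_deg| = q.-1.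
Proof.
have e := cardsD1 (0, 0) [set y | disc2 y == 0].
have -> : cubics_deg = [set y | disc2 y == 0] :\ (0, 0).
  apply/setP => -[c b]; rewrite !inE xpair_eqE negb_and /=.
  case: (eqVneq (disc2 (c, b)) 0) => [d0|_]; last by rewrite andbF.
  case: (eqVneq b 0) => [b0|_]; last by rewrite orbT.
    have [x [_ /= eb ec]] := disc3_eq0_splits h2 h3 d0.
    have x0 : x = 0.
      have : 3%:R * x ^+ 2 = 0 by rewrite -[RHS]oppr0 -b0 eb; ring.
      by move/eqP; rewrite mulf_eq0 (negPf h3) expf_eq0 /= => /eqP.
    by rewrite ec x0 !mul0r eqxx.
move: e; rewrite card_disc0 inE /disc2 /= /disc3 !expr0n !mulr0 addr0 oppr0 eqxx /=.
by move=> ->.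
Qed.

(** The other classes have been counted, and there are q^2 pairs in all. *)
Lemma card_cubics_irr : (#|cubics_irr| * 3 = q ^ 2 - 1)%N.
Proof.
have q2 : (2 <= q)%N by exact: finRing_gt1.
have disj : (#|cubics_split| + #|cubics_quad| + #|cubics_irr| + q = q ^ 2)%N.
  have -> : (q ^ 2)%N = #|[set: F * F]| by rewrite cardsT card_prod mulnn.
  rewrite -[X in (_ + X)%N]card_disc0 -[RHS](cardsID [set y | rootb y]).
  rewrite -(cardsID [set y | sqb (disc2 y)] ([set: F * F] :&: _)).
  rewrite -(cardsID [set y | disc2 y == 0] (_ :&: [set y | sqb (disc2 y)])).
  have -> : [set: F * F] :&: [set y | rootb y] :&: [set y | sqb (disc2 y)]
     :&: [set y | disc2 y == 0] = [set y | disc2 y == 0].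
    apply/setP => y; rewrite !inE andb_idl // => /eqP d0; apply/andP; split.
      have [x /splits3_root hx] := disc3_eq0_splits h2 h3 d0.
      by apply/rootbP; exists x.
    by rewrite d0; apply/sqbP; exists 0; rewrite expr0n.
  have -> : [set: F * F] :&: [set y | rootb y] :&: [set y | sqb (disc2 y)]
     :\: [set y | disc2 y == 0] = cubics_split by apply/setP => y; rewrite !inE.
  have -> : [set: F * F] :&: [set y | rootb y] :\: [set y | sqb (disc2 y)] = cubics_quad.
    by apply/setP => y; rewrite !inE andbC.
  have -> : [set: F * F] :\: [set y | rootb y] = cubics_irr.
    by apply/setP => y; rewrite !inE andbT.
  lia.
have := card_cubics_quad; have := card_cubics_split; nia.
Qed.

End FiniteField.

(** * The Frobenius map and irreducible cubics *)

Section FiniteDisc.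
Variable F : finFieldType.
Variables b c : F.

Lemma frobenius_fixed (L : fieldExtType F) (x : L) : x ^+ #|F| = x -> x \in 1%VS.
Proof.
move=> fx; have : (map_poly (in_alg L) ('X^#|F| - 'X)).[x] = 0.
  by rewrite rmorphB /= map_polyXn map_polyX !hornerE fx subrr.
rewrite finField_genPoly rmorph_prod horner_prod /= => /eqP.
rewrite prodf_seq_eq0 => /hasP[a _ /=].
rewrite rmorphB /= map_polyX map_polyC /= !hornerE subr_eq0 => /eqP ->.
exact: (alg_mem 1%AS).
Qed.

(** The Frobenius automorphism fixes no root, since its fixed field is the base
    field; so it permutes the three roots cyclically and fixes the product of their
    differences, a square root of the discriminant. *)
Lemma finite_noroot_square : ~ has_root3 b c -> is_square (disc3 b c).
Proof.
move=> nr; have [L splitL] := exists_splitting_field 0 b c.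
have [y1 [y2 [y3 [sy _]]]] := splitting_roots splitL.
have [alpha _ alphaE] := finField_galois_generator (subvf (1%AS : {subfield L})).
have nfix y : is_root3 b%:A c%:A y -> alpha y != y.
  move=> hy; apply/eqP => e; apply: nr; apply: (root3_in1 hy).
  by apply: frobenius_fixed; rewrite -[RHS]e alphaE ?memvf // dimv1 expn1.
have aroot y : is_root3 b%:A c%:A y -> is_root3 b%:A c%:A (alpha y).
  move=> hy; have := rmorph_root3 alpha hy.
  by rewrite -![_%:A]/(in_alg L _) /= !linearZ /= !rmorph1.
have key z1 z2 z3 : splits3 b%:A c%:A z1 z2 z3 -> alpha z1 = z2 -> is_square (disc3 b c).
  move=> sz a1; have sz2 := splits3_rot sz; have sz3 := splits3_rot sz2.
  have r2 := splits3_root sz2; have r3 := splits3_root sz3.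
  have z3E : alpha z3 = - z2 - alpha z2 by case: sz => -> _ _; rewrite rmorphB rmorphN /= a1.
  have a2 : alpha z2 = z3.
    case/or3P: (splits3_eq0 sz (aroot _ r2)) => /eqP // e.
      have := nfix _ r3; rewrite z3E e; case: sz => -> _ _.
      by rewrite addrC eqxx.
    by have := nfix _ r2; rewrite e eqxx.
  have a3 : alpha z3 = z1 by rewrite z3E a2; case: sz => -> _ _; ring.
  have := disc3_splits sz; rewrite -(rmorph_disc3 (in_alg L)) => /square_in1; apply.
  apply: frobenius_fixed.
  have := alphaE ((z1 - z2) * (z2 - z3) * (z3 - z1)) (memvf _).
  rewrite dimv1 expn1 => <-; rewrite !(rmorphM, rmorphB) /= a1 a2 a3; ring.
have r1 := splits3_root sy.
case/or3P: (splits3_eq0 sy (aroot _ r1)) => /eqP e.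
- by have := nfix _ r1; rewrite e eqxx.
- exact: key sy e.
- by apply: (key y1 y3 y2) => //; case: sy => -> -> ->; split; ring.
Qed.

End FiniteDisc.

(** * Nonarchimedean absolute values and Hensel's lemma *)

Section Absval.
Import numFieldNormedType.Exports.
Variables (R : realType) (F : fieldType) (v : nonarch_absval R F).

Lemma absval_gt0 x : x != 0 -> 0 < v x.
Proof.
move=> x0; rewrite lt_neqAle absval_ge0 andbT eq_sym.
by apply: contraNneq x0 => /absval_eq0 ->.
Qed.

Lemma absvalX x n : v (x ^+ n) = v x ^+ n.
Proof.
by elim: n => [|n IH]; rewrite ?expr0 ?absval1 // !exprS absvalM IH.
Qed.

Lemma absvalV x : v x^-1 = (v x)^-1.
Proof.
have [->|x0] := eqVneq x 0; first by rewrite invr0 absval0 invr0.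
apply: (mulfI (lt0r_neq0 (absval_gt0 x0))).
by rewrite -absvalM !mulfV ?absval1 // lt0r_neq0 // absval_gt0.
Qed.

Lemma absvalB x y : v (x - y) = v (y - x).
Proof. by rewrite -opprB absvalN. Qed.

Lemma absvalD_le x y e : v x <= e -> v y <= e -> v (x + y) <= e.
Proof. by move=> hx hy; rewrite (le_trans (absval_ultra _ _ _)) // ge_max hx. Qed.

Lemma absvalD_lt x y e : v x < e -> v y < e -> v (x + y) < e.
Proof. by move=> hx hy; rewrite (le_lt_trans (absval_ultra _ _ _)) // gt_max hx. Qed.

Lemma absvalB_le x y e : v x <= e -> v y <= e -> v (x - y) <= e.
Proof. by move=> hx hy; apply: absvalD_le; rewrite ?absvalN. Qed.

Lemma absvalB_lt x y e : v x < e -> v y < e -> v (x - y) < e.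
Proof. by move=> hx hy; apply: absvalD_lt; rewrite ?absvalN. Qed.

Lemma absvalD_eq x y : v x < v y -> v (x + y) = v y.
Proof.
move=> xy; apply/eqP; rewrite eq_le absvalD_le ?(ltW xy) //=.
rewrite leNgt; apply/negP => h.
have : v (x + y - x) < v y by apply: absvalB_lt.
by rewrite addrC addKr ltxx.
Qed.

Lemma absval_sum_lt (I : finType) (P : pred I) (f : I -> F) e :
  0 < e -> (forall i, P i -> v (f i) < e) -> v (\sum_(i | P i) f i) < e.
Proof.
move=> e0 h; elim/big_ind: _ => //; first by rewrite absval0.
by move=> x y; apply: absvalD_lt.
Qed.

Definition cauchy_seq (u : nat -> F) : Prop :=
  forall e : R, 0 < e -> exists N, forall m n, (N <= m)%N -> (N <= n)%N -> v (u m - u n) < e.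

Definition seq_limit (u : nat -> F) (l : F) : Prop :=
  forall e : R, 0 < e -> exists N, forall n, (N <= n)%N -> v (u n - l) < e.

Lemma seq_limit_cauchy u l : seq_limit u l -> cauchy_seq u.
Proof.
move=> ul e /ul[N hN]; exists N => m n Nm Nn.
have -> : u m - u n = (u m - l) - (u n - l) by ring.
by apply: absvalB_lt; apply: hN.
Qed.

Lemma absval_le0 x : (forall e, 0 < e -> v x < e) -> x = 0.
Proof.
move=> h; apply/eqP; apply: contraT => x0.
by have := h _ (absval_gt0 x0); rewrite ltxx.
Qed.

Lemma seq_limit_unique u l l' : seq_limit u l -> seq_limit u l' -> l = l'.
Proof.
move=> ul ul'; apply/eqP; rewrite -subr_eq0; apply/eqP/absval_le0 => e e0.
have [N hN] := ul e e0; have [N' hN'] := ul' e e0.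
have -> : l - l' = (u (maxn N N') - l') - (u (maxn N N') - l) by ring.
by apply: absvalB_lt; [apply: hN'|apply: hN]; rewrite ?leq_maxl ?leq_maxr.
Qed.

Lemma geometric_small (r e : R) : 0 <= r -> r < 1 -> 0 < e -> exists N, r ^+ N < e.
Proof.
move=> r0 r1 e0.
have /cvgrPdist_lt/(_ e e0)[N _ /(_ N (leqnn N))]   : ((fun n => r ^+ n) @ \oo --> (0 : R))%classic.
  by apply: cvg_expr; rewrite ger0_norm.
by rewrite sub0r normrN ger0_norm ?exprn_ge0 //; exists N.
Qed.

Lemma geometric_cauchy (u : nat -> F) (r : R) : 0 <= r -> r < 1 ->
  (forall n, v (u n.+1 - u n) <= r ^+ n) -> cauchy_seq u.
Proof.
move=> r0 r1 hu e e0; have [N rN] := geometric_small r0 r1 e0.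
have hN n : (N <= n)%N -> v (u n - u N) < e.
  elim: n => [|n IH]; first by rewrite leqn0 => /eqP ->; rewrite subrr absval0.
  rewrite leq_eqVlt => /orP[/eqP <-|Nn]; first by rewrite subrr absval0.
  have -> : u n.+1 - u N = (u n.+1 - u n) + (u n - u N) by ring.
  apply: absvalD_lt; last exact: IH.
  by apply: le_lt_trans (hu n) _; apply: le_lt_trans rN; rewrite ler_wiXn2l // ltW.
exists N => m n Nm Nn.
have -> : u m - u n = (u m - u N) - (u n - u N) by ring.
by apply: absvalB_lt; apply: hN.
Qed.

End Absval.

Section Hensel.
Variables (R : realType) (F : fieldType) (v : nonarch_absval R F).
Hypothesis complete : forall u, cauchy_seq v u -> exists l, seq_limit v u l.
Variables a3 a2 a1 a0 x0 : F.
Hypotheses (i3 : v a3 <= 1) (i2 : v a2 <= 1) (i1 : v a1 <= 1) (i0 : v a0 <= 1).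
Hypothesis ix0 : v x0 <= 1.

Let f x := a3 * x ^+ 3 + a2 * x ^+ 2 + a1 * x + a0.
Let f' x := 3%:R * a3 * x ^+ 2 + 2%:R * a2 * x + a1.

Hypothesis fx0 : v (f x0) < 1.
Hypothesis f'x0 : v (f' x0) = 1.

Let r := v (f x0).
Let h x y := a3 * (x ^+ 2 + x * y + y ^+ 2) + a2 * (x + y) + a1.
Let g x := x - f x / f' x0.

Let f'0 : f' x0 != 0.
Proof. by apply/eqP => e; have := f'x0; rewrite e absval0 => /eqP; rewrite eq_sym oner_eq0. Qed.

Let fE x y : f x - f y = (x - y) * h x y.
Proof. by rewrite /f /h; ring. Qed.

Let vM x y : v x <= 1 -> v y <= 1 -> v (x * y) <= 1.
Proof. by move=> hx hy; rewrite absvalM mulr_ile1 ?absval_ge0. Qed.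

Let r0 : 0 <= r. Proof. exact: absval_ge0. Qed.

Let ball_int x : v (x - x0) <= r -> v x <= 1.
Proof.
move=> hx; rewrite -[x](subrK x0); apply: absvalD_le => //.
by apply: le_trans hx _; apply: ltW.
Qed.

Let mul_le x y e : v x <= e -> v y <= 1 -> v (x * y) <= e.
Proof.
move=> hx hy; rewrite absvalM (le_trans _ hx) // ler_piMr //; exact: absval_ge0.
Qed.

Let hB x y : v (x - x0) <= r -> v (y - x0) <= r -> v (h x y - f' x0) <= r.
Proof.
move=> hx hy; have ix := ball_int hx; have iy := ball_int hy.
have -> : h x y - f' x0 =
  (x - x0) * (a3 * (x + x0 + y) + a2) + (y - x0) * (a3 * (y + x0 + x0) + a2).
  by rewrite /h /f'; ring.
by apply: absvalD_le; apply: mul_le => //; apply: absvalD_le => //;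
  apply: vM => //; do ?apply: absvalD_le.
Qed.

Let gE x y : g x - g y = (x - y) * - ((h x y - f' x0) / f' x0).
Proof.
have -> : g x - g y = (x - y) - (f x - f y) / f' x0 by rewrite /g; ring.
by rewrite fE; field.
Qed.

Let g_contr x y : v (x - x0) <= r -> v (y - x0) <= r -> v (g x - g y) <= r * v (x - y).
Proof.
move=> hx hy; rewrite gE absvalM mulrC absvalN absvalM absvalV f'x0 invr1 mulr1.
by rewrite ler_wpM2r ?absval_ge0 // hB.
Qed.

Let u n := iter n g x0.

Let u_ball n : v (u n - x0) <= r.
Proof.
elim: n => [|n IH]; first by rewrite subrr absval0.
have -> : u n.+1 - x0 = (g (u n) - g x0) - f x0 / f' x0.
  rewrite -[g x0]/(x0 - f x0 / f' x0) -[u n.+1]/(g (u n)).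
  by move: (g (u n)) (f x0 / f' x0) => A B; ring.
apply: absvalB_le; last by rewrite absvalM absvalV f'x0 invr1 mulr1.
apply: le_trans (g_contr IH _) _; first by rewrite subrr absval0.
by rewrite -[leRHS]mulr1 ler_wpM2l // (le_trans IH) // ltW.
Qed.

Let u_step n : v (u n.+1 - u n) <= r ^+ n.
Proof.
elim: n => [|n IH].
  by rewrite expr0; apply: le_trans (u_ball 1) _; apply: ltW.
apply: le_trans (g_contr (u_ball n.+1) (u_ball n)) _.
by rewrite exprS ler_wpM2l.
Qed.

(** Newton iteration with the fixed derivative f'(x0) contracts the ball of radius
    r = |f(x0)| around x0 by the factor r.  The leading coefficient is arbitrary so
    that the same lemma serves for quadratic equations and for rescaled cubics. *)
Lemma hensel_cubic : exists x, [/\ v x <= 1, f x = 0 & v (x - x0) < 1].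
Proof.
have [x ux] := complete (geometric_cauchy r0 fx0 u_step).
have xb : v (x - x0) <= r.
  rewrite leNgt; apply/negP => rx.
  have [N /(_ N (leqnn N)) hN] := ux _ (le_lt_trans r0 rx).
  have : v (x - x0) < v (x - x0).
    have {1}-> : x - x0 = (u N - x0) - (u N - x) by ring.
    by apply: absvalB_lt => //; apply: le_lt_trans (u_ball N) rx.
  by rewrite ltxx.
exists x; split; [exact: ball_int | | exact: le_lt_trans fx0].
apply: (@absval_le0 _ _ v) => e e0; have [N hN] := ux e e0.
have [M hM] := geometric_small r0 fx0 e0; set n := maxn N M.
have -> : f x = (f x - f (u n)) + f (u n) by ring.
apply: absvalD_lt.
  rewrite fE; apply: le_lt_trans (hN n (leq_maxl _ _)).
  rewrite -(absvalB v x) ; apply: mul_le => //.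
  rewrite -[h x _](subrK (f' x0)) absvalD_le ?f'x0 // (le_trans (hB xb (u_ball n))) //.
  exact: ltW.
have -> : f (u n) = - (u n.+1 - u n) * f' x0.
  rewrite -[u n.+1]/(u n - f (u n) / f' x0).
  by move: (u n) (f (u n)) (f' x0) f'0 => A B C C0; field.
rewrite absvalM f'x0 mulr1 absvalN (le_lt_trans (u_step n)) //.
by apply: le_lt_trans hM; rewrite ler_wiXn2l ?leq_maxr // ltW.
Qed.

End Hensel.

(** * Finite extensions of the p-adic field: discreteness and completeness *)

Section PadicExtension.
Variables (R : realType) (p : nat) (p_prime : prime p).
Variables (Qp : fieldType) (vp : nonarch_absval R Qp) (Qp_padic : is_padic_field p vp).
Variables (K : fieldExtType Qp) (v : nonarch_absval R K).
Hypothesis v_ext : forall x : Qp, v x%:A = vp x.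

Let p_gt0 : (0 : R) < p%:R. Proof. by rewrite ltr0n prime_gt0. Qed.
Let p_neq0 : p%:R != 0 :> R. Proof. exact: lt0r_neq0. Qed.
Let p_gt1 : (1 : R) < p%:R. Proof. by rewrite ltr1n prime_gt1. Qed.

(** A rational number close enough to x has the same absolute value. *)
Lemma padic_value (x : Qp) : x != 0 -> exists k : int, vp x = p%:R ^ k.
Proof.
move=> x0; have [r hr] := padic_dense Qp_padic x (absval_gt0 vp x0).
have e : vp x = vp (ratr r).
  have -> : ratr r = - (x - ratr r) + x :> Qp by ring.
  by rewrite absvalD_eq // absvalN.
have r0 : r != 0.
  apply: contraTneq (absval_gt0 vp x0) => r0.
  by rewrite e r0 (padic_rat Qp_padic) /rat_padic_abs eqxx ltxx.
exists (- rat_padic_val p r).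
by rewrite e (padic_rat Qp_padic) /rat_padic_abs (negPf r0).
Qed.

Lemma padic_natr n : (0 < n)%N -> vp n%:R = p%:R ^ (- (logn p n)%:Z).
Proof.
move=> n0; have := padic_rat Qp_padic n%:R; rewrite ratr_nat => ->.
rewrite /rat_padic_abs pnatr_eq0 -(negbK (_ == _)) -lt0n n0 /=.
by rewrite /rat_padic_val -[n%:R]/((n%:Z)%:~R) numq_int denq_int /= logn1 subr0.
Qed.

Lemma absval_natr n : v n%:R = vp n%:R.
Proof. by rewrite -v_ext -[_%:A]/(in_alg K _) rmorph_nat. Qed.

Lemma absval_p : v p%:R = p%:R^-1.
Proof.
have lp : logn p p = 1%N by rewrite -{2}(expn1 p) pfactorK.
by rewrite absval_natr padic_natr ?prime_gt0 // lp exprN1. Qed.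

Lemma absval_natr1 n : (0 < n)%N -> ~~ (p %| n)%N -> v n%:R = 1.
Proof.
move=> n0 pn; rewrite absval_natr padic_natr //.
by rewrite (_ : logn p n = 0%N) ?oppr0 ?expr0z //; apply/eqP; rewrite -leqn0 leqNgt logn_gt0 mem_primes p_prime n0.
Qed.

Lemma natr_neq0 n : (0 < n)%N -> n%:R != 0 :> K.
Proof.
move=> n0; apply/eqP => e; have := padic_natr n0; rewrite -absval_natr e absval0.
by move/esym/eqP; rewrite expfz_eq0 (negPf p_neq0) andbF.
Qed.

Section Discrete.

(** In a linear relation the terms have pairwise distinct absolute values, so the
    largest one cannot be cancelled by the others. *)
Lemma free_distinct_values n (X : n.-tuple K) :
  (forall i : 'I_n, X`_i != 0) ->
  (forall i j : 'I_n, i != j -> forall k : int, v X`_i != v X`_j * p%:R ^ k) -> free X.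
Proof.
move=> X0 Xd; apply/freeP => k sk i; apply/eqP; apply: contraT => ki0.
pose t (j : 'I_n) := v (k j *: X`_j).
have vt j : t j = vp (k j) * v X`_j by rewrite /t -mulr_algl absvalM v_ext.
pose j := [arg max_(j > i) t j]%O.
have tj j' : t j' <= t j.
  by rewrite /j; case: arg_maxP => // l _; apply.
have tj0 : 0 < t j.
  by apply: lt_le_trans (tj i); rewrite vt mulr_gt0 // absval_gt0.
have kj0 : k j != 0.
  by apply: contraTneq tj0 => e; rewrite vt e absval0 mul0r ltxx.
have : v (\sum_(l | l != j) k l *: X`_l) < t j.
  apply: absval_sum_lt => // l lj; rewrite lt_neqAle tj andbT.
  apply/negP => /eqP e.
  have kl0 : k l != 0.
    by apply: contraTneq tj0 => kl; rewrite -e -/(t l) vt kl absval0 mul0r ltxx.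
  have [a ha] := padic_value kl0; have [b hb] := padic_value kj0.
  have /eqP := Xd _ _ lj (b - a); apply.
  move: e; rewrite -/(t l) !vt ha hb => e.
  apply: (mulfI (expfz_neq0 a p_neq0)); rewrite e mulrCA -expfzDr //.
  by rewrite mulrC addrC subrK.
have -> : \sum_(l | l != j) k l *: X`_l = - (k j *: X`_j).
  by move: sk; rewrite (bigD1 j) //= => /eqP; rewrite addrC addr_eq0 => /eqP.
by rewrite absvalN ltxx.
Qed.

(** If no value below 1 were maximal, there would be infinitely many values between
    1/p and 1; these are distinct modulo powers of p, contradicting
    [free_distinct_values] in a finite-dimensional space. *)
Lemma exists_uniformizer : exists w : K,
  [/\ w != 0, v w < 1 & forall x, v x < 1 -> v x <= v w].
Proof.
apply: contrapT => nw.
have p_small : v p%:R < 1 by rewrite absval_p invf_lt1.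
have step x : exists y, v x < 1 -> v x < v y /\ v y < 1.
  have [x1|] := boolP (v x < 1); last by exists 0.
  apply: contrapT => ny; apply: nw.
  have [x0|x0] := eqVneq x 0.
    exfalso; apply: ny; exists p%:R => _; rewrite x0 absval0 p_small; split=> //.
    by rewrite absval_gt0 // natr_neq0 // prime_gt0.
  exists x; split=> // y y1; rewrite leNgt; apply/negP => xy.
  by apply: ny; exists y.
have [g gP] := boolp.choice step.
(* A sequence of strictly increasing values, all in [1/p, 1). *)
pose X n := iter n g p%:R.
have X1 n : v (X n) < 1 by elim: n => //= n /gP[].
have XS n : v (X n) < v (X n.+1) by have [] := gP _ (X1 n).
have Xlt m n : (m < n)%N -> v (X m) < v (X n).
  elim: n => // n IH; rewrite ltnS leq_eqVlt => /orP[/eqP -> //|/IH h].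
  exact: lt_trans h (XS n).
have Xp n : p%:R^-1 <= v (X n).
  case: n => [|n]; first by rewrite absval_p.
  by rewrite -absval_p; apply: ltW; exact: (Xlt 0%N n.+1).
have Xpos n : 0 < v (X n) by apply: lt_le_trans (Xp n); rewrite invr_gt0.
pose d := \dim {:K}.
have : free [tuple X i | i < d.+1].
  have nX (i : 'I_d.+1) : [tuple X i | i < d.+1]`_i = X i.
    by rewrite -tnth_nth tnth_mktuple.
  apply: free_distinct_values => [i|i j ij k].
    by rewrite nX; apply: contraTneq (Xpos i) => ->; rewrite absval0 ltxx.
  rewrite !nX; apply/eqP => e.
  have [k0|k0|k0] := ltgtP k 0.
  - have : v (X i) < p%:R^-1.
      rewrite e -[ltRHS]mul1r; apply: (@lt_le_trans _ _ (1 * p%:R ^ k)).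
        by rewrite ltr_pM2r ?exprz_gt0.
      by rewrite ler_wpM2l // -exprN1 (ler_weXz2l (ltW p_gt1)) //; lia.
    by rewrite ltNge Xp.
  - have : 1 <= v (X i).
      have pk : p%:R <= p%:R ^ k :> R.
        by rewrite -[X in X <= _]expr1z (ler_weXz2l (ltW p_gt1)) //; lia.
      rewrite e; apply: (@le_trans _ _ (p%:R^-1 * p%:R)); first by rewrite mulVf.
      apply: ler_pM; [by rewrite invr_ge0 ltW|exact: ltW|exact: Xp|exact: pk].
    by rewrite leNgt X1.
  - move: e; rewrite k0 expr0z mulr1; move/eqP: ij => ij e.
    case: (ltngtP i j) => [/Xlt|/Xlt|/val_inj //]; by rewrite e ltxx.
move/eqP => /=; rewrite size_tuple => e.
by have := dimvS (subvf <<[tuple X i | i < d.+1]>>%VS); rewrite e card_ord ltnn.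
Qed.

End Discrete.

Section Complete.

Definition subspace_complete (U : {vspace K}) : Prop :=
  forall u : nat -> K, (forall n, u n \in U) -> cauchy_seq v u ->
    exists2 l, l \in U & seq_limit v u l.

(** A complete subspace is closed, so a vector outside it lies at positive
    distance. *)
Lemma subspace_separated (U : {vspace K}) e : subspace_complete U -> e \notin U ->
  exists2 d : R, 0 < d & forall w, w \in U -> d <= v (e - w).
Proof.
move=> cU eU; apply: contrapT => nd.
have hn (n : nat) : exists w, w \in U /\ v (e - w) < n.+1%:R^-1.
  apply: contrapT => nw; apply: nd; exists n.+1%:R^-1; first by rewrite invr_gt0.
  by move=> w wU; rewrite leNgt; apply/negP => h; apply: nw; exists w.
have [w wP] := boolp.choice hn.
have we : seq_limit v w e.
  move=> t t0; have [N hN] : exists N : nat, N.+1%:R^-1 < t.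
    have [N hN] := ltr_add_invr t0; exists N; by rewrite add0r in hN.
  exists N => n Nn; rewrite absvalB; apply: lt_le_trans (proj2 (wP n)) _.
  apply: le_trans (ltW hN); rewrite lef_pV2 ?posrE // ler_nat //.
have [l lU wl] := cU w (fun n => proj1 (wP n)) (seq_limit_cauchy we).
by move: eU; rewrite (seq_limit_unique we wl) lU.
Qed.

Lemma absval_scale (t : Qp) x : v (t *: x) = vp t * v x.
Proof. by rewrite -mulr_algl absvalM v_ext. Qed.

(** The coordinate of u n along e is bounded by |u n| divided by the distance from
    e to U, so both components of a Cauchy sequence are Cauchy. *)
Lemma subspace_complete_add (U : {vspace K}) e :
  subspace_complete U -> subspace_complete (<[e]> + U).
Proof.
move=> cU; have [eU|eU] := boolP (e \in U).
  by rewrite (addv_idPr _) // -memvE.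
have [d d0 dP] := subspace_separated cU eU.
have dle w t : w \in U -> vp t * d <= v (t *: e + w).
  move=> wU; have [->|t0] := eqVneq t 0; first by rewrite absval0 mul0r absval_ge0.
  have -> : t *: e + w = t *: (e - - (t^-1 *: w)).
    by rewrite opprK scalerDr scalerA mulfV // scale1r.
  by rewrite absval_scale ler_wpM2l ?absval_ge0 // dP // memvN memvZ.
move=> u uU cu.
have dec n : exists tw : Qp * K, tw.2 \in U /\ u n = tw.1 *: e + tw.2.
  have /memv_addP[x /vlineP[t ->] [w wU ->]] := uU n.
  by exists (t, w).
have [tw twP] := boolp.choice dec.
have diff m n : u m - u n = ((tw m).1 - (tw n).1) *: e + ((tw m).2 - (tw n).2).
  by rewrite !(proj2 (twP _)) scalerBl; ring.
have [t tl] : exists t, seq_limit vp (fun n => (tw n).1) t.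
  apply: (padic_complete Qp_padic) => eps eps0.
  have [N hN] := cu (eps * d) (mulr_gt0 eps0 d0); exists N => m n Nm Nn.
  rewrite -(ltr_pM2r d0); apply: le_lt_trans (hN m n Nm Nn).
  rewrite diff; apply: dle.
  by rewrite rpredB // (proj1 (twP _)).
have te : seq_limit v (fun n => (tw n).1 *: e) (t *: e).
  move=> eps eps0; have ve : 0 < v e.
    by apply: absval_gt0; apply: contraNneq eU => ->; exact: mem0v.
  have [N hN] := tl (eps / v e) (divr_gt0 eps0 ve); exists N => n Nn.
  by rewrite -scalerBl absval_scale -ltr_pdivlMr // hN.
have [w wU wl] : exists2 w, w \in U & seq_limit v (fun n => (tw n).2) w.
  apply: cU => [n|eps eps0]; first exact: (proj1 (twP n)).
  have [N hN] := cu _ eps0; have [M hM] := seq_limit_cauchy te eps0.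
  exists (maxn N M) => m n; rewrite !geq_max => /andP[Nm Mm] /andP[Nn Mn].
  have -> : (tw m).2 - (tw n).2 = (u m - u n) - ((tw m).1 *: e - (tw n).1 *: e).
    by rewrite diff scalerBl; ring.
  by apply: absvalB_lt; [apply: hN | apply: hM].
exists (t *: e + w); first by rewrite memv_add ?memvZ ?memv_line.
move=> eps eps0; have [N hN] := te _ eps0; have [M hM] := wl _ eps0.
exists (maxn N M) => n; rewrite geq_max => /andP[Nn Mn].
have -> : u n - (t *: e + w) = ((tw n).1 *: e - t *: e) + ((tw n).2 - w).
  by rewrite (proj2 (twP n)); ring.
by apply: absvalD_lt; [apply: hN | apply: hM].
Qed.

Lemma extension_complete u : cauchy_seq v u -> exists l, seq_limit v u l.
Proof.
have cs (s : seq K) : subspace_complete << s >>%VS.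
  elim: s => [|e s IH]; last by rewrite span_cons; exact: subspace_complete_add.
  rewrite span_nil => w w0 _; exists 0; first exact: mem0v.
  move=> eps eps0; exists 0%N => n _.
  by have := w0 n; rewrite memv0 => /eqP ->; rewrite subrr absval0.
have := cs (vbasis {:K}); rewrite (span_basis (vbasisP _)) => h cu.
by have [|l _ hl] := h u _ cu; [move=> n; exact: memvf | exists l].
Qed.

End Complete.
End PadicExtension.

(** * The residue field as a finite field *)

(** The ring T keeps its own operations; only the finiteness and the inverses are
    added, which is why the comparison map is the identity. *)
Lemma finite_field_structure (T : comNzRingType) (q : nat) (e : T -> 'I_q) :
  injective e -> (forall i, exists x, e x = i) ->
  (forall x : T, x != 0 -> exists y, y * x = 1) ->
  exists (F : finFieldType) (h : {rmorphism T -> F}), bijective h /\ #|F| = q.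
Proof.
move=> einj esurj hinv.
have [g eg] := boolp.choice esurj.
have ge : cancel e g by move=> x; apply: einj; rewrite eg.
have hinv' (x : T) : exists y, x != 0 -> y * x = 1.
  by have [->|/hinv[y hy]] := eqVneq x 0; [exists 0 | exists y].
have [i0 hi0] := boolp.choice hinv'.
pose i x := if x == 0 then 0 else i0 x.
have mulVf x : x != 0 -> i x * x = 1 by rewrite /i => x0; rewrite (negPf x0) hi0.
have inv0 : i 0 = 0 by rewrite /i eqxx.
pose C : countType := HB.pack (GRing.ComNzRing.sort T) (CanIsCountable ge).
pose Fi : finType := HB.pack (GRing.ComNzRing.sort T) C
  (CanIsFinite (ge : cancel (e : Countable.sort C -> 'I_q) g)).
pose F : finFieldType := HB.pack (GRing.ComNzRing.sort T) Fi
  (GRing.ComNzRing_isField.Build T mulVf inv0).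
have am : zmod_morphism (id : T -> F) by [].
have mm : monoid_morphism (id : T -> F) by [].
pose h : {rmorphism T -> F} := HB.pack (id : T -> F)
  (GRing.isZmodMorphism.Build T F id am) (GRing.isMonoidMorphism.Build T F id mm).
exists F, h; split; first by exists (id : F -> T).
rewrite -[RHS]card_ord; apply: (bij_eq_card (f := (e : F -> 'I_q))).
by exists g => // x; exact: eg.
Qed.

Section Residue.
Variables (R : realType) (K : fieldType) (v : nonarch_absval R K).
Local Notation O := (integers v).
Local Open Scope quotient_scope.

Lemma integers_inv (x : O) : v (val x) = 1 -> exists y : O, y * x = 1.
Proof.
move=> x1; have x0 : val x != 0.
  by apply/eqP => e; move: x1; rewrite e absval0 => /eqP; rewrite eq_sym oner_eq0.
have hy : (val x)^-1 \in in_integers v.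
  by rewrite inE absvalV x1 invr1.
by exists (Integers hy); apply: val_inj; exact: (mulVf x0).
Qed.

Lemma val_integers_le1 (x : O) : v (val x) <= 1.
Proof. exact: (valP x). Qed.

Lemma residue_finField (q : nat) :
  ([set: residue_field v] #= `I_q)%card ->
  exists (F : finFieldType) (h : {rmorphism O -> F}),
    [/\ forall y, exists x, h x = y, forall x, h x = 0 <-> v (val x) < 1 & #|F| = q].
Proof.
case/card_set_bijP => f [fq finj fsurj].
have fq' x : (f x < q)%N by exact: fq.
pose e (x : residue_field v) : 'I_q := Ordinal (fq' x).
have einj : injective e by move=> x y [] /finj; apply; rewrite ?inE.
have esurj i : exists x, e x = i.
  have [x _ fx] := fsurj i (ltn_ord i).
  by exists x; apply: val_inj.
have piE (x y : O) : (\pi_(residue_field v) x = \pi_(residue_field v) y) <-> v (val x - val y) < 1.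
  split; first by move/eqP; rewrite -Quotient.idealrBE.
  by move=> h; apply/eqP; rewrite -Quotient.idealrBE.
have hinv (x : residue_field v) : x != 0 -> exists y, y * x = 1.
  elim/quotW: x => x x0.
  have x1 : v (val x) = 1.
    apply/eqP; rewrite eq_le val_integers_le1 leNgt; apply: contra x0 => x1.
    by apply/eqP; rewrite -[RHS](rmorph0 (\pi_(residue_field v))); apply/piE; rewrite subr0.
  have [y yx] := integers_inv x1; exists (\pi y).
  by rewrite -rmorphM yx rmorph1.
have [F [h [hb cF]]] := finite_field_structure einj esurj hinv.
exists F, (h \o \pi_(residue_field v)); split=> //.
- move=> y; have [g gh hg] := hb.
  by have := hg y; elim/quotW: (g y) => x <-; exists x.
- move=> x /=; rewrite -[v (val x)](_ : v (val x - val (0 : O)) = _); last by rewrite subr0.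
  rewrite -piE; split=> [|->]; last by rewrite !rmorph0.
  by rewrite -[RHS](rmorph0 h) => /(bij_inj hb) ->; rewrite rmorph0.
Qed.

End Residue.

(** * Cubics over the valuation ring *)

(** The properties of the valued field used from here on: a uniformizer, the
    reduction map to a finite field where 2 and 3 are invertible, completeness. *)
Record local_datum (R : realType) (K : fieldType) (v : nonarch_absval R K)
    (F : finFieldType) := LocalDatum {
  unif : integers v;
  residue :> {rmorphism integers v -> F};
  unif_neq0 : val unif != 0;
  unif_lt1 : v (val unif) < 1;
  unif_max : forall x : K, v x < 1 -> v x <= v (val unif);
  local_complete : forall u, cauchy_seq v u -> exists l, seq_limit v u l;
  residue_surj : forall y, exists x, residue x = y;
  residue_eq0 : forall x, residue x = 0 <-> v (val x) < 1;
  two_neq0 : 2%:R != 0 :> F;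
  three_neq0 : 3%:R != 0 :> F
}.

Section LocalCubics.
Variables (R : realType) (K : fieldType) (v : nonarch_absval R K).
Variables (F : finFieldType) (D : local_datum v F).
Local Notation O := (integers v).
Local Notation pi := (unif D).
Local Notation rho := (residue D).
Implicit Types x y z b c d : O.

Lemma absval_int x : v (val x) <= 1.
Proof. exact: (valP x). Qed.

Lemma lift_int (x : K) : v x <= 1 -> exists y : O, val y = x.
Proof. by move=> hx; exists (Integers (hx : x \in in_integers v)). Qed.

Lemma absval_pi_gt0 : 0 < v (val pi).
Proof. exact: absval_gt0 (unif_neq0 D). Qed.

Lemma residue_neq0 x : rho x != 0 <-> v (val x) = 1.
Proof.
split=> [x0|x1]; last first.
  by apply/eqP => /(residue_eq0 D); rewrite x1 ltxx.
apply/eqP; rewrite eq_le absval_int leNgt; apply: contra x0 => /(residue_eq0 D) ->.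
by rewrite eqxx.
Qed.

Lemma dvd_pi x k : v (val x) <= v (val pi) ^+ k -> exists y, x = pi ^+ k * y.
Proof.
move=> hx; have [|y hy] := lift_int (x := val x / val pi ^+ k).
  rewrite absvalM absvalV absvalX ler_pdivrMr ?exprn_gt0 ?absval_pi_gt0 //.
  by rewrite mul1r.
exists y; apply: val_inj; rewrite rmorphM rmorphXn /= hy mulrC divfK //.
by rewrite expf_neq0 // unif_neq0.
Qed.

Lemma residue_dvd x : rho x = 0 -> exists y, x = pi * y.
Proof.
move=> /(residue_eq0 D) /(unif_max D) hx.
by have := @dvd_pi x 1; rewrite expr1; apply.
Qed.

Lemma residue_pi : rho pi = 0.
Proof. exact/(residue_eq0 D)/unif_lt1. Qed.

Lemma pi_cancel x y : pi * x = pi * y -> x = y.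
Proof.
move=> /(congr1 val); rewrite !rmorphM => /(mulfI (unif_neq0 D)).
exact: val_inj.
Qed.

Lemma int_unit x : rho x != 0 -> exists y, y * x = 1.
Proof.
move=> /residue_neq0 x1.
have [|y hy] := lift_int (x := (val x)^-1); first by rewrite absvalV x1 invr1.
exists y; apply: val_inj; rewrite rmorphM /= hy; apply: mulVf.
by apply/eqP => e; move: x1; rewrite e absval0 => /eqP; rewrite eq_sym oner_eq0.
Qed.

(** Hensel's lemma with the hypotheses read in the residue field. *)
Lemma hensel_int (a3 a2 a1 a0 x0 : O) :
  rho (a3 * x0 ^+ 3 + a2 * x0 ^+ 2 + a1 * x0 + a0) = 0 ->
  rho (3%:R * a3 * x0 ^+ 2 + 2%:R * a2 * x0 + a1) != 0 ->
  exists x, a3 * x ^+ 3 + a2 * x ^+ 2 + a1 * x + a0 = 0 /\ rho x = rho x0.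
Proof.
move=> /(residue_eq0 D) f0 /residue_neq0 f1.
have [|||||x [ix fx x1]] := @hensel_cubic R K v (@local_complete _ _ _ _ D)
  (val a3) (val a2) (val a1) (val a0) (val x0); try exact: absval_int.
- by move: f0; rewrite !(rmorphD, rmorphM, rmorphXn).
- by move: f1; rewrite !(rmorph_nat, rmorphD, rmorphM, rmorphXn).
have [y hy] := lift_int ix; exists y; split.
  apply: val_inj; rewrite rmorph0 -fx -hy.
  by rewrite !(rmorphD, rmorphM, rmorphXn).
apply/eqP; rewrite -subr_eq0 -rmorphB; apply/eqP/(residue_eq0 D).
by rewrite rmorphB /= hy.
Qed.

Lemma root_int b c (x : K) : is_root3 (val b) (val c) x -> v x <= 1.
Proof.
move=> hx; rewrite leNgt; apply/negP => x1.
have e : x ^+ 3 = - (val b * x + val c) by rewrite -[LHS]subr0 -[X in _ - X]hx; ring.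
have : v (x ^+ 3) <= v x.
  rewrite e absvalN absvalD_le ?absvalM ?ler_piMl ?absval_ge0 ?absval_int //.
  exact: le_trans (absval_int c) (ltW x1).
rewrite absvalX leNgt => /negP; apply.
by rewrite -[ltLHS]expr1 ltr_eXn2l.
Qed.

Lemma has_root3_int b c : has_root3 (val b) (val c) <-> has_root3 b c.
Proof.
split=> [[x hx]|[x hx]]; last by exists (val x); exact: rmorph_root3.
have [y hy] := lift_int (root_int hx); exists y; apply: val_inj.
by rewrite !(rmorphD, rmorphM, rmorphXn) rmorph0 -hx -hy.
Qed.

Lemma is_square_int d : is_square (val d) <-> is_square d.
Proof.
split=> [[x hx]|[x ->]]; last by exists (val x); rewrite rmorphXn.
have [|y hy] := lift_int (x := x).
  rewrite -(@ler_pXn2r _ 2) ?nnegrE ?absval_ge0 // -absvalX -hx expr1n.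
  exact: absval_int.
by exists y; apply: val_inj; rewrite rmorphXn /= hy.
Qed.

(** Hensel's lemma for x^2 - d, whose derivative 2x is a unit at a unit root. *)
Lemma square_residue d : rho d != 0 -> is_square d <-> is_square (rho d).
Proof.
move=> d0; split=> [[x ->]|[e he]]; first by exists (rho x); rewrite rmorphXn.
have [x0 hx0] := residue_surj D e.
have [||x [hx _]] := @hensel_int 0 1 0 (- d) x0.
- by rewrite !(rmorphD, rmorphN, rmorphM, rmorphXn, rmorph0, rmorph1) he hx0; ring.
- rewrite !(rmorph_nat, rmorphD, rmorphN, rmorphM, rmorphXn, rmorph0, rmorph1).
  rewrite mulr0 mul0r add0r addr0 mulr1 hx0 mulf_neq0 ?(two_neq0 D) //.
  by apply: contraNneq d0 => e0; rewrite he e0 expr0n.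
by exists x; rewrite -[LHS]add0r -hx; ring.
Qed.

Lemma square_pi2 d : is_square (pi ^+ 2 * d) <-> is_square d.
Proof.
split=> [[y hy]|[y ->]]; last by exists (pi * y); rewrite exprMn.
have /residue_dvd[z hz] : rho y = 0.
  apply/eqP; rewrite -[_ == _](expf_eq0 _ 2) -rmorphXn -hy rmorphM rmorphXn.
  by rewrite residue_pi expr0n mul0r.
exists z; apply: pi_cancel; apply: pi_cancel.
by rewrite mulrA -expr2 hy hz; ring.
Qed.

Lemma square_pi d : rho d != 0 -> ~ is_square (pi * d).
Proof.
move=> d0 [y hy].
have /residue_dvd[z hz] : rho y = 0.
  apply/eqP; rewrite -[_ == _](expf_eq0 _ 2) -rmorphXn -hy rmorphM.
  by rewrite residue_pi mul0r.
have dz : d = pi * z ^+ 2 by apply: pi_cancel; rewrite hy hz; ring.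
by move: d0; rewrite dz rmorphM residue_pi mul0r eqxx.
Qed.

Lemma has_root3_unit b c : disc3 (rho b) (rho c) != 0 ->
  has_root3 b c <-> has_root3 (rho b) (rho c).
Proof.
move=> d0; split=> [[x hx]|[x hx]]; first by exists (rho x); exact: rmorph_root3.
have [x0 hx0] := residue_surj D x.
have [||y [hy _]] := @hensel_int 1 0 b c x0.
- by rewrite !(rmorphD, rmorphM, rmorphXn, rmorph0, rmorph1) hx0 -[RHS]hx; ring.
- apply: contraNneq d0; rewrite !(rmorph_nat, rmorphD, rmorphM, rmorphXn, rmorph0, rmorph1).
  by rewrite hx0 (disc3_root hx) mulr1 mulr0 mul0r addr0 => ->; rewrite expr0n mulr0.
by exists y; rewrite /is_root3 -[RHS]hy; ring.
Qed.

Lemma disc3_residue b c : rho (disc3 b c) = disc3 (rho b) (rho c).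
Proof. exact: rmorph_disc3. Qed.

(** The reduced cubic is (x - r)^2 (x + 2r) with r nonzero, so -2r is a simple root
    and lifts. *)
Lemma has_root3_double b c : disc3 (rho b) (rho c) = 0 -> rho b != 0 -> has_root3 b c.
Proof.
move=> /(disc3_eq0_splits (two_neq0 D) (three_neq0 D))[x [_ hb hc]] b0.
have x0 : x != 0 by apply: contraNneq b0 => x0; rewrite hb x0; apply/eqP; ring.
have [z hz] := residue_surj D (- 2%:R * x).
have [||y [hy _]] := @hensel_int 1 0 b c z.
- by rewrite !(rmorphD, rmorphM, rmorphXn, rmorph0, rmorph1) hz hb hc; ring.
- rewrite !(rmorph_nat, rmorphD, rmorphM, rmorphXn, rmorph0, rmorph1) hz hb.
  rewrite (_ : _ + _ = (3%:R * x) ^+ 2); last by ring.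
  by rewrite expf_neq0 // mulf_neq0 ?(three_neq0 D).
by exists y; rewrite /is_root3 -[RHS]hy; ring.
Qed.

(** The Newton polygon has slope 1/3; concretely, a root would be divisible by the
    uniformizer, and then so would c. *)
Lemma noroot_pi1 b c : rho c != 0 -> ~ has_root3 (pi * b) (pi * c).
Proof.
move=> c0 [x hx]; have /residue_dvd[y hy] : rho x = 0.
  have := rmorph_root3 rho hx; rewrite /is_root3 !rmorphM residue_pi !mul0r !addr0.
  by move/eqP; rewrite expf_eq0 => /eqP.
have ce : c = pi * - (pi * y ^+ 3 + b * y).
  apply: pi_cancel; rewrite -[LHS]add0r -[X in X + _]oppr0 -[X in - X + _]hx hy; ring.
by move: c0; rewrite ce rmorphM residue_pi mul0r eqxx.
Qed.

(** The Newton polygon has slope 2/3. *)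
Lemma noroot_pi2 b c : rho c != 0 -> ~ has_root3 (pi ^+ 2 * b) (pi ^+ 2 * c).
Proof.
move=> c0 [x hx]; have /residue_dvd[y hy] : rho x = 0.
  have := rmorph_root3 rho hx; rewrite /is_root3 !(rmorphXn, rmorphM) residue_pi.
  by rewrite expr0n !mul0r !addr0; move/eqP; rewrite expf_eq0 => /eqP.
have ce : c = pi * - (y ^+ 3 + b * y).
  apply: pi_cancel; apply: pi_cancel.
  rewrite -[LHS]add0r -[X in X + _]oppr0 -[X in - X + _]hx hy; ring.
by move: c0; rewrite ce rmorphM residue_pi mul0r eqxx.
Qed.

(** -27c^2 is -3 times the square of 3c. *)
Lemma square_neg27 (c : F) d : c != 0 -> rho d = - 27%:R * c ^+ 2 ->
  is_square d <-> is_square (- 3%:R : F).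
Proof.
move=> c0 hd; have t0 : 3%:R * c != 0 by rewrite mulf_neq0 ?(three_neq0 D).
have e : - 27%:R * c ^+ 2 = - 3%:R * (3%:R * c) ^+ 2 by ring.
rewrite square_residue ?hd e.
  split=> -[y hy]; last by exists (y * (3%:R * c)); rewrite [RHS]exprMn -hy.
  by exists (y / (3%:R * c)); rewrite expr_div_n -hy mulfK // expf_neq0.
by rewrite mulf_neq0 ?expf_neq0 // oppr_eq0 (three_neq0 D).
Qed.

Lemma square_disc_pi1 b c : rho c != 0 ->
  is_square (disc3 (pi * b) (pi * c)) <-> is_square (- 3%:R : F).
Proof.
move=> c0.
have -> : disc3 (pi * b) (pi * c) =
    pi ^+ 2 * (- 27%:R * c ^+ 2 - 4%:R * pi * b ^+ 3) by rewrite /disc3; ring.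
rewrite square_pi2; apply: (square_neg27 c0).
rewrite !(rmorph_nat, rmorphXn, rmorphN, rmorphD, rmorphM) residue_pi.
by rewrite mulr0 mul0r oppr0 addr0.
Qed.

Lemma square_disc_pi2 b c : rho c != 0 ->
  is_square (disc3 (pi ^+ 2 * b) (pi ^+ 2 * c)) <-> is_square (- 3%:R : F).
Proof.
move=> c0.
have -> : disc3 (pi ^+ 2 * b) (pi ^+ 2 * c) =
    pi ^+ 2 * (pi ^+ 2 * (- 27%:R * c ^+ 2 - 4%:R * pi ^+ 2 * b ^+ 3)) by rewrite /disc3; ring.
rewrite !square_pi2; apply: (square_neg27 c0).
rewrite !(rmorph_nat, rmorphXn, rmorphN, rmorphD, rmorphM) residue_pi.
by rewrite expr0n mulr0 mul0r oppr0 addr0.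
Qed.

(** The discriminant has valuation 3. *)
Lemma nonsquare_disc_mixed b c : rho b != 0 ->
  ~ is_square (disc3 (pi * b) (pi ^+ 2 * c)).
Proof.
move=> b0.
have -> : disc3 (pi * b) (pi ^+ 2 * c) =
    pi ^+ 2 * (pi * (- 4%:R * b ^+ 3 - 27%:R * pi * c ^+ 2)) by rewrite /disc3; ring.
rewrite square_pi2; apply: square_pi.
rewrite !(rmorph_nat, rmorphXn, rmorphN, rmorphD, rmorphM) residue_pi.
rewrite mulr0 mul0r oppr0 addr0 mulf_neq0 ?expf_neq0 // oppr_eq0.
by rewrite (natrM _ 2 2) mulf_neq0 ?(two_neq0 D).
Qed.

(** The substitution x = wy, followed by division by w^2, turns the equation into
    w y^3 + b y + c = 0, whose reduction is linear. *)
Lemma has_root3_mixed b c : rho b != 0 -> has_root3 (pi * b) (pi ^+ 2 * c).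
Proof.
move=> b0; have [z hz] := residue_surj D (- rho c / rho b).
have [||y [hy _]] := @hensel_int pi 0 b c z.
- rewrite !(rmorphD, rmorphM, rmorphXn, rmorph0) hz residue_pi; field.
  by [].
- by rewrite !(rmorph_nat, rmorphD, rmorphM, rmorphXn, rmorph0) residue_pi mulr0 !mul0r mulr0 mul0r !add0r.
exists (pi * y); rewrite /is_root3 -[RHS](mulr0 (pi ^+ 2)) -hy; ring.
Qed.

(** The roots of the dilated cubic are the multiples by w of the roots of the
    original one. *)
Lemma has_root3_scale b c : has_root3 (pi ^+ 2 * b) (pi ^+ 3 * c) <-> has_root3 b c.
Proof.
split=> [[x hx]|[y hy]]; last first.
  by exists (pi * y); rewrite /is_root3 -[RHS](mulr0 (pi ^+ 3)) -hy; ring.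
have /residue_dvd[y hy] : rho x = 0.
  have := rmorph_root3 rho hx; rewrite /is_root3 !(rmorphXn, rmorphM) residue_pi.
  by rewrite !expr0n !mul0r !addr0; move/eqP; rewrite expf_eq0 => /eqP.
exists y; do 3!apply: pi_cancel.
by rewrite !mulr0 -[RHS]hx hy; ring.
Qed.

Lemma disc3_scale b c : disc3 (pi ^+ 2 * b) (pi ^+ 3 * c) = pi ^+ 6 * disc3 b c.
Proof. by rewrite /disc3; ring. Qed.

Lemma square_disc_scale b c :
  is_square (disc3 (pi ^+ 2 * b) (pi ^+ 3 * c)) <-> is_square (disc3 b c).
Proof.
by rewrite disc3_scale (exprD _ 2 4) -mulrA square_pi2 (exprD _ 2 2) -mulrA !square_pi2.
Qed.

End LocalCubics.

Local Open Scope classical_set_scope.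
Local Open Scope ring_scope.

(** * Balls and Borel sets of the valuation ring *)

Section Balls.
Variables (R : realType) (K : fieldType) (v : nonarch_absval R K).
Variables (F : finFieldType) (D : local_datum v F).
Local Notation O := (integers v).
Local Notation pi := (unif D).
Local Notation rho := (residue D).
Implicit Types x y z a b : O.

Definition ball_at (k : nat) (a : O) : set O :=
  [set x | v (val x - val a) <= v (val pi) ^+ k].

Lemma ball_atP k a x : ball_at k a x <-> exists y, x = a + pi ^+ k * y.
Proof.
split=> [hx|[y ->]].
  have [|y hy] := @dvd_pi R K v F D (x - a) k; first by rewrite rmorphB.
  by exists y; rewrite -hy addrC subrK.
rewrite /ball_at /mkset -rmorphB addrC addKr rmorphM rmorphXn absvalM absvalX.
by rewrite ler_piMr ?exprn_ge0 ?absval_ge0 ?absval_int.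
Qed.

Lemma ball_at_refl k a : ball_at k a a.
Proof. by rewrite /ball_at /mkset subrr absval0 exprn_ge0 ?absval_ge0. Qed.

Lemma ball_at_sym k a b : ball_at k a b -> ball_at k b a.
Proof. by rewrite /ball_at /mkset absvalB. Qed.

Lemma ball_at_trans k a b c : ball_at k a b -> ball_at k b c -> ball_at k a c.
Proof.
rewrite /ball_at /mkset => hab hbc.
have -> : val c - val a = (val c - val b) + (val b - val a) by ring.
exact: absvalD_le.
Qed.

Lemma ball_at_le j k a b : (j <= k)%N -> ball_at k a b -> ball_at j a b.
Proof.
rewrite /ball_at /mkset => jk h; apply: le_trans h _.
by rewrite ler_wiXn2l ?absval_ge0 ?absval_int.
Qed.

Lemma ball_at_eq k a b : ball_at k a b -> ball_at k a = ball_at k b.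
Proof.
move=> ab; apply/seteqP; split=> x h.
  exact: ball_at_trans (ball_at_sym ab) h.
exact: ball_at_trans ab h.
Qed.

Lemma ball_at0 a : ball_at 0 a = setT.
Proof.
apply/seteqP; split=> // x _; rewrite /ball_at /mkset expr0 -rmorphB.
exact: absval_int.
Qed.

Lemma ball_at0_mem a x : ball_at 0 a x.
Proof. by have /seteqP[_ /(_ x I)] := ball_at0 a. Qed.

Lemma ball_atI j k a b : (j <= k)%N ->
  ball_at j a `&` ball_at k b = set0 \/ ball_at j a `&` ball_at k b = ball_at k b.
Proof.
move=> jk; have [ab|nab] := pselect (ball_at j a b).
  right; apply/seteqP; split=> [x []//|x bx]; split=> //.
  exact: ball_at_trans ab (ball_at_le jk bx).
left; apply/seteqP; split=> // x [ax bx]; apply: nab.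
exact: ball_at_trans ax (ball_at_sym (ball_at_le jk bx)).
Qed.

(** The empty set is included because the intersection of two balls is empty or
    equal to the smaller one. *)
Definition ball_sets : set (set O) :=
  [set A | A = set0 \/ exists k a, A = ball_at k a].

Lemma ball_setsI : setI_closed ball_sets.
Proof.
move=> A B [->|[j [a ->]]]; first by rewrite set0I; left.
move=> [->|[k [b ->]]]; first by rewrite setI0; left.
have [jk|/ltnW kj] := leqP j k.
  have [->|->] := ball_atI a b jk; [by left|by right; exists k, b].
have [e|e] := ball_atI b a kj; rewrite setIC e; [by left|by right; exists j, a].
Qed.

Lemma ball_small (e : R) : 0 < e -> exists k, v (val pi) ^+ k < e.
Proof. exact: geometric_small (absval_ge0 _ _) (unif_lt1 D). Qed.

Lemma openP (U : set O) : integers_open U <->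
  forall x, U x -> exists k, ball_at k x `<=` U.
Proof.
split=> hU x Ux.
  have [e e0 he] := hU x Ux; have [k hk] := ball_small e0.
  by exists k => y hy; apply: he; apply: le_lt_trans hk.
have [k hk] := hU x Ux; exists (v (val pi) ^+ k); first by rewrite exprn_gt0 ?absval_pi_gt0.
by move=> y hy; apply: hk; exact: ltW.
Qed.

Lemma ball_open k a : integers_open (ball_at k a).
Proof. by apply/openP => x ax; exists k => y; exact: ball_at_trans. Qed.

Lemma measurable_open (U : set O) : integers_open U -> measurable U.
Proof. exact: sub_sigma_algebra. Qed.

Lemma measurable_ball k a : measurable (ball_at k a).
Proof. by apply: measurable_open; exact: ball_open. Qed.

Definition lift_residue (r : F) : O := sval (cid (residue_surj D r)).

Lemma lift_residueK r : rho (lift_residue r) = r.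
Proof. exact: svalP (cid (residue_surj D r)). Qed.

(** Finite expansions in powers of the uniformizer: a countable set of centers
    meeting every ball, because the residue field is finite. *)
Fixpoint digits (s : seq F) : O :=
  if s is r :: t then lift_residue r + pi * digits t else 0.

Lemma digitsP k x : exists s, size s = k /\ ball_at k (digits s) x.
Proof.
elim: k x => [|k IH] x; first by exists [::]; split=> //; exact: ball_at0_mem.
have /residue_dvd[y hy] : rho (x - lift_residue (rho x)) = 0.
  by rewrite rmorphB lift_residueK subrr.
have [s [ss hs]] := IH y; exists (rho x :: s); split; first by rewrite /= ss.
have /ball_atP[z hz] := hs; apply/ball_atP; exists z => /=.
have xE : x = lift_residue (rho x) + pi * y by rewrite -hy; ring.
by rewrite [LHS]xE hz exprS; ring.
Qed.

(** An open set is the union of the balls with center a finite expansion that it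
    contains, and there are countably many of these. *)
Lemma open_bigcup (U : set O) : integers_open U ->
  U = \bigcup_(s : seq F)
        (if `[< ball_at (size s) (digits s) `<=` U >] then ball_at (size s) (digits s) else set0).
Proof.
move=> /openP oU; apply/seteqP; split=> x.
  move=> /[dup] Ux /oU[k hk]; have [s [ss hs]] := digitsP k x.
  exists s => //; case: asboolP => [_|]; first by rewrite ss.
  by rewrite ss (ball_at_eq hs).
by move=> [s _]; case: asboolP => // sU /sU.
Qed.

Lemma measurable_ball_sets : (measurable : set (set O)) = <<s ball_sets >>.
Proof.
apply/seteqP; split.
  apply: smallest_sub; first exact: smallest_sigma_algebra.
  move=> U oU; rewrite (open_bigcup oU).
  apply: (@countable_bigcupT_measurable _ (g_sigma_algebraType ball_sets)).
    exact: countableP.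
  move=> s; case: asboolP => _; last exact: measurable0.
  by apply: sub_sigma_algebra; right; exists (size s), (digits s).
apply: smallest_sub; first exact: smallest_sigma_algebra.
move=> A [->|[k [a ->]]]; last exact: measurable_ball.
exact: measurable0.
Qed.

(** Balls form a pi-system generating the Borel sets. *)
Lemma ball_measure_unique (m1 m2 : {measure set O -> \bar R}) :
  (m1 setT < +oo)%E -> (forall k a, m1 (ball_at k a) = m2 (ball_at k a)) ->
  forall A, measurable A -> m1 A = m2 A.
Proof.
move=> fin m12 A mA; apply: (measure_unique ball_sets (fun=> setT)) => //.
- exact: measurable_ball_sets.
- exact: ball_setsI.
- by move=> _; right; exists 0%N, 0; rewrite ball_at0.
- by rewrite bigcup_const //; exists 0%N.
- by move=> B [->|[k [a ->]]]; rewrite ?measure0.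
Qed.

(** Integral polynomial maps respect congruences modulo powers of the uniformizer,
    so they satisfy the hypothesis. *)
Lemma ball_preserving_measurable (f : O -> O) :
  (forall k a b, ball_at k a b -> ball_at k (f a) (f b)) -> measurable_fun setT f.
Proof.
move=> hf; apply: (@measurability _ _ _ _ _ _ (@integers_open R K v)) => //.
move=> _ [U oU <-]; rewrite setTI; apply: measurable_open; apply/openP => x Ux.
have [k hk] := proj1 (openP U) oU _ Ux.
by exists k => y /hf; exact: hk.
Qed.

Definition ball2 (k : nat) (y : O * O) : set (O * O) :=
  ball_at k y.1 `*` ball_at k y.2.

Definition open2 (U : set (O * O)) : Prop := forall y : O * O, U y -> exists k, ball2 k y `<=` U.

(** An open set of pairs is a union of products of balls whose centers run through
    a countable set. *)
Lemma measurable_open2 U : open2 U -> measurable U.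
Proof.
move=> oU; have -> : U = \bigcup_(s : seq F * seq F)
    (if `[< size s.1 = size s.2 /\ ball_at (size s.1) (digits s.1) `*` ball_at (size s.2) (digits s.2) `<=` U >]
     then ball_at (size s.1) (digits s.1) `*` ball_at (size s.2) (digits s.2) else set0).
  apply/seteqP; split=> [y|y [s _]]; last by case: asboolP => // -[_ sU] /sU.
  move=> /[dup] Uy /oU[k hk].
  have [s1 [e1 h1]] := digitsP k y.1; have [s2 [e2 h2]] := digitsP k y.2.
  exists (s1, s2) => //=; case: asboolP => [_|[]]; first by split; rewrite ?e1 ?e2.
  by rewrite e1 e2 (ball_at_eq h1) (ball_at_eq h2).
apply: countable_bigcupT_measurable; first exact: countableP.
move=> s; case: asboolP => _ //.
by apply: measurableX; exact: measurable_ball.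
Qed.

Lemma ball_preserving_measurable2 (f : O * O -> O) :
  (forall k (y z : O * O), ball2 k y z -> ball_at k (f y) (f z)) -> measurable_fun setT f.
Proof.
move=> hf; apply: (@measurability _ _ _ _ _ _ (@integers_open R K v)) => //.
move=> _ [U oU <-]; rewrite setTI; apply: measurable_open2 => x Ux.
have [k hk] := proj1 (openP U) oU _ Ux.
by exists k => y /hf; exact: hk.
Qed.

Lemma ball_atD k a b a' b' : ball_at k a a' -> ball_at k b b' -> ball_at k (a + b) (a' + b').
Proof.
move=> /ball_atP[y ->] /ball_atP[z ->]; apply/ball_atP; exists (y + z); ring.
Qed.

Lemma ball_atM k a b a' b' : ball_at k a a' -> ball_at k b b' -> ball_at k (a * b) (a' * b').
Proof.
move=> /ball_atP[y ->] /ball_atP[z ->]; apply/ball_atP.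
by exists (y * b + a * z + pi ^+ k * y * z); ring.
Qed.

Lemma ball_atX n k a a' : ball_at k a a' -> ball_at k (a ^+ n) (a' ^+ n).
Proof.
move=> h; elim: n => [|n IH]; first by rewrite !expr0; exact: ball_at_refl.
by rewrite !exprS; exact: ball_atM.
Qed.

Lemma ball_atN k a a' : ball_at k a a' -> ball_at k (- a) (- a').
Proof. by move=> /ball_atP[y ->]; apply/ball_atP; exists (- y); ring. Qed.

Lemma ball_residue k a b : ball_at k.+1 a b -> rho a = rho b.
Proof.
by move=> /ball_atP[y ->]; rewrite rmorphD exprS -mulrA rmorphM residue_pi mul0r addr0.
Qed.

Lemma residue_ball a b : rho a = rho b <-> ball_at 1 a b.
Proof.
split=> [e|]; last exact: ball_residue.
have /residue_dvd[y hy] : rho (b - a) = 0 by rewrite rmorphB e subrr.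
by apply/ball_atP; exists y; rewrite expr1 -hy addrC subrK.
Qed.

End Balls.

(** * Haar measure of balls and of dilated sets *)

(** Packages a set function as a measure, so that [ball_measure_unique] and
    uniqueness of product measures apply to it. *)
Lemma exists_restricted_pushforward (R : realType) (d d' : measure_display)
    (X : measurableType d) (Y : measurableType d') (m : {measure set X -> \bar R})
    (B : set X) (f : X -> Y) : measurable B -> measurable_fun setT f ->
  exists m' : {measure set Y -> \bar R}, forall A, m' A = m (f @^-1` A `&` B).
Proof.
move=> mB mf; unshelve eexists (pushforward (mrestr m mB) f); first exact: mf.
by [].
Qed.

Lemma measure_fibers (R : realType) (d : measure_display) (X : measurableType d)
    (m : {measure set X -> \bar R}) (T : finType) (f : X -> T) (Y : {set T})
    (B : set X) (r : R) :
  (forall y, y \in Y -> measurable (B `&` f @^-1` [set y]) /\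
                        m (B `&` f @^-1` [set y]) = r%:E) ->
  measurable (B `&` [set x | f x \in Y]) /\
  m (B `&` [set x | f x \in Y]) = (#|Y|%:R * r)%:E.
Proof.
move=> h; have -> : B `&` [set x | f x \in Y] =
    \bigcup_(y in [set` enum Y]) (B `&` f @^-1` [set y]).
  apply/seteqP; split=> x.
    by move=> [Bx /= fx]; exists (f x); rewrite //= mem_enum.
  by move=> [y /=]; rewrite mem_enum => yY [Bx fxy]; split=> //=; rewrite fxy.
have mB y : [set` enum Y] y -> measurable (B `&` f @^-1` [set y]).
  by rewrite /= mem_enum => /h[].
split; first by apply: fin_bigcup_measurable => //; exact: finite_finset.
rewrite measure_fin_bigcup //; last 1 first.
- by apply/trivIsetP => i j _ _ /eqP ij; apply/seteqP; split=> // x [[_ fi] [_ fj]]; apply: ij; rewrite -fi -fj.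
rewrite -fsbig_seq ?enum_uniq // big_seq.
rewrite (eq_bigr (fun=> r%:E)); last by move=> y; rewrite mem_enum => /h[].
rewrite -big_seq sumEFin; congr EFin.
by rewrite big_enum /= sumr_const mulr_natl.
Qed.

Section Haar.
Variables (R : realType) (K : fieldType) (v : nonarch_absval R K).
Variables (F : finFieldType) (D : local_datum v F).
Variables (mu : probability (integers v) R).
Hypothesis mu_haar : is_haar mu.
Local Notation O := (integers v).
Local Notation pi := (unif D).
Local Notation rho := (residue D).
Implicit Types x y z a b : O.

Let qi : R := #|F|%:R^-1.

Lemma mu_fin A : measurable A -> mu A \is a fin_num.
Proof. by move=> mA; exact: fin_num_measure. Qed.

Lemma card_F_gt0 : 0 < #|F|%:R :> R.
Proof. by rewrite ltr0n; apply/card_gt0P; exists 0. Qed.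

Definition div_pi (k : nat) (x : O) : O :=
  if pselect (exists y, x = pi ^+ k * y) is left e then sval (cid e) else 0.

Lemma pi_expr_cancel k x y : pi ^+ k * x = pi ^+ k * y -> x = y.
Proof.
elim: k => [|k IH]; first by rewrite !expr0 !mul1r.
by rewrite exprS -!mulrA => /pi_cancel /IH.
Qed.

Lemma div_piK k y : div_pi k (pi ^+ k * y) = y.
Proof.
rewrite /div_pi; case: pselect => [e|[]]; last by exists y.
by case: cid => z /= /pi_expr_cancel.
Qed.

Lemma ball_0P k x : ball_at D k 0 x <-> exists y, x = pi ^+ k * y.
Proof. by split=> [/ball_atP[y]|[y ->]]; [rewrite add0r => ->; exists y|apply/ball_atP; exists y; rewrite add0r]. Qed.

Lemma haar_ball0 k a : mu (ball_at D k a) = mu (ball_at D k 0).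
Proof.
rewrite -(mu_haar a (measurable_ball D k 0)); congr (mu _).
apply/seteqP; split=> x.
  move=> /ball_atP[y ->]; exists (pi ^+ k * y) => //.
  by apply/ball_0P; exists y.
by move=> [y /ball_0P[z ->] <-]; apply/ball_atP; exists z.
Qed.

(** The ball of radius index k is the disjoint union of q translates of the ball of
    index k + 1, all of the same measure. *)
Lemma haar_ball k a : mu (ball_at D k a) = (qi ^+ k)%:E.
Proof.
rewrite haar_ball0; elim: k => [|k IH]; first by rewrite ball_at0 probability_setT.
have mS : mu (ball_at D k.+1 0) = (fine (mu (ball_at D k.+1 0)))%:E.
  by rewrite fineK // mu_fin //; exact: measurable_ball.
have fib (r : F) : r \in [set: F]%SET ->
    measurable (ball_at D k 0 `&` (rho \o div_pi k) @^-1` [set r]) /\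
    mu (ball_at D k 0 `&` (rho \o div_pi k) @^-1` [set r]) = (fine (mu (ball_at D k.+1 0)))%:E.
  move=> _; have -> : ball_at D k 0 `&` (rho \o div_pi k) @^-1` [set r] =
      ball_at D k.+1 (pi ^+ k * lift_residue D r).
    apply/seteqP; split=> x.
      move=> [/ball_0P[y ->]] /=; rewrite div_piK => yr.
      have /residue_ball/ball_atP[z hz] : rho (lift_residue D r) = rho y.
        by rewrite lift_residueK.
      by apply/ball_atP; exists z; rewrite hz expr1 exprSr; ring.
    move=> /ball_atP[z ->].
    have -> : pi ^+ k * lift_residue D r + pi ^+ k.+1 * z =
        pi ^+ k * (lift_residue D r + pi * z) by rewrite exprSr; ring.
    split; first by apply/ball_0P; eexists.
    by rewrite /= div_piK rmorphD rmorphM residue_pi mul0r addr0 lift_residueK.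
  by split; [exact: measurable_ball | rewrite haar_ball0].
have [_] := measure_fibers fib.
rewrite (_ : _ `&` _ = ball_at D k 0); last first.
  by apply/seteqP; split=> [x []//|x ?]; split=> //=; rewrite inE.
rewrite /= IH cardsT mS => -[e]; congr EFin.
by rewrite exprS e mulrA mulVf ?mul1r // lt0r_neq0 // card_F_gt0.
Qed.

(** A point is the intersection of the balls around it. *)
Lemma set1_measurable a : measurable [set a].
Proof.
have -> : [set a] = \bigcap_k ball_at D k a.
  apply/seteqP; split=> x; first by move=> -> k _; exact: ball_at_refl.
  move=> h; apply: val_inj; apply/eqP; rewrite -subr_eq0; apply/eqP.
  apply: (@absval_le0 _ _ v) => e e0; have [k hk] := ball_small D e0.
  by apply: le_lt_trans hk; exact: (h k I).
by apply: bigcap_measurableType => k _; exact: measurable_ball.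
Qed.

Lemma mu_set1 a : mu [set a] = 0%E.
Proof.
have ma := set1_measurable a.
have le k : fine (mu [set a]) <= qi ^+ k.
  rewrite -lee_fin fineK ?mu_fin // -(haar_ball k a).
  apply: le_measure; rewrite ?inE //; first exact: measurable_ball.
  by move=> x ->; exact: ball_at_refl.
rewrite -[LHS]fineK ?mu_fin //; congr EFin; apply/eqP.
rewrite eq_le fine_ge0 // andbT leNgt; apply/negP => h.
have q1 : (1 < #|F|%:R :> R) by rewrite ltr1n finRing_gt1.
have qi1 : qi < 1 by rewrite invf_lt1 // card_F_gt0.
have qi0 : 0 <= qi by rewrite invr_ge0 ltW // card_F_gt0.
have [k hk] := geometric_small qi0 qi1 h.
by have := le_lt_trans (le k) hk; rewrite ltxx.
Qed.

Lemma measurable_residue (Y : {set F}) : measurable [set x | rho x \in Y] /\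
  mu [set x | rho x \in Y] = (#|Y|%:R * qi)%:E.
Proof.
rewrite -[[set x | _]]setTI; apply: measure_fibers => r _.
have -> : setT `&` rho @^-1` [set r] = ball_at D 1 (lift_residue D r).
  rewrite setTI; apply/seteqP; split=> x /=.
    by move=> e; apply/residue_ball; rewrite lift_residueK.
  by move=> /residue_ball <-; rewrite lift_residueK.
by split; [exact: measurable_ball | rewrite /= haar_ball expr1].
Qed.

(** Division is 0 outside the ideal, which is open and closed. *)
Lemma measurable_div_pi k : measurable_fun setT (div_pi k).
Proof.
apply: (@measurability _ _ _ _ _ _ (@integers_open R K v)) => //.
move=> _ [U oU <-]; rewrite setTI.
have div0 x : ~ ball_at D k 0 x -> div_pi k x = 0.
  by rewrite /div_pi; case: pselect => // e ne; case: ne; apply/ball_0P.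
have -> : div_pi k @^-1` U = (ball_at D k 0 `&` div_pi k @^-1` U) `|`
    (~` ball_at D k 0 `&` [set _ | U 0]).
  apply/seteqP; split=> x /=.
    have [bx|nbx] := pselect (ball_at D k 0 x); first by left.
    by rewrite div0 // => U0; right.
  by move=> [[]//|[nbx U0]]; rewrite div0.
apply: measurableU.
  apply: measurable_open; apply/(openP D) => x [bx Ux].
  have [j hj] := proj1 (openP D U) oU _ Ux.
  have /ball_0P[z xz] := bx; rewrite xz /= div_piK in Ux hj *.
  exists (k + j)%N => y /ball_atP[w ->].
  have -> : pi ^+ k * z + pi ^+ (k + j) * w = pi ^+ k * (z + pi ^+ j * w).
    by rewrite exprD; ring.
  split; first by apply/ball_0P; eexists.
  by rewrite /= div_piK; apply: hj; apply/ball_atP; eexists.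
apply: measurableI; first by apply: measurableC; exact: measurable_ball.
have [U0|nU0] := pselect (U 0).
  by rewrite (_ : [set _ | _] = setT) //; apply/seteqP; split.
by rewrite (_ : [set _ | _] = set0) //; apply/seteqP; split.
Qed.

Definition scale_pi (k : nat) (A : set O) : set O := ball_at D k 0 `&` div_pi k @^-1` A.

Lemma scale_piP k A x : scale_pi k A x <-> exists2 y, A y & x = pi ^+ k * y.
Proof.
split=> [[/ball_0P[y ->] /=]|[y Ay ->]]; first by rewrite div_piK; exists y.
by split; rewrite /= ?div_piK //; apply/ball_0P; exists y.
Qed.

Lemma measurable_scale_pi k A : measurable A -> measurable (scale_pi k A).
Proof.
move=> mA; apply: measurableI; first exact: measurable_ball.
by rewrite -[X in measurable X]setTI; exact: measurable_div_pi.
Qed.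

(** Both sides, as functions of A, are measures; they agree on balls. *)
Lemma mu_scale_pi k A : measurable A -> mu (scale_pi k A) = ((qi ^+ k)%:E * mu A)%E.
Proof.
move=> mA.
have [m' hm'] := exists_restricted_pushforward mu (measurable_ball D k 0) (measurable_div_pi k).
have q0 : 0 <= #|F|%:R ^+ k :> R by rewrite exprn_ge0 // ltW // card_F_gt0.
pose m2 : {measure set O -> \bar R} := mscale (NngNum q0) m'.
have e B : m2 B = ((#|F|%:R ^+ k)%:E * mu (scale_pi k B))%E.
  by rewrite /m2 /= /mscale /= hm' setIC.
have qq : #|F|%:R ^+ k * qi ^+ k = 1.
  by rewrite -exprMn mulfV ?expr1n // lt0r_neq0 // card_F_gt0.
have -> : mu A = m2 A.
  apply: (@ball_measure_unique R K v F D) => //.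
    by rewrite /= probability_setT ltry.
  move=> j a; rewrite e.
  have -> : scale_pi k (ball_at D j a) = ball_at D (k + j) (pi ^+ k * a).
    apply/seteqP; split=> x.
      by move=> /scale_piP[y /ball_atP[z ->] ->]; apply/ball_atP; exists z; rewrite exprD; ring.
    move=> /ball_atP[z ->]; apply/scale_piP; exists (a + pi ^+ j * z).
      by apply/ball_atP; exists z.
    by rewrite exprD; ring.
  by rewrite /= !haar_ball -EFinM exprD mulrA qq mul1r.
by rewrite e muleA -EFinM mulrC qq mul1e.
Qed.

End Haar.

(** * Squares, and the distribution of the discriminant *)

Section Squares.
Variables (R : realType) (K : fieldType) (v : nonarch_absval R K).
Variables (F : finFieldType) (D : local_datum v F).
Variables (mu : probability (integers v) R).
Hypothesis mu_haar : is_haar mu.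
Local Notation O := (integers v).
Local Notation pi := (unif D).
Local Notation rho := (residue D).
Implicit Types x y z a b : O.

Let qi : R := #|F|%:R^-1.

(** The powers of the absolute value of the uniformizer tend to 0, so dividing by
    the uniformizer stops. *)
Lemma unif_decomposition x : x != 0 -> exists m u, x = pi ^+ m * u /\ rho u != 0.
Proof.
move=> x0; have vx : 0 < v (val x).
  by apply: absval_gt0; apply: contra x0 => /eqP e; apply/eqP/val_inj; rewrite e.
have [k] := ball_small D vx; elim: k x {x0 vx} => [|k IH] x hx.
  by have := lt_le_trans hx (absval_int x); rewrite expr0 ltxx.
have [/residue_dvd[y hy]|r0] := eqVneq (rho x) 0; last first.
  by exists 0%N, x; rewrite expr0 mul1r.
have [|m [u [yE u0]]] := IH y.
  rewrite -(ltr_pM2l (absval_pi_gt0 D)) -exprS; apply: lt_le_trans hx _.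
  by rewrite hy rmorphM absvalM.
by exists m.+1, u; rewrite hy yE exprS mulrA.
Qed.

(** Whether w^m u is a square depends only on the parity of m and on the residue
    of the unit u. *)
Lemma square_unif_mul m u u' : rho u = rho u' -> rho u != 0 ->
  is_square (pi ^+ m * u) -> is_square (pi ^+ m * u').
Proof.
move=> uu u0; have u0' : rho u' != 0 by rewrite -uu.
have [n] := ubnP m; elim: n m => // n IH [|[|m]] mn.
- by rewrite !expr0 !mul1r !(@square_residue _ _ _ _ D) // uu.
- by rewrite !expr1 => /(square_pi u0).
- have e w : pi ^+ m.+2 * w = pi ^+ 2 * (pi ^+ m * w) by rewrite mulrA -exprD.
  rewrite !e !(@square_pi2 _ _ _ _ D); apply: IH.
  by rewrite ltnS in mn; exact: ltnW.
Qed.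

Definition nonzero_squares : set O := [set x | x != 0 /\ is_square x].

(** By [square_unif_mul] the nonzero squares form an open set. *)
Lemma measurable_nonzero_squares : measurable nonzero_squares.
Proof.
apply: measurable_open; apply/(openP D) => x [x0 sx].
have [m [u [xE u0]]] := unif_decomposition x0.
exists m.+1 => y /ball_atP[z yE].
have {}yE : y = pi ^+ m * (u + pi * z) by rewrite yE xE exprS; ring.
have r : rho (u + pi * z) = rho u by rewrite rmorphD rmorphM residue_pi mul0r addr0.
have sx' : is_square (pi ^+ m * u) by rewrite -xE.
split; last by rewrite yE; apply: square_unif_mul sx'; rewrite ?r.
apply/eqP => y0; move: u0; rewrite -r => /eqP; apply.
have -> : u + pi * z = 0 by apply: (@pi_expr_cancel _ _ _ _ D m); rewrite -yE y0 mulr0.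
by rewrite rmorph0.
Qed.

Lemma nonunit_squares : nonzero_squares `&` ball_at D 1 0 = scale_pi D 2 nonzero_squares.
Proof.
apply/seteqP; split=> x.
  move=> [[x0 [y xy]] /ball_0P[z xz]].
  have /residue_dvd[w yw] : rho y = 0.
    apply/eqP; rewrite -[_ == _](expf_eq0 _ 2) -rmorphXn -xy xz expr1 rmorphM.
    by rewrite residue_pi mul0r.
  apply/scale_piP; exists (w ^+ 2); last by rewrite xy yw exprMn.
  by split; [apply: contraNneq x0 => w0; rewrite xy yw exprMn w0 mulr0 | exists w].
move=> /scale_piP[y [y0 sy] ->]; split; last first.
  by apply/ball_0P; exists (pi * y); rewrite expr2 mulrA expr1.
split; last by apply/square_pi2.
apply: contra y0 => /eqP e; apply/eqP; apply: (@pi_expr_cancel _ _ _ _ D 2).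
by rewrite e mulr0.
Qed.

Lemma unit_squares : nonzero_squares `\` ball_at D 1 0 = [set x | rho x \in nz_squares F].
Proof.
apply/seteqP; split=> x.
  move=> [[x0 sx] nb]; have r0 : rho x != 0.
    apply/eqP => r0; apply: nb; have [y hy] := residue_dvd r0.
    by apply/ball_0P; exists y; rewrite expr1.
  by rewrite /= inE r0; apply/sqbP/square_residue.
rewrite /= inE => /andP[r0 /sqbP sr]; split.
  by split; [apply: contraNneq r0 => ->; rewrite rmorph0 eqxx | exact: (proj2 (square_residue r0) sr)].
by move=> /ball_0P[y xy]; move: r0; rewrite xy expr1 rmorphM residue_pi mul0r eqxx.
Qed.

Definition square_mass : R := fine (mu nonzero_squares).

Lemma mu_squares : mu nonzero_squares = square_mass%:E.
Proof. by rewrite fineK // mu_fin //; exact: measurable_nonzero_squares. Qed.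

(** Unit squares are detected in the residue field; the other nonzero squares are
    the multiples by w^2 of nonzero squares. *)
Lemma square_massE : square_mass = #|nz_squares F|%:R * qi + qi ^+ 2 * square_mass.
Proof.
have mS := measurable_nonzero_squares.
have := measureDI mu mS (measurable_ball D 1 0).
rewrite unit_squares nonunit_squares /= mu_squares (mu_scale_pi D mu_haar) // mu_squares.
by rewrite (proj2 (measurable_residue D mu_haar _)) -EFinM -EFinD => -[].
Qed.

Lemma mu_nonunit_squares :
  mu (nonzero_squares `&` ball_at D 1 0) = (qi ^+ 2 * square_mass)%:E.
Proof.
by rewrite nonunit_squares (mu_scale_pi D mu_haar) ?mu_squares //; exact: measurable_nonzero_squares.
Qed.

Section DiscFiber.
Variables (b : O) (c0 : F).
Hypothesis b0 : rho b != 0.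
Hypothesis disc0 : disc3 (rho b) c0 = 0.

Let fib : set O := [set c | rho c = c0].

Let c0_neq0 : c0 != 0.
Proof.
apply: contraNneq b0 => c00; have [x [_ hb hc]] := disc3_eq0_splits (two_neq0 D) (three_neq0 D) disc0.
have : 2%:R * x ^+ 3 = 0 by rewrite -c00 hc; ring.
move/eqP; rewrite mulf_eq0 (negPf (two_neq0 D)) expf_eq0 /= => /eqP x0.
by rewrite hb x0; apply/eqP; ring.
Qed.

Lemma fiber_ball : fib = ball_at D 1 (lift_residue D c0).
Proof.
apply/seteqP; split=> x /=.
  by move=> xc; apply/residue_ball; rewrite lift_residueK.
by move=> /residue_ball e; rewrite /fib /= -e lift_residueK.
Qed.

Let n27 : 27%:R != 0 :> F.
Proof. by rewrite (natrX _ 3 3) expf_neq0 // (three_neq0 D). Qed.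

(** For c in the residue class c0, which is nonzero, the difference of two values
    of the discriminant is 27 (c1 - c)(c1 + c), with 27 (c1 + c) a unit: the
    discriminant is an isometry, and it is onto by Hensel's lemma. *)
Lemma disc_fiber_ball k a : rho a = 0 ->
  exists c1, fib `&` [set c | ball_at D k.+1 a (disc3 b c)] = ball_at D k.+1 c1.
Proof.
move=> a0; have [||c1 [hc1 rc1]] :=
  @hensel_int R K v F D 0 27%:R 0 (4%:R * b ^+ 3 + a) (lift_residue D c0).
- transitivity (- disc3 (rho b) c0); last by rewrite disc0 oppr0.
  rewrite !(rmorph_nat, rmorphXn, rmorphD, rmorphM) rmorph0 lift_residueK a0.
  by rewrite /disc3; ring.
- rewrite !(rmorph_nat, rmorphXn, rmorphD, rmorphM) rmorph0 lift_residueK.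
  by rewrite mulr0 mul0r add0r addr0 !mulf_neq0 // (two_neq0 D).
have ac1 : a = disc3 b c1 by rewrite /disc3 -[LHS]subr0 -[X in _ - X]hc1; ring.
rewrite lift_residueK in rc1.
exists c1; apply/seteqP; split=> c.
  move=> [/= rc /ball_atP[z hz]].
  have [w hw] : exists w, w * (27%:R * (c + c1)) = 1.
    apply: (int_unit (D := D)); rewrite !(rmorph_nat, rmorphM, rmorphD) rc rc1.
    by rewrite mulf_neq0 // -mulr2n -mulr_natl mulf_neq0 // (two_neq0 D).
  apply/ball_atP; exists (- (z * w)).
  have e : (c - c1) * (27%:R * (c + c1)) = - (pi ^+ k.+1 * z).
    have -> : pi ^+ k.+1 * z = disc3 b c - a by rewrite hz; ring.
    by rewrite ac1 /disc3; ring.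
  have -> : c = c1 + (c - c1) * (w * (27%:R * (c + c1))) by rewrite hw; ring.
  have -> : (c - c1) * (w * (27%:R * (c + c1))) = w * ((c - c1) * (27%:R * (c + c1))) by ring.
  by rewrite e; ring.
move=> cc1; split; first by rewrite /fib /= -rc1 (ball_residue cc1).
have /ball_atP[z ->] := cc1; apply/ball_atP.
exists (- 27%:R * (2%:R * c1 * z + pi ^+ k.+1 * z ^+ 2)).
by rewrite ac1 /disc3; ring.
Qed.

Lemma measurable_disc_b : measurable_fun setT (disc3 b).
Proof.
apply: (@ball_preserving_measurable R K v F D) => k c c' h.
by apply: ball_atN; apply: ball_atD; [exact: ball_at_refl|];
  apply: ball_atM; [exact: ball_at_refl|]; apply: ball_atM.
Qed.

(** By [disc_fiber_ball] the image of the Haar measure of the residue class under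
    the discriminant agrees on balls with the Haar measure of the maximal ideal. *)
Lemma mu_disc_fiber (B : set O) : measurable B ->
  mu (fib `&` [set c | B (disc3 b c)]) = mu (B `&` ball_at D 1 0).
Proof.
move=> mB; have mf : measurable fib by rewrite fiber_ball; exact: measurable_ball.
have [m1 e1] := exists_restricted_pushforward mu mf measurable_disc_b.
have [m2 e2] := exists_restricted_pushforward mu (measurable_ball D 1 0) (@measurable_id _ O setT).
suff : m1 B = m2 B by rewrite e1 e2 setIC.
apply: (@ball_measure_unique R K v F D) => //.
- by rewrite e1 preimage_setT setTI fiber_ball /= (haar_ball D mu_haar) ltry.
move=> k a; rewrite e1 e2 [RHS](_ : _ = mu (ball_at D k a `&` ball_at D 1 0)) // /=.
case: k => [|k].
  rewrite !ball_at0 setTI preimage_setT setTI fiber_ball.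
  by rewrite /= !(haar_ball D mu_haar).
have [a0|a0] := eqVneq (rho a) 0; last first.
  rewrite (_ : _ `&` _ = set0) 1?(_ : ball_at D k.+1 a `&` _ = set0) ?measure0 //.
    apply/seteqP; split=> // x [/ball_residue ax /ball_0P[y xy]].
    by move: a0; rewrite ax xy expr1 rmorphM residue_pi mul0r eqxx.
  apply/seteqP; split=> // c [/ball_residue ac rc].
  by move: a0; rewrite ac disc3_residue rc disc0 eqxx.
have [c1 hc1] := disc_fiber_ball k a0; rewrite setIC hc1.
have -> : ball_at D k.+1 a `&` ball_at D 1 0 = ball_at D k.+1 a.
  apply/seteqP; split=> [x []//|x ax]; split=> //.
  by apply/residue_ball; rewrite rmorph0 -a0; exact: ball_residue ax.
by rewrite /= !(haar_ball D mu_haar).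
Qed.

End DiscFiber.

End Squares.

(** * Product measures on coefficients *)

Section ProductSections.
Variables (R : realType) (d1 d2 : measure_display).
Variables (X : measurableType d1) (Y : measurableType d2).
Variables (m1 : {sigma_finite_measure set X -> \bar R}).
Variables (m2 : {sigma_finite_measure set Y -> \bar R}).

Lemma product_measure_ysection (A : set (X * Y)) : measurable A ->
  (m1 \x m2)%E A = (\int[m2]_y m1 (ysection A y))%E.
Proof.
move=> mA; rewrite (@product_measure_unique _ _ _ _ _ m1 m2 (product_measure2 m1 m2)) //.
by move=> B C mB mC; exact: product_measure2E.
Qed.

(** Fubini: the measure of A is the integral over y of the measures of its
    sections, and h preserves the measure in y. *)
Lemma product_measure_reparam (h : Y -> Y) (A B : set (X * Y)) :
  measurable A -> measurable B -> measurable_fun setT h ->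
  (forall C, measurable C -> m2 (h @^-1` C) = m2 C) ->
  (forall y, m1 (ysection A y) = m1 (ysection B (h y))) ->
  (m1 \x m2)%E A = (m1 \x m2)%E B.
Proof.
move=> mA mB mh hm AB; rewrite !product_measure_ysection //.
have mB' := measurable_fun_ysection m1 mB.
have -> : (\int[m2]_y m1 (ysection A y) = \int[m2]_y ((m1 \o ysection B) \o h) y)%E.
  by apply: eq_integral => y _; rewrite AB.
have := @ge0_integral_pushforward _ _ _ _ R h mh m2 setT (m1 \o ysection B) measurableT mB'.
rewrite preimage_setT => <- //.
by apply: eq_measure_integral => C mC _; exact: hm.
Qed.

Lemma product_measure_const (A : set (X * Y)) (r : \bar R) : measurable A ->
  (forall y, m1 (ysection A y) = r) -> (m1 \x m2)%E A = (r * m2 setT)%E.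
Proof.
move=> mA Ar; rewrite product_measure_ysection //.
by rewrite -integral_cst //; apply: eq_integral => y _; rewrite Ar.
Qed.

End ProductSections.

Section PairMeasure.
Variables (R : realType) (K : fieldType) (v : nonarch_absval R K).
Variables (F : finFieldType) (D : local_datum v F).
Variables (mu : probability (integers v) R).
Hypothesis mu_haar : is_haar mu.
Local Notation O := (integers v).
Local Notation pi := (unif D).
Local Notation rho := (residue D).
Local Notation M := (mu \x mu)%E.
Implicit Types x z a b c : O.

Let qi : R := #|F|%:R^-1.

Definition rho2 (y : O * O) : F * F := (rho y.1, rho y.2).

Lemma pair_measureX (A B : set O) : measurable A -> measurable B ->
  M (A `*` B) = (mu A * mu B)%E.
Proof. by move=> mA mB; rewrite product_measure1E. Qed.

Lemma pair_measureT : M setT = 1%E.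
Proof. by rewrite -setXTT pair_measureX // probability_setT mule1. Qed.

Lemma residue_fiber_ball (r : F) : rho @^-1` [set r] = ball_at D 1 (lift_residue D r).
Proof. exact: fiber_ball. Qed.

Lemma rho2_fiber (y : F * F) :
  rho2 @^-1` [set y] = (rho @^-1` [set y.1]) `*` (rho @^-1` [set y.2]).
Proof.
apply/seteqP; split=> [z /= <-//|z [/= e1 e2]].
by rewrite /rho2 e1 e2 -surjective_pairing.
Qed.

Lemma measurable_rho2_fiber (y : F * F) : measurable (rho2 @^-1` [set y]).
Proof.
by rewrite rho2_fiber !residue_fiber_ball; apply: measurableX; exact: measurable_ball.
Qed.

Lemma pair_residue (Y : {set F * F}) : measurable [set y | rho2 y \in Y] /\
  M [set y | rho2 y \in Y] = (#|Y|%:R * qi ^+ 2)%:E.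
Proof.
rewrite -[[set y | _]]setTI; apply: measure_fibers => y _; rewrite setTI.
split; first exact: measurable_rho2_fiber.
rewrite rho2_fiber !residue_fiber_ball /= pair_measureX; try exact: measurable_ball.
by rewrite !(haar_ball D mu_haar) -EFinM expr1 expr2.
Qed.

(** The image of A under (c, b) -> (w^3 c, w^2 b), written as a preimage so that its
    measurability is immediate. *)
Definition pi_scaling (A : set (O * O)) : set (O * O) :=
  (ball_at D 3 0 `*` ball_at D 2 0) `&`
  (fun y => (div_pi D 3 y.1, div_pi D 2 y.2)) @^-1` A.

Lemma pi_scalingP A (y : O * O) :
  pi_scaling A y <-> exists2 z, A z & y = (pi ^+ 3 * z.1, pi ^+ 2 * z.2).
Proof.
split=> [[[/= /ball_0P[c hc] /ball_0P[b hb]]]|[z Az ->]].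
  rewrite /= hc hb !div_piK => Acb; exists (c, b) => //=.
  by rewrite -hc -hb -surjective_pairing.
split; last by rewrite /= !div_piK -surjective_pairing.
by split; apply/ball_0P; eexists.
Qed.

Lemma measurable_div_pair : measurable_fun setT
  (fun y : O * O => (div_pi D 3 y.1, div_pi D 2 y.2)).
Proof.
by apply: measurable_fun_pair; apply: measurableT_comp => //; exact: measurable_div_pi.
Qed.

Lemma measurable_pi_scaling A : measurable A -> measurable (pi_scaling A).
Proof.
move=> mA; apply: measurableI; first by apply: measurableX; exact: measurable_ball.
by rewrite -[X in measurable X]setTI; exact: measurable_div_pair.
Qed.

(** By uniqueness of product measures, it suffices to treat rectangles, to which
    [mu_scale_pi] applies in each coordinate. *)
Lemma pair_measure_scale A : measurable A -> M (pi_scaling A) = ((qi ^+ 5)%:E * M A)%E.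
Proof.
move=> mA.
have mD : measurable (ball_at D 3 0 `*` ball_at D 2 0).
  by apply: measurableX; exact: measurable_ball.
have [m' hm'] := exists_restricted_pushforward (mu \x mu)%E mD measurable_div_pair.
have q0 : 0 <= #|F|%:R ^+ 5 :> R by rewrite exprn_ge0 // ltW // card_F_gt0.
pose m2 : {measure set (O * O) -> \bar R} := mscale (NngNum q0) m'.
have e B : m2 B = ((#|F|%:R ^+ 5)%:E * M (pi_scaling B))%E.
  by rewrite /m2 /= /mscale /= hm' setIC.
have qq : #|F|%:R ^+ 5 * qi ^+ 5 = 1.
  by rewrite -exprMn mulfV ?expr1n // lt0r_neq0 // card_F_gt0.
have -> : M A = m2 A.
  apply: product_measure_unique => // B C mB mC; rewrite e.
  have -> : pi_scaling (B `*` C) = scale_pi D 3 B `*` scale_pi D 2 C.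
    by apply/seteqP; split=> y [[? ?] [? ?]]; do 2!split.
  rewrite pair_measureX; try exact: measurable_scale_pi.
  rewrite !(mu_scale_pi D mu_haar) //.
  rewrite /= -(fineK (mu_fin mu mB)) -(fineK (mu_fin mu mC)) -!EFinM; congr EFin.
  rewrite -[RHS](_ : (#|F|%:R ^+ 5 * qi ^+ 5) * (fine (mu B) * fine (mu C)) = _); last by rewrite qq mul1r.
  by rewrite /qi; move: (#|F|%:R^-1 : R) (#|F|%:R : R) => w u; ring.
by rewrite e muleA -EFinM mulrC qq mul1e.
Qed.

Lemma measurable_disc_pair : measurable_fun setT (fun y : O * O => disc3 y.2 y.1).
Proof.
apply: (@ball_preserving_measurable2 R K v F D) => k y z [h1 h2].
apply/ball_atN/ball_atD; apply: ball_atM (ball_at_refl _ _ _) _.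
  exact: ball_atX.
exact: ball_atX.
Qed.

Lemma measurable_disc_preimage (B : set O) : measurable B ->
  measurable [set y : O * O | B (disc3 y.2 y.1)].
Proof.
move=> mB; rewrite -[X in measurable X]setTI.
exact: (measurable_disc_pair measurableT mB).
Qed.

(** The section at each b in its residue class has measure independent of b by
    [mu_disc_fiber], so the set has the measure of a rectangle. *)
Lemma pair_disc_fiber (y : F * F) (B : set O) : y \in cubics_deg F -> measurable B ->
  measurable (rho2 @^-1` [set y] `&` [set z | B (disc3 z.2 z.1)]) /\
  M (rho2 @^-1` [set y] `&` [set z | B (disc3 z.2 z.1)]) =
  (mu (B `&` ball_at D 1 0%R) * qi%:E)%E.
Proof.
rewrite inE => /andP[/eqP d0 b0] mB.
have mA : measurable (rho2 @^-1` [set y] `&` [set z | B (disc3 z.2 z.1)]).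
  by apply: measurableI; [exact: measurable_rho2_fiber | exact: measurable_disc_preimage].
split=> //.
have mBm : measurable (B `&` ball_at D 1 0) by apply: measurableI => //; exact: measurable_ball.
have mr : measurable (rho @^-1` [set y.2]) by rewrite residue_fiber_ball; exact: measurable_ball.
have <- : mu (rho @^-1` [set y.2]) = qi%:E.
  by rewrite residue_fiber_ball (haar_ball D mu_haar) expr1.
rewrite -pair_measureX //.
apply: (@product_measure_reparam _ _ _ _ _ _ _ id) => //; first exact: measurableX.
move=> b; have [hb|hb] := pselect (rho b = y.2); last first.
  have -> : ysection ((B `&` ball_at D 1 0) `*` rho @^-1` [set y.2]) b = set0.
    by apply/seteqP; split=> // c /ysectionP[].
  have -> : ysection (rho2 @^-1` [set y] `&` [set z | B (disc3 z.2 z.1)]) b = set0.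
    by apply/seteqP; split=> // c /ysectionP[/= e]; case: hb; rewrite -e.
  by [].
have -> : ysection ((B `&` ball_at D 1 0) `*` rho @^-1` [set y.2]) b = B `&` ball_at D 1 0.
  apply/seteqP; split=> c; first by move=> /ysectionP[].
  by move=> h; apply/ysectionP; split.
transitivity (mu ([set c | rho c = y.1] `&` [set c | B (disc3 b c)])); last first.
  by apply: (mu_disc_fiber mu_haar); rewrite ?hb.
congr (mu _); apply/seteqP; split=> c.
  by move=> /ysectionP[/= <- h]; split.
by move=> [/= e h]; apply/ysectionP; split=> //=; rewrite /rho2 /= e hb -surjective_pairing.
Qed.

(** For fixed b at most two values of c, opposite to each other, make the
    discriminant vanish. *)
Lemma mu_disc0_section (b : O) : 3%:R != 0 :> K ->
  mu [set c | disc3 b c = 0] = 0%E.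
Proof.
move=> k3; apply/eqP; rewrite eq_le measure_ge0 andbT.
have [[c0 hc0]|no] := pselect (exists c, disc3 b c = 0); last first.
  have -> : [set c | disc3 b c = 0] = set0.
    by apply/seteqP; split=> // c hc; apply: no; exists c.
  by rewrite measure0.
have -> : [set c | disc3 b c = 0] = [set c0] `|` [set - c0].
  apply/seteqP; split=> c.
    rewrite /mkset => hc; have e : 27%:R * ((c - c0) * (c + c0)) = 0.
      rewrite -[RHS]subr0 -{1}hc0 -hc /disc3; ring.
    have : 27%:R * ((val c - val c0) * (val c + val c0)) = 0 :> K.
      by move/(congr1 val): e; rewrite !(rmorph_nat, rmorph0, rmorphM, rmorphB, rmorphD).
    move/eqP; rewrite (natrX _ 3 3) mulf_eq0 expf_eq0 (negPf k3) /= mulf_eq0 subr_eq0 addr_eq0.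
    move=> /orP[] /eqP h; [left|right]; apply: val_inj => //.
  move=> [->//|->]; rewrite /mkset -hc0 /disc3; ring.
apply: le_trans (measureU2 _ _ _) _; try exact: (set1_measurable D).
by rewrite /= !(mu_set1 D mu_haar) adde0.
Qed.

Lemma pair_disc0 : 3%:R != 0 :> K ->
  measurable [set y : O * O | disc3 y.2 y.1 = 0] /\
  M [set y : O * O | disc3 y.2 y.1 = 0] = 0%E.
Proof.
move=> k3; have mZ : measurable [set y : O * O | disc3 y.2 y.1 = 0].
  by apply: (@measurable_disc_preimage [set 0]); exact: (set1_measurable D).
split=> //; rewrite (@product_measure_const _ _ _ _ _ _ _ _ 0%E) ?mul0e //.
move=> b; rewrite -[RHS](mu_disc0_section b k3); congr (mu _).
by apply/seteqP; split=> c; [move=> /ysectionP | move=> h; apply/ysectionP].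
Qed.

Lemma haar_shift (s : O) (C : set O) : measurable C ->
  mu ((fun x => x - s) @^-1` C) = mu C.
Proof.
move=> mC; rewrite -(mu_haar s mC); congr (mu _); apply/seteqP; split=> x.
  by move=> h; exists (x - s) => //; rewrite addrC subrK.
by move=> [y Cy <-]; rewrite /= addrC addKr.
Qed.

Lemma measurable_shift (s : O) : measurable_fun setT (fun x : O => x - s).
Proof.
apply: (@ball_preserving_measurable R K v F D) => k a b h.
by apply: ball_atD => //; exact: ball_at_refl.
Qed.

Variable third : O.
Hypothesis thirdE : 3%:R * third = 1.

(** With s = a2/3, the cubic is (x+s)^3 + b(x+s) + c for the returned pair (c, b). *)
Definition depress (a : O * O * O) : O * O :=
  let s := third * a.2 in
  let b := a.1.2 - 3%:R * s ^+ 2 in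
  (a.1.1 - (b * s + s ^+ 3), b).

Lemma measurable_depress : measurable_fun setT depress.
Proof.
have mb : measurable_fun setT (fun a : O * O * O => a.1.2 - 3%:R * (third * a.2) ^+ 2).
  have m1 : measurable_fun setT (fun y : O * O => y.1 - 3%:R * (third * y.2) ^+ 2).
    apply: (@ball_preserving_measurable2 R K v F D) => k y z [h1 h2].
    apply: ball_atD => //; apply/ball_atN/ball_atM; first exact: ball_at_refl.
    by apply: ball_atX; apply: ball_atM => //; exact: ball_at_refl.
  apply: (measurableT_comp m1 (g := fun a : O * O * O => (a.1.2, a.2))).
  apply: measurable_fun_pair => //.
  by apply: measurableT_comp => //; exact: measurable_snd.
have mt : measurable_fun setT (fun y : O * O => y.1 * (third * y.2) + (third * y.2) ^+ 3).
  apply: (@ball_preserving_measurable2 R K v F D) => k y z [h1 h2].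
  have hs : ball_at D k (third * y.2) (third * z.2).
    by apply: ball_atM => //; exact: ball_at_refl.
  by apply: ball_atD; [exact: ball_atM | exact: ball_atX].
have ms : measurable_fun setT (fun y : O * O => y.1 - y.2).
  apply: (@ball_preserving_measurable2 R K v F D) => k y z [h1 h2].
  by apply: ball_atD => //; exact: ball_atN.
apply: measurable_fun_pair => //.
apply: (measurableT_comp ms (g := fun a : O * O * O => (a.1.1, _))).
apply: measurable_fun_pair; first by apply: measurableT_comp => //; exact: measurable_fst.
apply: (measurableT_comp mt (g := fun a : O * O * O => (_, a.2))).
exact: measurable_fun_pair.
Qed.

(** For fixed a2 the map (a0, a1) -> (c, b) is a translation in a1 followed, for each
    a1, by a translation in a0. *)
Lemma measure_depress (T : set (O * O)) : measurable T ->
  measurable (depress @^-1` T) /\ (M \x mu)%E (depress @^-1` T) = M T.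
Proof.
move=> mT; have mA : measurable (depress @^-1` T).
  by rewrite -[X in measurable X]setTI; exact: measurable_depress.
split=> //.
transitivity (M T * mu setT)%E; last by rewrite probability_setT mule1.
pose pm : probability (O * O)%type R := (mu \x mu)%E.
apply: (@product_measure_const R _ _ _ _ pm mu (depress @^-1` T) (M T) mA) => a2.
set s := third * a2.
have mA2 : measurable (ysection (depress @^-1` T) a2) by exact: measurable_ysection.
apply: (@product_measure_reparam _ _ _ _ _ _ _ (fun a1 => a1 - 3%:R * s ^+ 2)) => //.
- exact: measurable_shift.
- by move=> C mC; exact: haar_shift.
move=> a1; set b := a1 - 3%:R * s ^+ 2.
transitivity (mu ((fun x => x - (b * s + s ^+ 3)) @^-1` ysection T b)); last first.
  by apply: haar_shift; exact: measurable_ysection.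
congr (mu _); apply/seteqP; split=> a0.
  by move=> /ysectionP/ysectionP h; apply/ysectionP.
by move=> /ysectionP h; apply/ysectionP/ysectionP.
Qed.

End PairMeasure.

(** * Self-similar sets of cubics *)

Section CubicTypes.
Variables (R : realType) (K : fieldType) (v : nonarch_absval R K).
Variables (F : finFieldType) (D : local_datum v F).
Variables (mu : probability (integers v) R).
Hypothesis mu_haar : is_haar mu.
Local Notation O := (integers v).
Local Notation pi := (unif D).
Local Notation rho := (residue D).
Local Notation M := (mu \x mu)%E.
Implicit Types x z a b c : O.

Let qi : R := #|F|%:R^-1.

Definition root_at (y : O * O) : Prop := has_root3 y.2 y.1.
Definition square_at (y : O * O) : Prop := is_square (disc3 y.2 y.1).

Definition split_set : set (O * O) :=
  [set y | [/\ root_at y, square_at y & disc3 y.2 y.1 != 0]].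
Definition quad_set : set (O * O) := [set y | root_at y /\ ~ square_at y].
Definition cyclic_set : set (O * O) := [set y | ~ root_at y /\ square_at y].
Definition sym_set : set (O * O) := [set y | ~ root_at y /\ ~ square_at y].
Definition disc0_set : set (O * O) := [set y | disc3 y.2 y.1 = 0].

(** The image of the dilation (c, b) -> (w^3 c, w^2 b). *)
Definition scaling_box : set (O * O) := ball_at D 3 0 `*` ball_at D 2 0.

Lemma measurable_scaling_box : measurable scaling_box.
Proof. by apply: measurableX; exact: measurable_ball. Qed.

Lemma scaling_boxP (y : O * O) : scaling_box y <-> exists z : O * O, y = (pi ^+ 3 * z.1, pi ^+ 2 * z.2).
Proof.
split=> [[/= /ball_0P[c hc] /ball_0P[b hb]]|[z ->]].
  by exists (c, b); rewrite /= -hc -hb -surjective_pairing.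
by split; apply/ball_0P; eexists.
Qed.

Section Recursion.
Variable T : set (O * O).
Hypothesis T_scale : forall z : O * O, T (pi ^+ 3 * z.1, pi ^+ 2 * z.2) <-> T z.
Hypothesis T0 : ~ T (0, 0).
Hypothesis mT : measurable (T `\` scaling_box).

Let iterate n : set (O * O) := iter n (pi_scaling D) (T `\` scaling_box).

Let iterate_small (k : nat) (y : O * O) : T y ->
  v (val pi) ^+ k < v (val y.1) \/ v (val pi) ^+ k < v (val y.2) -> exists n, iterate n y.
Proof.
elim: k y => [|k IH] y Ty hy.
  by case: hy; rewrite expr0 ltNge absval_int.
have [sy|nsy] := pselect (scaling_box y); last by exists 0%N.
have /scaling_boxP[z yz] := sy; have Tz : T z by apply/T_scale; rewrite -yz.
have [n hn] : exists n, iterate n z.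
  apply: IH => //.
  have step x m : v (val pi) ^+ k.+1 < v (val (pi ^+ m.+1 * x)) -> v (val pi) ^+ k < v (val x).
    rewrite rmorphM rmorphXn absvalM absvalX !exprS -mulrA ltr_pM2l ?absval_pi_gt0 //.
    move=> h; apply: lt_le_trans h _; rewrite ler_piMl ?absval_ge0 //.
    by rewrite -absvalX -rmorphXn absval_int.
  by move: hy; rewrite yz => -[h|h]; [left; exact: (step _ 2%N h)|right; exact: (step _ 1%N h)].
by exists n.+1; apply/pi_scalingP; exists z.
Qed.

Let iterate_T n y : iterate n y -> T y.
Proof.
elim: n y => [|n IH] y; first by case.
by move=> /pi_scalingP[z /IH Tz ->]; exact/T_scale.
Qed.

(** T is the union of the successive dilates of its part outside the scaling box:
    a nonzero pair cannot be divided indefinitely. *)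
Lemma measurable_invariant : measurable T.
Proof.
have -> : T = \bigcup_n iterate n.
  apply/seteqP; split=> y; last by move=> [n _]; exact: iterate_T.
  move=> Ty.
  have [h|h] : y.1 != 0 \/ y.2 != 0.
  - apply: contrapT => h; apply: T0; rewrite (_ : (0, 0) = y) //.
    case: y {Ty} h => c b /= h; congr pair; apply/eqP; rewrite eq_sym; apply: contrapT => /negP n0.
      by apply: h; left.
    by apply: h; right.
  - have h' : val y.1 != 0 by apply: contra h => /eqP e; apply/eqP/val_inj.
    have [k hk] := ball_small D (absval_gt0 v h').
    by have [n hn] := @iterate_small k y Ty (or_introl hk); exists n.
  - have h' : val y.2 != 0 by apply: contra h => /eqP e; apply/eqP/val_inj.
    have [k hk] := ball_small D (absval_gt0 v h').
    by have [n hn] := @iterate_small k y Ty (or_intror hk); exists n.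
apply: bigcupT_measurable => n; elim: n => //= n IH; exact: measurable_pi_scaling.
Qed.

(** The part of T inside the scaling box is the dilate of T, so the measure m of T
    satisfies m = r + q^-5 m. *)
Lemma measure_invariant (r : R) : M (T `\` scaling_box) = r%:E ->
  M T = (r / (1 - qi ^+ 5))%:E.
Proof.
move=> Tr; have mT' := measurable_invariant.
have e : M T = (r%:E + (qi ^+ 5)%:E * M T)%E.
  rewrite -(pair_measure_scale D mu_haar mT') -Tr.
  rewrite [LHS](measureDI _ mT' measurable_scaling_box); congr (_ + _)%E; congr (M _).
  apply/seteqP; split=> y.
    move=> [Ty /scaling_boxP[z yz]]; apply/pi_scalingP; exists z => //.
    by apply/T_scale; rewrite -yz.
  move=> /pi_scalingP[z Tz ->]; split; first exact/T_scale.
  by apply/scaling_boxP; exists z.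
have fT : M T \is a fin_num.
  rewrite ge0_fin_numE //; apply: (@le_lt_trans _ _ (M setT)); last by rewrite pair_measureT ltry.
  by apply: le_measure; rewrite ?inE.
have q5 : 1 - qi ^+ 5 != 0.
  rewrite subr_eq0 eq_sym lt_eqF // exprn_ilt1 //.
    by rewrite invr_ge0 ltW // card_F_gt0.
  by rewrite invf_lt1 ?card_F_gt0 // ltr1n finRing_gt1.
move: e; rewrite -(fineK fT) -EFinM -EFinD => -[e]; congr EFin.
apply: (mulIf q5); rewrite divfK // mulrBr mulr1 {1}e; ring.
Qed.

End Recursion.

End CubicTypes.

(** * The four types outside the scaling box *)

Section TypeRegions.
Variables (R : realType) (K : fieldType) (v : nonarch_absval R K).
Variables (F : finFieldType) (D : local_datum v F).
Local Notation O := (integers v).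
Local Notation pi := (unif D).
Local Notation rho := (residue D).
Implicit Types x a b c : O.
Implicit Types y z : O * O.

Let h2 : 2%:R != 0 :> F := two_neq0 D.
Let h3 : 3%:R != 0 :> F := three_neq0 D.

(** v(c) = 1 and v(b) >= 1: an Eisenstein cubic. *)
Definition region1 : set (O * O) :=
  (ball_at D 1 0 `\` ball_at D 2 0) `*` ball_at D 1 0.
(** v(c) = 2 and v(b) >= 2. *)
Definition region2 : set (O * O) :=
  (ball_at D 2 0 `\` ball_at D 3 0) `*` ball_at D 2 0.

Lemma shellP k x : (ball_at D k 0 `\` ball_at D k.+1 0) x <->
  exists u, rho u != 0 /\ x = pi ^+ k * u.
Proof.
split=> [[/ball_0P[u ->] nb]|[u [u0 ->]]].
  exists u; split=> //; apply/eqP => u0; apply: nb.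
  by have [w ->] := residue_dvd u0; apply/ball_0P; exists w; rewrite exprSr mulrA.
split; first by apply/ball_0P; exists u.
move=> /ball_0P[w]; rewrite exprSr -mulrA => /pi_expr_cancel uw.
by move: u0; rewrite uw rmorphM residue_pi mul0r eqxx.
Qed.

Lemma region1P y : region1 y <-> exists c b, rho c != 0 /\ y = (pi * c, pi * b).
Proof.
split=> [[/shellP[c [c0 e1]] /ball_0P[b e2]]|[c [b [c0 ->]]]].
  by exists c, b; split=> //; rewrite -[pi]expr1 -e1 -e2 -surjective_pairing.
split; first by apply/shellP; exists c; rewrite expr1.
by apply/ball_0P; exists b; rewrite expr1.
Qed.

Lemma region2P y : region2 y <->
  exists c b, rho c != 0 /\ y = (pi ^+ 2 * c, pi ^+ 2 * b).
Proof.
split=> [[/shellP[c [c0 e1]] /ball_0P[b e2]]|[c [b [c0 ->]]]].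
  by exists c, b; split=> //; rewrite -e1 -e2 -surjective_pairing.
split; first by apply/shellP; exists c.
by apply/ball_0P; exists b.
Qed.

(** When the reduced discriminant and b vanish, so does c since 27 is invertible. *)
Lemma residue_cases y :
  [\/ disc2 (rho2 D y) != 0, rho2 D y \in cubics_deg F | rho y.1 = 0 /\ rho y.2 = 0].
Proof.
have [d0|d0] := eqVneq (disc2 (rho2 D y)) 0; last by constructor 1.
have [b0|b0] := eqVneq (rho y.2) 0; last by constructor 2; rewrite inE d0 eqxx.
constructor 3; split=> //; have [x [_ /= eb ec]] := disc3_eq0_splits h2 h3 d0.
have : 3%:R * x ^+ 2 = 0 by rewrite -[RHS]oppr0 -b0 eb; ring.
move/eqP; rewrite mulf_eq0 (negPf h3) expf_eq0 /= => /eqP x0.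
by rewrite ec x0 !mul0r.
Qed.

(** The three shapes of the Newton polygon outside the scaling box; the last one is
    v(b) = 1 and v(c) >= 2. *)
Lemma deep_cases y : rho y.1 = 0 -> rho y.2 = 0 -> ~ scaling_box D y ->
  [\/ region1 y, region2 y |
      exists c b, rho b != 0 /\ y = (pi ^+ 2 * c, pi * b)].
Proof.
move=> /residue_dvd[c1 e1] /residue_dvd[b1 e2] nsm.
have yE : y = (pi * c1, pi * b1) by rewrite -e1 -e2 -surjective_pairing.
have [/residue_dvd[c2 e3]|c10] := eqVneq (rho c1) 0; last first.
  by constructor 1; apply/region1P; exists c1, b1.
have [/residue_dvd[b2 e4]|b10] := eqVneq (rho b1) 0; last first.
  by constructor 3; exists c2, b1; rewrite yE e3 expr2 mulrA.
have [/residue_dvd[c3 e5]|c20] := eqVneq (rho c2) 0; last first.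
  by constructor 2; apply/region2P; exists c2, b2; rewrite yE e3 e4 expr2 !mulrA.
exfalso; apply: nsm; apply/scaling_boxP; exists (c3, b2) => /=.
by rewrite yE e3 e4 e5; congr pair; ring.
Qed.

Lemma scaling_box_residue y : scaling_box D y -> rho y.1 = 0 /\ rho y.2 = 0.
Proof.
by move=> /scaling_boxP[z ->] /=; rewrite !(rmorphXn, rmorphM) residue_pi !expr0n !mul0r.
Qed.

Lemma scaling_box_rho2 y : scaling_box D y -> disc2 (rho2 D y) = 0 /\ rho2 D y \notin cubics_deg F.
Proof.
move=> /scaling_box_residue[c0 b0]; rewrite inE /disc2 /rho2 /= c0 b0 eqxx andbF; split=> //.
by rewrite /disc3; ring.
Qed.

Lemma disc_residue y : rho (disc3 y.2 y.1) = disc2 (rho2 D y).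
Proof. exact: disc3_residue. Qed.

Lemma unit_root y : disc2 (rho2 D y) != 0 -> root_at y <-> rootb (rho2 D y).
Proof. by move=> d0; rewrite /root_at (has_root3_unit d0); split=> [h|/rootbP//]; exact/rootbP. Qed.

Lemma unit_square y : disc2 (rho2 D y) != 0 -> square_at y <-> sqb (disc2 (rho2 D y)).
Proof.
move=> d0; rewrite /square_at (@square_residue _ _ _ _ D) ?disc_residue //.
by split=> [h|/sqbP//]; exact/sqbP.
Qed.

Lemma deg_root y : rho2 D y \in cubics_deg F -> root_at y.
Proof. by rewrite inE => /andP[/eqP d0 b0]; exact: (has_root3_double d0 b0). Qed.

Lemma region1_type y : region1 y ->
  ~ root_at y /\ (square_at y <-> is_square (- 3%:R : F)).
Proof.
move=> /region1P[c [b [c0 ->]]]; split; first exact: noroot_pi1.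
exact: square_disc_pi1.
Qed.

Lemma region2_type y : region2 y ->
  ~ root_at y /\ (square_at y <-> is_square (- 3%:R : F)).
Proof.
move=> /region2P[c [b [c0 ->]]]; split; first exact: noroot_pi2.
exact: square_disc_pi2.
Qed.

Lemma mixed_type c b : rho b != 0 ->
  root_at (pi ^+ 2 * c, pi * b) /\ ~ square_at (pi ^+ 2 * c, pi * b).
Proof.
by move=> b0; split; [exact: has_root3_mixed | exact: nonsquare_disc_mixed].
Qed.

Lemma region_rho2 y : region1 y \/ region2 y -> rho y.1 = 0 /\ rho y.2 = 0 /\ ~ scaling_box D y.
Proof.
move=> h; have [r1 r2] : rho y.1 = 0 /\ rho y.2 = 0.
  by case: h => [/region1P|/region2P] [c [b [_ ->]]] /=;
    rewrite !(rmorphXn, rmorphM) residue_pi ?expr0n !mul0r.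
do 2!split=> //; move=> [s1 _]; case: h => -[[_ n1] _]; apply: n1 => //.
exact: (ball_at_le (isT : (2 <= 3)%N) s1).
Qed.

Lemma region12_disjoint y : region1 y -> region2 y -> False.
Proof. by move=> [[_ n1] _] [[s1 _] _]. Qed.

Lemma split_set_outer : @split_set R K v `\` scaling_box D =
  [set y | rho2 D y \in cubics_split F] `|`
  ([set y : O * O | nonzero_squares (disc3 y.2 y.1)] `&` [set y | rho2 D y \in cubics_deg F]).
Proof.
apply/seteqP; split=> y.
  move=> [[ry sy d0] nsm]; have [dr|dg|[c0 b0]] := residue_cases y.
  - left; rewrite /= inE dr /=; apply/andP; split; first exact: (proj1 (unit_root dr) ry).
    exact: (proj1 (unit_square dr) sy).
  - by right.
  - have [r1|r2|[c [b [b1 ye]]]] := deep_cases c0 b0 nsm.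
    + by have [] := region1_type r1.
    + by have [] := region2_type r2.
    + by have [_ []] := mixed_type c b1; rewrite -ye.
move=> [/= yin|[[d0 sy] dg]].
  move: yin; rewrite inE => /and3P[d0 rt sq]; split; last by move=> /scaling_box_rho2[/eqP]; rewrite (negPf d0).
  split; [exact: (proj2 (unit_root d0) rt)|exact: (proj2 (unit_square d0) sq)|].
  by apply: contra d0 => /eqP d1; rewrite -disc_residue d1 rmorph0.
split; last by move=> /scaling_box_rho2[_]; rewrite dg.
by split=> //; exact: deg_root.
Qed.

Lemma noroot_outer y : ~ root_at y -> ~ scaling_box D y ->
  rho2 D y \in cubics_irr F \/ region1 y \/ region2 y.
Proof.
move=> nr nsm; have [dr|dg|[c0 b0]] := residue_cases y.
- by left; rewrite inE; apply/negP => /(unit_root dr).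
- by case: nr; exact: deg_root.
- have [r1|r2|[c [b [b1 ye]]]] := deep_cases c0 b0 nsm; [by right; left|by right; right|].
  by have [] := mixed_type c b1; rewrite -ye.
Qed.

Lemma irr_disc (w : F * F) : w \in cubics_irr F -> disc2 w != 0.
Proof.
rewrite inE; apply: contra => /eqP /(disc3_eq0_splits h2 h3)[x /splits3_root hx].
by apply/rootbP; exists x.
Qed.

Lemma irr_type y : rho2 D y \in cubics_irr F ->
  [/\ ~ root_at y, square_at y & ~ scaling_box D y].
Proof.
move=> yi; have d0 := irr_disc yi; move: yi; rewrite inE => /negP nr; split.
- by move=> /(unit_root d0).
- apply/unit_square => //; apply/sqbP; apply: finite_noroot_square.
  by move=> /rootbP.
- by move=> /scaling_box_rho2[/eqP]; rewrite (negPf d0).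
Qed.

Lemma cyclic_set_outer : @cyclic_set R K v `\` scaling_box D =
  [set y | rho2 D y \in cubics_irr F] `|`
  ((region1 `|` region2) `&` [set _ | is_square (- 3%:R : F)]).
Proof.
apply/seteqP; split=> y.
  move=> [[nr sy] nsm]; have [|[r|r]] := noroot_outer nr nsm; [by left|right|right].
    by split; [left|apply/(proj2 (region1_type r))].
  by split; [right|apply/(proj2 (region2_type r))].
move=> [/irr_type[]//|[r /= sq]].
have [_ [_ nsm]] := region_rho2 r; split=> //.
by case: r => r; [have [nr sy] := region1_type r | have [nr sy] := region2_type r];
  split=> //; apply/sy.
Qed.

Lemma sym_set_outer : @sym_set R K v `\` scaling_box D =
  (region1 `|` region2) `&` [set _ | ~ is_square (- 3%:R : F)].
Proof.
apply/seteqP; split=> y.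
  move=> [[nr nsy] nsm]; have [|[r|r]] := noroot_outer nr nsm.
  - by move=> /irr_type[].
  - split; first by left.
    by move=> sq; apply: nsy; have [_ ->] := region1_type r.
  - split; first by right.
    by move=> sq; apply: nsy; have [_ ->] := region2_type r.
move=> [r /= nsq]; have [_ [_ nsm]] := region_rho2 r; split=> //.
by case: r => r; [have [nr sy] := region1_type r | have [nr sy] := region2_type r];
  split=> //; move=> /sy.
Qed.

End TypeRegions.

(** * Measures of the types *)

Section Arithmetic.
Variables (R : realFieldType) (Q : R).
Hypothesis Q_gt1 : 1 < Q.
Let S : R := Q ^+ 4 + Q ^+ 3 + Q ^+ 2 + Q + 1.
Let Qp : 0 < Q := lt_trans ltr01 Q_gt1.
Let Q0 : Q != 0 := lt0r_neq0 Qp.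
Let Q1 : Q + 1 != 0.
Proof. by rewrite lt0r_neq0 // addr_gt0. Qed.
Let Qm1 : Q - 1 != 0.
Proof. by rewrite lt0r_neq0 // subr_gt0. Qed.
Let S0 : S != 0.
Proof.
by rewrite lt0r_neq0 // /S; do !apply: addr_gt0 => //; apply: exprn_gt0.
Qed.

(** The denominators S in the statement come from summing the dilations: q^5 - 1
    factors as (q - 1) S. *)
Lemma geometric_ratio : 1 - Q^-1 ^+ 5 = (Q - 1) * S / Q ^+ 5.
Proof. by rewrite /S; field. Qed.

Lemma split_arith :
  ((Q - 1) * (Q - 2) / 6%:R * Q^-1 ^+ 2 +
    (Q - 1) * (Q^-1 ^+ 2 * (Q / (2%:R * (Q + 1))) * Q^-1)) / (1 - Q^-1 ^+ 5) =
  1 / 6 - (3 * Q ^+ 4 + Q ^+ 3 + 2 * Q ^+ 2 + 2 * Q + 1) / (6 * (Q + 1) * S).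
Proof.
rewrite geometric_ratio; move: S0; rewrite /S => S0'; field.
by rewrite ?S0' ?Q0 ?Q1 ?Qm1.
Qed.

Lemma cyclic_arith1 :
  ((Q ^+ 2 - 1) / 3%:R * Q^-1 ^+ 2 +
    ((Q^-1 - Q^-1 ^+ 2) * Q^-1 + (Q^-1 ^+ 2 - Q^-1 ^+ 3) * Q^-1 ^+ 2)) / (1 - Q^-1 ^+ 5) =
  1 / 3 - (Q ^+ 2 + Q + 1) / (3 * S) + (Q ^+ 2 + 1) / S.
Proof.
rewrite geometric_ratio; move: S0; rewrite /S => S0'; field.
by rewrite ?S0' ?Q0 ?Qm1.
Qed.

Lemma cyclic_arith0 :
  (Q ^+ 2 - 1) / 3%:R * Q^-1 ^+ 2 / (1 - Q^-1 ^+ 5) =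
  1 / 3 - (Q ^+ 2 + Q + 1) / (3 * S).
Proof.
rewrite geometric_ratio; move: S0; rewrite /S => S0'; field.
by rewrite ?S0' ?Q0 ?Qm1.
Qed.

Lemma sym_arith :
  ((Q^-1 - Q^-1 ^+ 2) * Q^-1 + (Q^-1 ^+ 2 - Q^-1 ^+ 3) * Q^-1 ^+ 2) / (1 - Q^-1 ^+ 5) =
  (Q ^+ 2 + 1) / S.
Proof.
rewrite geometric_ratio; move: S0; rewrite /S => S0'; field.
by rewrite ?S0' ?Q0 ?Qm1.
Qed.

Lemma irr_arith :
  1 / 3 - (Q ^+ 2 + Q + 1) / (3 * S) + (Q ^+ 2 + 1) / S =
  1 / 3 + (2 * Q ^+ 2 - Q + 2) / (3 * S).
Proof.
by move: S0; rewrite /S => S0'; field.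
Qed.

Lemma quad_arith :
  1 - ((1 / 6 - (3 * Q ^+ 4 + Q ^+ 3 + 2 * Q ^+ 2 + 2 * Q + 1) / (6 * (Q + 1) * S)) +
       (1 / 3 + (2 * Q ^+ 2 - Q + 2) / (3 * S))) =
  1 / 2 + (Q ^+ 4 - Q ^+ 3 - 1) / (2 * (Q + 1) * S).
Proof.
by move: S0; rewrite /S => S0'; field; rewrite ?Q1 ?S0'.
Qed.

End Arithmetic.

Section TypeMeasures.
Variables (R : realType) (K : fieldType) (v : nonarch_absval R K).
Variables (F : finFieldType) (D : local_datum v F).
Variables (mu : probability (integers v) R).
Hypothesis mu_haar : is_haar mu.
Local Notation O := (integers v).
Local Notation pi := (unif D).
Local Notation rho := (residue D).
Local Notation M := (mu \x mu)%E.
Implicit Types x a b c : O.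
Implicit Types y z : O * O.

Let Q : R := #|F|%:R.
Let S : R := Q ^+ 4 + Q ^+ 3 + Q ^+ 2 + Q + 1.
Let h2 : 2%:R != 0 :> F := two_neq0 D.
Let h3 : 3%:R != 0 :> F := three_neq0 D.

Let Q_gt1 : 1 < Q. Proof. by rewrite ltr1n finRing_gt1. Qed.
Let Q_gt0 : 0 < Q. Proof. exact: lt_trans Q_gt1. Qed.
Let Q_neq0 : Q != 0. Proof. exact: lt0r_neq0. Qed.

Let natQ (n : nat) : (0 < n)%N -> (n.-1)%:R = n%:R - 1 :> R.
Proof. by case: n => // n _; rewrite -[n.+1]addn1 natrD addrK addn1. Qed.

Let Fgt0 : (0 < #|F|)%N. Proof. by apply/card_gt0P; exists 0. Qed.

(** The linear equation [square_massE], solved with (q - 1)/2 unit square classes. *)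
Lemma square_mass_value : square_mass mu = Q / (2%:R * (Q + 1)).
Proof.
have e := @square_massE R K v F D mu mu_haar; rewrite -/Q in e.
have n2 : #|nz_squares F|%:R * 2%:R = Q - 1.
  by rewrite -natrM card_nz_squares // natQ.
have Q1 : Q + 1 != 0 by rewrite lt0r_neq0 // addr_gt0.
have Qm1 : Q - 1 != 0 by rewrite subr_eq0 gt_eqF.
have e2 : square_mass mu * (2%:R * (Q ^+ 2 - 1)) = (Q - 1) * Q.
  transitivity (2%:R * (square_mass mu * Q ^+ 2 - square_mass mu)); first by ring.
  rewrite -n2 {1}e; field; exact: Q_neq0.
apply: (mulIf Qm1); apply: (mulIf (_ : 2%:R * (Q + 1) != 0)).
  by rewrite mulf_neq0 // pnatr_eq0.
transitivity (square_mass mu * (2%:R * (Q ^+ 2 - 1))); first by ring.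
rewrite e2; field; by rewrite Q1 /= ?pnatr_eq0.
Qed.

Let scale_inv_root z : root_at (pi ^+ 3 * z.1, pi ^+ 2 * z.2) <-> root_at z.
Proof. exact: has_root3_scale. Qed.

Let scale_inv_square z : square_at (pi ^+ 3 * z.1, pi ^+ 2 * z.2) <-> square_at z.
Proof. exact: square_disc_scale. Qed.

Let scale_inv_disc z :
  disc3 (pi ^+ 2 * z.2) (pi ^+ 3 * z.1) = 0 <-> disc3 z.2 z.1 = 0.
Proof.
rewrite disc3_scale; split=> [e|->]; last by rewrite mulr0.
by apply: (@pi_expr_cancel _ _ _ _ D 6); rewrite e mulr0.
Qed.

Let root0 : @root_at R K v (0, 0).
Proof. by exists 0; rewrite /is_root3 /=; ring. Qed.

Let natr_K n : n%:R != 0 :> F -> n%:R != 0 :> K.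
Proof.
move=> n0; have : rho n%:R != 0 by rewrite rmorph_nat.
move=> /residue_neq0 e; apply/eqP => n0'; move: e; rewrite rmorph_nat n0' absval0.
by move/eqP; rewrite eq_sym oner_eq0.
Qed.

Let two_K : 2%:R != 0 :> K := natr_K h2.
Let three_K : 3%:R != 0 :> K := natr_K h3.

Let region_not_irr y : (region1 D `|` region2 D) y -> rho2 D y \in cubics_irr F -> False.
Proof.
move=> /region_rho2[c0 [b0 _]]; rewrite inE => /negP; apply.
by apply/rootbP; exists 0; rewrite /is_root3 /rho2 /= c0 b0; ring.
Qed.

Lemma split_set_scale z :
  split_set (pi ^+ 3 * z.1, pi ^+ 2 * z.2) <-> split_set z.
Proof.
split=> -[hr hs d0]; split.
- exact: (proj1 (scale_inv_root z) hr).
- exact: (proj1 (scale_inv_square z) hs).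
- by apply: contra d0 => /eqP e; apply/eqP/scale_inv_disc.
- exact: (proj2 (scale_inv_root z) hr).
- exact: (proj2 (scale_inv_square z) hs).
- by apply: contra d0 => /eqP /scale_inv_disc /eqP.
Qed.

Lemma cyclic_set_scale z :
  cyclic_set (pi ^+ 3 * z.1, pi ^+ 2 * z.2) <-> cyclic_set z.
Proof. by rewrite /cyclic_set /mkset scale_inv_root scale_inv_square. Qed.

Lemma sym_set_scale z :
  sym_set (pi ^+ 3 * z.1, pi ^+ 2 * z.2) <-> sym_set z.
Proof. by rewrite /sym_set /mkset scale_inv_root scale_inv_square. Qed.

Lemma measure_regions :
  [/\ measurable (region1 D), measurable (region2 D), 
      M (region1 D) = ((Q^-1 - Q^-1 ^+ 2) * Q^-1)%:E &
      M (region2 D) = ((Q^-1 ^+ 2 - Q^-1 ^+ 3) * Q^-1 ^+ 2)%:E].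
Proof.
have mb k := measurable_ball D k 0.
have shell k : mu (ball_at D k 0 `\` ball_at D k.+1 0) = (Q^-1 ^+ k - Q^-1 ^+ k.+1)%:E.
  rewrite measureD //; last by rewrite /= (haar_ball D mu_haar) ltry.
  have -> : ball_at D k 0 `&` ball_at D k.+1 0 = ball_at D k.+1 0.
    by apply/seteqP; split=> [x []//|x h]; split=> //; exact: ball_at_le h.
  by rewrite /= !(haar_ball D mu_haar).
split; try (by apply: measurableX => //; exact: measurableD).
  rewrite pair_measureX //; last exact: measurableD.
  by rewrite shell (haar_ball D mu_haar) -EFinM !expr1.
rewrite pair_measureX //; last exact: measurableD.
by rewrite shell (haar_ball D mu_haar) -EFinM.
Qed.

Lemma measure_regions_union : measurable (region1 D `|` region2 D) /\
  M (region1 D `|` region2 D) =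
  ((Q^-1 - Q^-1 ^+ 2) * Q^-1 + (Q^-1 ^+ 2 - Q^-1 ^+ 3) * Q^-1 ^+ 2)%:E.
Proof.
have [m1 m2 e1 e2] := measure_regions; split; first exact: measurableU.
rewrite EFinD -e1 -e2; apply: measureU => //.
by apply/seteqP; split=> // y [r1 r2]; exact: (region12_disjoint r1 r2).
Qed.

Lemma split_set_measure : measurable (@split_set R K v) /\
  M (@split_set R K v) = (1 / 6 - (3 * Q ^+ 4 + Q ^+ 3 + 2 * Q ^+ 2 + 2 * Q + 1)
                   / (6 * (Q + 1) * S))%:E.
Proof.
have [mA eA] := pair_residue D mu_haar (cubics_split F).
have mN := measurable_nonzero_squares D.
have mdisc := measurable_disc_preimage D mN.
have [mB eB] : measurable ([set y : O * O | nonzero_squares (disc3 y.2 y.1)]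
      `&` [set y | rho2 D y \in cubics_deg F]) /\
    M ([set y : O * O | nonzero_squares (disc3 y.2 y.1)]
      `&` [set y | rho2 D y \in cubics_deg F]) =
    (#|cubics_deg F|%:R * (Q^-1 ^+ 2 * square_mass mu * Q^-1))%:E.
  apply: measure_fibers => w wd; rewrite setIC.
  have [m e] := pair_disc_fiber D mu_haar wd mN; split=> //.
  by rewrite /= e (mu_nonunit_squares D mu_haar) -EFinM.
have disj : [set y | rho2 D y \in cubics_split F] `&`
   ([set y : O * O | nonzero_squares (disc3 y.2 y.1)] `&` [set y | rho2 D y \in cubics_deg F]) = set0.
  apply/seteqP; split=> // y [/=]; rewrite !inE => /and3P[d0 _ _] [_ /andP[]].
  by rewrite (negPf d0).
have mo : measurable (@split_set R K v `\` scaling_box D).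
  by rewrite split_set_outer; exact: measurableU.
have T0 : ~ @split_set R K v (0, 0).
  by move=> [_ _ /negP]; apply; apply/eqP; rewrite /disc3 /=; ring.
split; first exact: (measurable_invariant split_set_scale T0 mo).
have r : M (@split_set R K v `\` scaling_box D) =
   (#|cubics_split F|%:R * Q^-1 ^+ 2 + #|cubics_deg F|%:R * (Q^-1 ^+ 2 * square_mass mu * Q^-1))%:E.
  by rewrite split_set_outer measureU // /= eA eB.
rewrite (measure_invariant mu_haar split_set_scale T0 mo r); congr EFin.
have n1 : #|cubics_split F|%:R * 6%:R = (Q - 1) * (Q - 2).
  rewrite -natrM card_cubics_split // natrM natQ //.
  by rewrite natrB ?finRing_gt1.
have n2 : #|cubics_deg F|%:R = Q - 1 by rewrite card_cubics_deg // natQ.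
have n1' : #|cubics_split F|%:R = (Q - 1) * (Q - 2) / 6%:R.
  by rewrite -n1 mulfK // pnatr_eq0.
rewrite n1' n2 square_mass_value -/Q /S; exact: split_arith.
Qed.

Lemma cyclic_set_measure : measurable (@cyclic_set R K v) /\
  M (@cyclic_set R K v) =
    (if `[< is_square (- 3%:R : F) >] then 1 / 3 - (Q ^+ 2 + Q + 1) / (3 * S) + (Q ^+ 2 + 1) / S
     else 1 / 3 - (Q ^+ 2 + Q + 1) / (3 * S))%:E.
Proof.
have [mA eA] := pair_residue D mu_haar (cubics_irr F).
have [mR eR] := measure_regions_union.
have mc : measurable [set _ : O * O | is_square (- 3%:R : F)].
  have [sq|nsq] := pselect (is_square (- 3%:R : F)).
    by rewrite (_ : [set _ | _] = setT) //; apply/seteqP; split.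
  by rewrite (_ : [set _ | _] = set0) //; apply/seteqP; split.
have T0 : ~ @cyclic_set R K v (0, 0) by move=> [nr _]; exact: (nr root0).
have mo : measurable (@cyclic_set R K v `\` scaling_box D).
  by rewrite cyclic_set_outer; apply: measurableU => //; exact: measurableI.
split; first exact: (measurable_invariant cyclic_set_scale T0 mo).
have n3 : #|cubics_irr F|%:R = (Q ^+ 2 - 1) / 3%:R.
  apply: (mulIf (_ : 3%:R != 0)); first by rewrite pnatr_eq0.
  rewrite divfK ?pnatr_eq0 // -natrM card_cubics_irr // natrB ?natrX //.
  by rewrite expn_gt0 Fgt0.
have disj : [set y | rho2 D y \in cubics_irr F] `&`
    ((region1 D `|` region2 D) `&` [set _ | is_square (- 3%:R : F)]) = set0.
  by apply/seteqP; split=> // y [yi [r _]]; exact: (region_not_irr r yi).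
have r : M (@cyclic_set R K v `\` scaling_box D) =
    (if `[< is_square (- 3%:R : F) >] then
       (Q ^+ 2 - 1) / 3%:R * Q^-1 ^+ 2 +
       ((Q^-1 - Q^-1 ^+ 2) * Q^-1 + (Q^-1 ^+ 2 - Q^-1 ^+ 3) * Q^-1 ^+ 2)
     else (Q ^+ 2 - 1) / 3%:R * Q^-1 ^+ 2)%:E.
  rewrite cyclic_set_outer measureU //; last exact: measurableI.
  rewrite /= eA n3; case: asboolP => sq.
    by rewrite (_ : [set _ | _] = setT) ?setIT ?eR //; apply/seteqP; split.
  rewrite (_ : [set _ | _] = set0) ?setI0 ?measure0 ?adde0 //.
  by apply/seteqP; split.
rewrite (measure_invariant mu_haar cyclic_set_scale T0 mo r).
congr EFin; case: asboolP => _; [exact: cyclic_arith1 | exact: cyclic_arith0].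
Qed.

Lemma sym_set_measure : measurable (@sym_set R K v) /\
  M (@sym_set R K v) =
    (if `[< is_square (- 3%:R : F) >] then 0 else (Q ^+ 2 + 1) / S)%:E.
Proof.
have [mR eR] := measure_regions_union.
have T0 : ~ @sym_set R K v (0, 0) by move=> [nr _]; exact: (nr root0).
have [sq|nsq] := pselect (is_square (- 3%:R : F)).
  have e : @sym_set R K v `\` scaling_box D = set0.
    by rewrite sym_set_outer; apply/seteqP; split=> // y [_].
  have mo : measurable (@sym_set R K v `\` scaling_box D) by rewrite e.
  split; first exact: (measurable_invariant sym_set_scale T0 mo).
  have r : M (@sym_set R K v `\` scaling_box D) = 0%:E by rewrite e measure0.
  rewrite (measure_invariant mu_haar sym_set_scale T0 mo r) mul0r.
  by case: asboolP.
have e : @sym_set R K v `\` scaling_box D = region1 D `|` region2 D.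
  by rewrite sym_set_outer; apply/seteqP; split=> [y []//|y r].
have mo : measurable (@sym_set R K v `\` scaling_box D) by rewrite e.
split; first exact: (measurable_invariant sym_set_scale T0 mo).
have r := eR; rewrite -e in r.
rewrite (measure_invariant mu_haar sym_set_scale T0 mo r); congr EFin.
by case: asboolP => // _; exact: sym_arith.
Qed.

Lemma disc0_type y : disc3 y.2 y.1 = 0 -> root_at y /\ square_at y.
Proof.
move=> d0; split; last by exists 0; rewrite d0 expr0n.
have : disc3 (val y.2) (val y.1) = 0 by rewrite -rmorph_disc3 d0 rmorph0.
move=> /(disc3_eq0_splits two_K three_K)[x /splits3_root hx].
by apply/has_root3_int; exists x.
Qed.

Lemma disc0_measure : measurable (@disc0_set R K v) /\ M (@disc0_set R K v) = 0%E.
Proof. exact: (pair_disc0 D mu_haar three_K). Qed.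

Lemma noroot_measure : measurable [set y | ~ @root_at R K v y] /\
  M [set y | ~ @root_at R K v y] = (1 / 3 + (2 * Q ^+ 2 - Q + 2) / (3 * S))%:E.
Proof.
have [m1 e1] := cyclic_set_measure; have [m2 e2] := sym_set_measure.
have -> : [set y | ~ @root_at R K v y] = @cyclic_set R K v `|` @sym_set R K v.
  apply/seteqP; split=> y; last by move=> [[]|[]].
  by move=> nr; have [sq|nsq] := pselect (square_at y); [left|right].
split; first exact: measurableU.
rewrite measureU //; last by apply/seteqP; split=> // y [[_ sq] [_ /(_ sq)]].
rewrite /= e1 e2 -irr_arith //; case: asboolP => _; rewrite -EFinD; congr EFin; ring.
Qed.

Lemma root_square_measure : measurable [set y | @root_at R K v y /\ square_at y] /\
  M [set y | @root_at R K v y /\ square_at y] = M (@split_set R K v).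
Proof.
have [m1 _] := split_set_measure; have [m0 e0] := disc0_measure.
have -> : [set y | @root_at R K v y /\ square_at y] = @split_set R K v `|` @disc0_set R K v.
  apply/seteqP; split=> y; last by move=> [[]//|/disc0_type].
  move=> [r sq]; have [d0|d0] := eqVneq (disc3 y.2 y.1) 0; first by right.
  by left.
split; first exact: measurableU.
rewrite measureU //; last by apply/seteqP; split=> // y [[_ _ /eqP]].
by rewrite [X in (_ + X)%E]e0 adde0.
Qed.

(** The complement of the other types. *)
Lemma quad_set_measure : measurable (@quad_set R K v) /\
  M (@quad_set R K v) = (1 / 2 + (Q ^+ 4 - Q ^+ 3 - 1) / (2 * (Q + 1) * S))%:E.
Proof.
have [m1 e1] := root_square_measure; have [_ e1'] := split_set_measure.
have [m2 e2] := noroot_measure.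
pose U := [set y | @root_at R K v y /\ square_at y] `|` [set y | ~ @root_at R K v y].
have mU : measurable U by exact: measurableU.
have eU : M U = ((1 / 6 - (3 * Q ^+ 4 + Q ^+ 3 + 2 * Q ^+ 2 + 2 * Q + 1) / (6 * (Q + 1) * S)) +
       (1 / 3 + (2 * Q ^+ 2 - Q + 2) / (3 * S)))%:E.
  rewrite /U measureU //; last by apply/seteqP; split=> // y [[r _] /(_ r)].
  by rewrite EFinD -e2 -e1' -e1.
have qU : @quad_set R K v = ~` U.
  apply/seteqP; split=> y.
    by move=> [r nsq] [[_ /nsq]//|/(_ r)].
  move=> nU; split; first by apply: contrapT => nr; apply: nU; right.
  move=> sq; apply: nU; have [r|nr] := pselect (root_at y); by [left|right].
rewrite qU; split; first exact: measurableC.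
have := probability_setC ((mu \x mu)%E : probability _ R) mU => /= ->.
by rewrite eU -EFinB quad_arith.
Qed.

End TypeMeasures.

(** * Cube roots of unity and conclusion *)

Section NegThree.
Variable F : finFieldType.
Hypotheses (h2 : 2%:R != 0 :> F) (h3 : 3%:R != 0 :> F).

(** Three times the number of irreducible depressed cubics is q^2 - 1, so 3 does not
    divide q. *)
Lemma card_mod3 : (#|F| %% 3 = 1 \/ #|F| %% 3 = 2)%N.
Proof.
have := card_cubics_irr h2 h3; have : (1 < #|F|)%N by exact: finRing_gt1.
rewrite -mulnn; have := divn_eq #|F| 3; have : (#|F| %% 3 < 3)%N by rewrite ltn_mod.
move: #|F| #|cubics_irr F| (#|F| %/ 3)%N (#|F| %% 3)%N => q n k r.
case: r => [|[|[|//]]] _; [|by move=> *; left|by move=> *; right].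
by move=> -> q1 e; exfalso; nia.
Qed.

Lemma cube_root_neg3 (w : F) : w ^+ 3 = 1 -> w != 1 -> is_square (- 3%:R : F).
Proof.
move=> w3 w1; exists (2%:R * w + 1).
have : (w - 1) * (w ^+ 2 + w + 1) = 0.
  by transitivity (w ^+ 3 - 1); [ring | rewrite w3 subrr].
move/eqP; rewrite mulf_eq0 subr_eq0 (negPf w1) /= => /eqP e.
transitivity (4%:R * (w ^+ 2 + w + 1) - 3%:R); last by ring.
by rewrite e mulr0 add0r.
Qed.

(** A square root e of -3 gives the primitive cube root of unity (e - 1)/2, and
    conversely.  If q = 2 modulo 3, then x^q = x forces a cube root of unity to be 1.
    If q = 3k + 1 and 1 is the only cube root of unity, then x^k = 1 for all 3k
    nonzero x, too many roots for x^k - 1. *)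
Lemma neg3_square : is_square (- 3%:R : F) <-> (#|F| %% 3 = 1)%N.
Proof.
split=> [[e he]|q1].
  case: card_mod3 => // q2; exfalso; move: h3.
  pose w := (e - 1) / 2%:R.
  have e2 : w ^+ 2 + w + 1 = 0.
    have -> : w ^+ 2 + w + 1 = (e ^+ 2 + 3%:R) / 4%:R.
      by rewrite /w; field; rewrite h2 (natrM _ 2 2) mulf_neq0.
    by rewrite -he addrC subrr mul0r.
  have w3 : w ^+ 3 = 1.
    transitivity ((w - 1) * (w ^+ 2 + w + 1) + 1); first by ring.
    by rewrite e2 mulr0 add0r.
  have ww : w ^+ 2 = w.
    by have := expf_card w; rewrite {1}(divn_eq #|F| 3) q2 exprD mulnC exprM w3 expr1n mul1r.
  have w0 : w != 0.
    by apply/eqP => w0; move/eqP: w3; rewrite w0 expr0n eq_sym oner_eq0.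
  have w1 : w = 1 by apply: (mulfI w0); rewrite mulr1 -expr2.
  by move: e2; rewrite w1 (_ : _ + _ = 3%:R) => [->|]; [rewrite eqxx | ring].
have [[w [w3 w1]]|nw] := pselect (exists w : F, w ^+ 3 = 1 /\ w != 1).
  exact: cube_root_neg3 w3 w1.
exfalso; pose k := (#|F| %/ 3)%N.
have qk : #|F| = (k * 3 + 1)%N by rewrite {1}(divn_eq #|F| 3) q1.
have k0 : (0 < k)%N by have := finRing_gt1 F; rewrite qk; case: (k).
pose rs := [seq x <- enum F | x != 0].
have srs : size rs = (k * 3)%N.
  have u : uniq rs by rewrite filter_uniq // enum_uniq.
  rewrite -(card_uniqP u) (eq_card (B := predC1 0)) ?cardC1 ?qk ?addn1 //.
  by move=> x; rewrite mem_filter mem_enum andbT.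
have all_k : all k.-unity_root rs.
  apply/allP => x; rewrite mem_filter => /andP[x0 _]; apply/unity_rootP.
  apply: contrapT => /eqP xk; apply: nw; exists (x ^+ k); split=> //.
  by apply: (mulIf x0); rewrite -exprM -exprSr -addn1 -qk expf_card mul1r.
have := max_unity_roots k0 all_k (filter_uniq _ (enum_uniq _)).
by rewrite srs; lia.
Qed.

Lemma legendre_card3 : legendre #|F| 3 = if `[< is_square (- 3%:R : F) >] then 1 else -1.
Proof.
rewrite /legendre /dvdn; case: asboolP => [/neg3_square q1|nsq].
  by rewrite q1 /=; case: existsP => // -[]; exists (Ordinal (isT : (1 < 3)%N)); rewrite /=.
case: card_mod3 => [/neg3_square//|q2]; rewrite q2 /=.
by case: existsP => // -[[[|[|[|]]] //= ? /eqP]]; rewrite q2.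
Qed.

End NegThree.

Lemma local_datum_extension (R : realType) (p : nat) (p_prime : prime p) (p_gt3 : (3 < p)%N)
    (Qp : fieldType) (vp : nonarch_absval R Qp) (Qp_padic : is_padic_field p vp)
    (K : fieldExtType Qp) (vK : nonarch_absval R K)
    (vK_ext : forall x : Qp, vK x%:A = vp x)
    (q : nat) (card_residue : ([set: residue_field vK] #= `I_q)%card) :
  exists (F : finFieldType) (D : local_datum vK F), #|F| = q.
Proof.
have [F [h [hs h0 cF]]] := residue_finField card_residue.
have [w [w0 w1 wmax]] := exists_uniformizer p_prime Qp_padic vK_ext.
have [pi hpi] := lift_int (ltW w1).
have nF n : (0 < n)%N -> (n < p)%N -> n%:R != 0 :> F.
  move=> n0 np; apply/eqP => e; have : h n%:R = 0 by rewrite rmorph_nat.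
  move=> /h0; rewrite rmorph_nat (absval_natr1 p_prime Qp_padic vK_ext) ?ltxx //.
  by apply/negP => /(dvdn_leq n0); rewrite leqNgt np.
have pi0 : val pi != 0 by rewrite hpi.
have pi1 : vK (val pi) < 1 by rewrite hpi.
have pim x : vK x < 1 -> vK x <= vK (val pi) by rewrite hpi; exact: wmax.
exists F; unshelve eexists; last exact: cF.
apply: (@LocalDatum R K vK F pi h) => //.
- by move=> u; apply: (extension_complete Qp_padic vK_ext).
- by apply: nF => //; exact: ltn_trans p_gt3.
- exact: nF.
Qed.

Section CubicIdentification.
Variables (R : realType) (K : fieldType) (v : nonarch_absval R K).
Variables (F : finFieldType) (D : local_datum v F).
Local Notation O := (integers v).
Variable third : O.
Hypothesis thirdE : 3%:R * third = 1.
Hypothesis char0 : forall n, (0 < n)%N -> n%:R != 0 :> K.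
Implicit Type a : O * O * O.

Let h2 : 2%:R != 0 :> K := char0 (isT : (0 < 2)%N).
Let h3 : 3%:R != 0 :> K := char0 (isT : (0 < 3)%N).

Lemma cubic_depress a : cubic a =
  shifted_cubic (val (third * a.2)) (val (depress third a).2) (val (depress third a).1).
Proof.
set y := depress third a; set s := third * a.2.
have e0 : a.1.1 = y.1 + y.2 * s + s ^+ 3 by rewrite /y /depress /= -/s; ring.
have e1 : a.1.2 = y.2 + 3%:R * s ^+ 2 by rewrite /y /depress /= -/s; ring.
have e2 : a.2 = 3%:R * s by rewrite /s mulrA thirdE mul1r.
have v0 : val a.1.1 = val y.1 + val y.2 * val s + val s ^+ 3.
  by rewrite e0 !(rmorphXn, rmorphM, rmorphD).
have v1 : val a.1.2 = val y.2 + 3%:R * val s ^+ 2.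
  by rewrite e1 !(rmorph_nat, rmorphXn, rmorphM, rmorphD).
have v2 : val a.2 = 3%:R * val s by rewrite {1}e2 rmorphM rmorph_nat.
by rewrite -[LHS]/(monic_cubic (val a.1.1) (val a.1.2) (val a.2)) v0 v1 v2.
Qed.

Lemma split_part a : P3_part v [:: 1; 1; 1]%N a <-> split_set (depress third a).
Proof.
rewrite /P3_part /mkset cubic_depress square_free_disc // factors111 //.
rewrite has_root3_int -rmorph_disc3 is_square_int.
split=> [[d0 [hr sq]]|[hr sq d0]].
  by split=> //; apply: contra d0 => /eqP ->; rewrite rmorph0.
by split=> //; apply: contra d0 => /eqP e; apply/eqP/val_inj.
Qed.

Lemma disc_eq0_root_square (b c : O) : disc3 (val b) (val c) = 0 ->
  has_root3 (val b) (val c) /\ is_square (disc3 (val b) (val c)).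
Proof.
move=> d0; split; last by exists 0; rewrite d0 expr0n.
by have [x /splits3_root hx] := disc3_eq0_splits h2 h3 d0; exists x.
Qed.

Lemma quad_part a : P3_part v [:: 2; 1]%N a <-> quad_set (depress third a).
Proof.
rewrite /P3_part /mkset cubic_depress square_free_disc // factors21 //.
rewrite -[quad_set _]/(has_root3 _ _ /\ ~ is_square _) -has_root3_int -is_square_int rmorph_disc3.
split=> [[]//|[hr nsq]]; split=> //; apply/eqP => d0; apply: nsq.
by have [] := disc_eq0_root_square d0.
Qed.

Lemma irr_part a : P3_part v [:: 3]%N a <-> ~ root_at (depress third a).
Proof.
rewrite /P3_part /mkset cubic_depress square_free_disc // factors3 /root_at -has_root3_int.
split=> [[]//|nr]; split=> //; apply/eqP => d0; apply: nr.
by have [] := disc_eq0_root_square d0.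
Qed.

Lemma gal_trivial a : P3_gal v (1%G : {group 'Z_2}) a <->
  root_at (depress third a) /\ square_at (depress third a).
Proof.
rewrite /P3_gal /mkset cubic_depress galois_trivial // /root_at /square_at.
by rewrite -has_root3_int -is_square_int rmorph_disc3.
Qed.

Lemma gal_Z2 a : P3_gal v [set: 'Z_2]%G a <-> quad_set (depress third a).
Proof.
rewrite /P3_gal /mkset cubic_depress galois_Z2 //.
rewrite -[quad_set _]/(has_root3 _ _ /\ ~ is_square _).
by rewrite -has_root3_int -is_square_int rmorph_disc3.
Qed.

Lemma gal_Z3 a : P3_gal v [set: 'Z_3]%G a <-> cyclic_set (depress third a).
Proof.
rewrite /P3_gal /mkset cubic_depress galois_Z3 //.
rewrite -[cyclic_set _]/(~ has_root3 _ _ /\ is_square _).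
by rewrite -has_root3_int -is_square_int rmorph_disc3.
Qed.

Lemma gal_S3 a : P3_gal v [set: 'S_3]%G a <-> sym_set (depress third a).
Proof.
rewrite /P3_gal /mkset cubic_depress galois_S3 //.
rewrite -[sym_set _]/(~ has_root3 _ _ /\ ~ is_square _).
by rewrite -has_root3_int -is_square_int rmorph_disc3.
Qed.

End CubicIdentification.

Theorem theorem4p3 (R : realType) (p : nat) (p_prime : prime p) (p_gt3 : (3 < p)%N)
    (Qp : fieldType) (vp : nonarch_absval R Qp) (Qp_padic : is_padic_field p vp)
    (K : fieldExtType Qp) (vK : nonarch_absval R K)
    (vK_ext : forall x : Qp, vK x%:A = vp x)
    (q : nat) (card_residue : ([set: residue_field vK] #= `I_q)%card)
    (mu : probability (integers vK) R) (mu_haar : is_haar mu) :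
  let nu := ((mu \x mu) \x mu)%E in
  let Q : R := q%:R in
  let S : R := Q ^+ 4 + Q ^+ 3 + Q ^+ 2 + Q + 1 in
  let chi : R := (legendre q 3)%:~R in
  [/\ nu (P3_gal vK (1%G : {group 'Z_2})) = nu (P3_part vK [:: 1; 1; 1]%N) /\
      nu (P3_part vK [:: 1; 1; 1]%N) =
        (1 / 6 - (3 * Q ^+ 4 + Q ^+ 3 + 2 * Q ^+ 2 + 2 * Q + 1)
                   / (6 * (Q + 1) * S))%:E,
      nu (P3_gal vK [set: 'Z_2]%G) = nu (P3_part vK [:: 2; 1]%N) /\
      nu (P3_part vK [:: 2; 1]%N) =
        (1 / 2 + (Q ^+ 4 - Q ^+ 3 - 1) / (2 * (Q + 1) * S))%:E,
      nu (P3_part vK [:: 3]%N) =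
        (1 / 3 + (2 * Q ^+ 2 - Q + 2) / (3 * S))%:E,
      nu (P3_gal vK [set: 'Z_3]%G) =
        (1 / 3 - (Q ^+ 2 + Q + 1) / (3 * S)
           + 1 / 2 * (1 + chi) * ((Q ^+ 2 + 1) / S))%:E
    & nu (P3_gal vK [set: 'S_3]%G) =
        (1 / 2 * (1 - chi) * ((Q ^+ 2 + 1) / S))%:E].
Proof.
move=> nu Q S chi.
have [F [D cF]] := local_datum_extension p_prime p_gt3 Qp_padic vK_ext card_residue.
have char0 := natr_neq0 p_prime Qp_padic vK_ext.
have [third thirdE] : exists t : integers vK, 3%:R * t = 1.
  have [|t ht] := @int_unit R K vK F D 3%:R; first by rewrite rmorph_nat (three_neq0 D).
  by exists t; rewrite mulrC.
have pull (P : set (integers vK * integers vK * integers vK)) T :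
    measurable T -> (forall a, P a <-> T (depress third a)) -> nu P = (mu \x mu)%E T.
  move=> mT PT; have -> : P = depress third @^-1` T.
    by apply/seteqP; split=> a; [move/PT | move=> h; apply/PT].
  by have [_] := measure_depress D mu_haar third mT.
have [m11 e11] := split_set_measure D mu_haar.
have [m11' e11'] := root_square_measure D mu_haar.
have [m10 e10] := quad_set_measure D mu_haar.
have [m0 e0] := noroot_measure D mu_haar.
have [m01 e01] := cyclic_set_measure D mu_haar.
have [m00 e00] := sym_set_measure D mu_haar.
rewrite cF -/Q -/S in e11 e10 e0 e01 e00.
have chiE : chi = if `[< is_square (- 3%:R : F) >] then 1 else -1.
  rewrite /chi -cF (legendre_card3 (two_neq0 D) (three_neq0 D)).
  by case: asboolP.
have half : 1 / 2 * (1 + 1) = 1 :> R by field.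
split.
- by rewrite (pull _ _ m11' (gal_trivial thirdE char0)) (pull _ _ m11 (split_part thirdE char0)) e11' e11.
- by rewrite (pull _ _ m10 (gal_Z2 thirdE char0)) (pull _ _ m10 (quad_part thirdE char0)) e10.
- by rewrite (pull _ _ m0 (irr_part thirdE char0)) e0.
- rewrite (pull _ _ m01 (gal_Z3 thirdE char0)) e01 chiE; congr EFin.
  by case: asboolP => _; rewrite ?half ?mul1r // subrr mulr0 mul0r addr0.
- rewrite (pull _ _ m00 (gal_S3 thirdE char0)) e00 chiE; congr EFin.
  by case: asboolP => _; rewrite ?subrr ?mulr0 ?mul0r // opprK half mul1r.
Qed.
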